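(* Let $G$ be a compact quantum group and let $F:\mathrm{Rep}(G)\to\mathrm{Hilb}$ be the canonical fibre functor. There is a bijective correspondence, induced by $\alpha\mapsto\alpha\otimes\alpha^*$, between: \begin{itemize} \item unitary $*$-isomorphism classes of simple Frobenius monoids in $\mathrm{End}(F)\cong\mathrm{Rep}(A_G)$; \item equivalence classes of (nonzero) unitary pseudonatural transformations whose source is the canonical fibre functor $F$ (and whose target is any fibre functor on $\mathrm{Rep}(G)$). \end{itemize}
   Context: $\mathrm{Rep}(G)$ is the pivotal dagger category of continuous finite-dimensional unitary representations of the compact quantum group $G$; $\mathrm{Hilb}$ is the pivotal dagger category of finite-dimensional Hilbert spaces and linear maps (with the standard pivotal dagger structure). Monoidal categories are treated as strict and as one-object 2-categories. A fibre functor is a $\mathbb{C}$-linear unitary monoidal functor $F':\mathrm{Rep}(G)\to\mathrm{Hilb}$, with multiplicators $m_{X,Y}:F'(X)\otimes F'(Y)\to F'(X\otimes Y)$ and unitor $u:\mathbb{C}\to F'(\mathbb{1})$ (unitary: $F'(f^\dagger)=F'(f)^\dagger$ and $m,u$ unitary). The canonical fibre functor $F$ is the one sending a representation to its underlying Hilbert space. A unitary pseudonatural transformation (UPT) $(\alpha,H):F_1\to F_2$ between fibre functors is a Hilbert space $H\in\mathrm{Hilb}$ together with, for every object $X$ of $\mathrm{Rep}(G)$, a unitary $\alpha_X:F_1(X)\otimes H\to H\otimes F_2(X)$ such that $(\mathrm{id}_H\otimes F_2(f))\circ\alpha_X=\alpha_Y\circ(F_1(f)\otimes\mathrm{id}_H)$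 for $f:X\to Y$; $\alpha_{X\otimes Y}\circ(m^{F_1}_{X,Y}\otimes\mathrm{id}_H)=(\mathrm{id}_H\otimes m^{F_2}_{X,Y})\circ(\alpha_X\otimes\mathrm{id}_{F_2(Y)})\circ(\mathrm{id}_{F_1(X)}\otimes\alpha_Y)$; and $\alpha_{\mathbb{1}}\circ(u^{F_1}\otimes\mathrm{id}_H)=\mathrm{id}_H\otimes u^{F_2}$. It is nonzero if $H\ne0$. Composition: $(\alpha,H)\otimes(\beta,K)$ has Hilbert space $H\otimes K$ and components $(\mathrm{id}_H\otimes\beta_X)\circ(\alpha_X\otimes\mathrm{id}_K)$. A modification $f:(\alpha,H)\to(\beta,H')$ is a linear map $f:H\to H'$ with $\beta_X\circ(\mathrm{id}_{F_1(X)}\otimes f)=(f\otimes\mathrm{id}_{F_2(X)})\circ\alpha_X$ for all $X$; its dagger is the adjoint $f^\dagger$. Fibre functors, UPTs and modifications form the pivotal dagger 2-category $\mathrm{Fun}_u(\mathrm{Rep}(G),\mathrm{Hilb})$, and $\mathrm{End}(F)$ is the monoidal dagger category of UPTs $F\to F$ and modifications. It is isomorphic to the category $\mathrm{Rep}(A_G)$ of finite-dimensional $*$-representations of the compact quantum group algebra $A_G$ associated to $G$ (the Hopf $*$-algebra of matrix coefficients of finite-dimensional representations of $G$). The right dual of $(\alpha,H):F_1\to F_2$ is $\alpha^*=(\alpha^*,H^* ):F_2\to F_1$ with $(\alpha^* )_X=(\mathrm{id}_{H^*}\otimes\mathrm{id}_{F_1(X)}\otimes\epsilon)\circ(\mathrm{id}_{H^*}\otimes\alpha_X^\dagger\otimes\mathrm{id}_{H^*})\circ(\eta\otimes\mathrm{id}_{F_2(X)}\otimes\mathrm{id}_{H^*})$,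 where $\eta:\mathbb{C}\to H^*\otimes H$ and $\epsilon:H\otimes H^*\to\mathbb{C}$ are the standard coevaluation and evaluation. In a monoidal dagger category, a monoid $(A,m,u)$ is Frobenius if $(m\otimes\mathrm{id})\circ(\mathrm{id}\otimes m^\dagger)=m^\dagger\circ m=(\mathrm{id}\otimes m)\circ(m^\dagger\otimes\mathrm{id})$, and special if $m\circ m^\dagger=\mathrm{id}_A$. A $*$-homomorphism $f:A\to B$ of Frobenius monoids is a morphism with $f\circ m_A=m_B\circ(f\otimes f)$, $f\circ u_A=u_B$ and $f^\dagger=(\mathrm{id}_A\otimes(u_B^\dagger\circ m_B))\circ(\mathrm{id}_A\otimes f\otimes\mathrm{id}_B)\circ((m_A^\dagger\circ u_A)\otimes\mathrm{id}_B)$; a unitary $*$-isomorphism is a unitary $*$-homomorphism. For a nonzero UPT $(\alpha,H)$ with source $F$ and $d=\dim H$, the object $\alpha\otimes\alpha^*$ of $\mathrm{End}(F)$ is a special Frobenius monoid with multiplication $\frac{1}{\sqrt d}(\mathrm{id}_H\otimes\eta^\dagger\otimes\mathrm{id}_{H^*})$ and unit $\sqrt d\,\epsilon^\dagger$. For a nonzero Hilbert space $H$ the same formulas define a special Frobenius monoid $H\otimes H^*$ in $\mathrm{Hilb}$. A special Frobenius monoid in $\mathrm{End}(F)$ is called simple if its underlying Frobenius monoid in $\mathrm{Hilb}$ (forget the components $\alpha_X$) is unitarily $*$-isomorphic to $H\otimes H^*$ for some nonzero finite-dimensional Hilbert space $H$. Two UPTs $\alpha_1:F\to F_1$, $\alpha_2:F\to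 F_2$ are equivalent if there exist a dagger equivalence $E:F_2\to F_1$ in $\mathrm{Fun}_u(\mathrm{Rep}(G),\mathrm{Hilb})$ and a unitary modification $\alpha_1\to\alpha_2\otimes E$. Here a UPT $E:F_2\to F_1$ is a dagger equivalence if there are a UPT $E^{-1}:F_1\to F_2$ and unitary modifications $\mathrm{id}_{F_1}\to E^{-1}\otimes E$ and $E\otimes E^{-1}\to\mathrm{id}_{F_2}$. *)

(* Defs.v *)
From HB Require Import structures.
From mathcomp Require Import all_boot all_order all_algebra.
From mathcomp Require Import complex mxtens.
From mathcomp Require Import boolp classical_sets reals.

Set Implicit Arguments.
Unset Strict Implicit.
Unset Printing Implicit Defensive.

Import Order.TTheory GRing.Theory Num.Theory.
Local Open Scope ring_scope.

(* The category Hilb is presented by its strict (skeletal) matrix model: the   *)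
(* object n : nat is the Hilbert space C^n, with C := R[i] for R : realType;   *)
(* a linear map C^m -> C^n is any matrix 'M[R[i]]_(n, m), and the composite    *)
(* of f followed by g is g *m f.  The tensor product is C^m (x) C^n := C^(m*n) *)
(* on objects and the Kronecker product *t on maps.  It is strictly            *)
(* associative and unital, but only up to the propositional equalities mulnA,  *)
(* mul1n and muln1, so that the identity maps between propositionally equal    *)
(* objects (assoc, unassoc, lunit, ...) are written explicitly.                *)
(* The dual of C^n is C^n, with the basis dual to the standard one.            *)

Section Hilb.
Variable R : realType.
Local Notation C := R[i].

Definition adjmx m n (f : 'M[C]_(m, n)) : 'M[C]_(n, m) :=
  map_mx (@Num.conj C) f^T.

Definition unitary m n (f : 'M[C]_(m, n)) : Prop :=
  adjmx f *m f = 1%:M /\ f *m adjmx f = 1%:M.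

Definition hid n : 'M[C]_n := 1%:M.

Definition assoc a b c : 'M[C]_(a * (b * c), a * b * c) :=
  castmx (esym (mulnA a b c), erefl) 1%:M.
Definition unassoc a b c : 'M[C]_(a * b * c, a * (b * c)) :=
  castmx (mulnA a b c, erefl) 1%:M.
Definition lunit a : 'M[C]_(a, 1 * a) := castmx (mul1n a, erefl) 1%:M.
Definition unlunit a : 'M[C]_(1 * a, a) := castmx (esym (mul1n a), erefl) 1%:M.
Definition runit a : 'M[C]_(a, a * 1) := castmx (muln1 a, erefl) 1%:M.
Definition unrunit a : 'M[C]_(a * 1, a) := castmx (esym (muln1 a), erefl) 1%:M.

(* eta : C -> H^* (x) H  and  epsilon : H (x) H^* -> C *)
Definition coev n : 'M[C]_(n * n, 1) :=
  \matrix_(k, _) ((mxtens_unindex k).1 == (mxtens_unindex k).2)%:R.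
Definition ev n : 'M[C]_(1, n * n) :=
  \matrix_(_, k) ((mxtens_unindex k).1 == (mxtens_unindex k).2)%:R.

End Hilb.

Arguments adjmx {R m n}.
Arguments hid {R}.
Arguments assoc {R} a b c.
Arguments unassoc {R} a b c.
Arguments lunit {R} a.
Arguments unlunit {R} a.
Arguments runit {R} a.
Arguments unrunit {R} a.
Arguments coev {R} n.
Arguments ev {R} n.

Section TensorEquality.
Variables (K : comPzRingType) (A : lmodType K).

Definition bilinear2 (V : lmodType K) (b : A -> A -> V) : Prop :=
  (forall x, linear (b x)) /\ (forall y, linear (b^~ y)).

Definition trilinear3 (V : lmodType K) (t : A -> A -> A -> V) : Prop :=
  [/\ forall x y, linear (t x y), forall x z, linear (fun y => t x y z)
    & forall y z, linear (fun x => t x y z)].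

(* A list [:: (x1, y1); (x2, y2); ...] stands for the element                  *)
(* x1 (x) y1 + x2 (x) y2 + ... of the algebraic tensor product A (x) A. By the *)
(* universal property, two lists denote the same element iff they have the     *)
(* same image under every bilinear map.                                        *)
Definition tens_eq (s t : seq (A * A)) : Prop :=
  forall (V : lmodType K) (b : A -> A -> V), bilinear2 b ->
    \sum_(p <- s) b p.1 p.2 = \sum_(p <- t) b p.1 p.2.

Definition tens3_eq (s t : seq (A * A * A)) : Prop :=
  forall (V : lmodType K) (b : A -> A -> A -> V), trilinear3 b ->
    \sum_(p <- s) b p.1.1 p.1.2 p.2 = \sum_(p <- t) b p.1.1 p.1.2 p.2.

End TensorEquality.

(* The comultiplication chooses, for each x, a list representing Delta(x); all *)
(* the axioms on it are equalities in A (x) A or A (x) A (x) A.                *)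
Record hopf_star_algebra (R : realType) := HopfStarAlgebra {
  hopf_sort :> algType R[i];
  star : hopf_sort -> hopf_sort;
  comul : hopf_sort -> seq (hopf_sort * hopf_sort);
  counit : {lrmorphism hopf_sort -> R[i]^o};
  antipode : {linear hopf_sort -> hopf_sort};
  starL : forall (k : R[i]) x y,
    star (k *: x + y) = Num.conj k *: star x + star y;
  starM : forall x y, star (x * y) = star y * star x;
  starK : involutive star;
  comulL : forall (k : R[i]) x y,
    tens_eq (comul (k *: x + y))
            ([seq (k *: p.1, p.2) | p <- comul x] ++ comul y);
  comul1 : tens_eq (comul 1) [:: (1, 1)];
  comulM : forall x y,
    tens_eq (comul (x * y))
            [seq (p.1 * q.1, p.2 * q.2) | p <- comul x, q <- comul y];
  comul_star : forall x,
    tens_eq (comul (star x)) [seq (star p.1, star p.2) | p <- comul x];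
  comulA : forall x,
    tens3_eq [seq (q.1, q.2, p.2) | p <- comul x, q <- comul p.1]
             [seq (p.1, q.1, q.2) | p <- comul x, q <- comul p.2];
  counitl : forall x, \sum_(p <- comul x) (counit p.1 : R[i]) *: p.2 = x;
  counitr : forall x, \sum_(p <- comul x) (counit p.2 : R[i]) *: p.1 = x;
  antipodel : forall x,
    \sum_(p <- comul x) antipode p.1 * p.2 = (counit x : R[i])%:A;
  antipoder : forall x,
    \sum_(p <- comul x) p.1 * antipode p.2 = (counit x : R[i])%:A
}.

Section Corepresentations.
Variables (R : realType) (A : hopf_star_algebra R).

Definition staradj m n (u : 'M[A]_(m, n)) : 'M[A]_(n, m) :=
  map_mx (@star R A) u^T.

Definition corepresentation n (u : 'M[A]_n) : Prop :=
  forall i j,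
    tens_eq (comul (u i j)) [seq (u i k, u k j) | k <- enum 'I_n].

Definition unitary_corepresentation n (u : 'M[A]_n) : Prop :=
  [/\ corepresentation u, staradj u *m u = 1%:M & u *m staradj u = 1%:M].

Definition unitary_coefficient (a : A) : Prop :=
  exists n (u : 'M[A]_n) i j, unitary_corepresentation u /\ a = u i j.

End Corepresentations.

(* A compact quantum group G is given by its compact quantum group algebra     *)
(* A_G: a Hopf *-algebra linearly spanned by the matrix coefficients of its    *)
(* finite-dimensional unitary corepresentations (Dijkhuizen and Koornwinder).  *)
(* The finite-dimensional unitary representations of G are the                 *)
(* finite-dimensional unitary corepresentations of A_G.                        *)
Record compact_quantum_group (R : realType) := CompactQuantumGroup {
  cqg_algebra :> hopf_star_algebra R;
  cqg_spanned : forall a : cqg_algebra,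
    exists s : seq (R[i] * cqg_algebra),
      (forall p, p \in s -> unitary_coefficient p.2)
      /\ a = \sum_(p <- s) p.1 *: p.2
}.

Section Star.
Variables (R : realType) (A : hopf_star_algebra R).

Lemma star0 : star 0 = 0 :> A.
Proof.
have := starL (-1) (0 : A) 0; rewrite scaler0 addr0 rmorphN rmorph1 scaleN1r.
by rewrite addNr.
Qed.

Lemma starD (x y : A) : star (x + y) = star x + star y.
Proof. by have := starL 1 x y; rewrite rmorph1 !scale1r. Qed.

Lemma starZ (k : R[i]) (x : A) : star (k *: x) = Num.conj k *: star x.
Proof. by have := starL k x 0; rewrite !addr0 star0 addr0. Qed.

Lemma star1 : star 1 = 1 :> A.
Proof. by rewrite -[LHS]mulr1 -{2}[1]starK -starM mulr1 starK. Qed.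

Lemma star_sum I (r : seq I) (F : I -> A) :
  star (\sum_(i <- r) F i) = \sum_(i <- r) star (F i).
Proof. exact: (big_morph _ starD star0). Qed.

Lemma star_in_alg (k : R[i]) : star (k%:A : A) = (Num.conj k)%:A.
Proof. by rewrite starZ star1. Qed.

Lemma staradjM m n p (u : 'M[A]_(m, n)) (v : 'M[A]_(n, p)) :
  staradj (u *m v) = staradj v *m staradj u.
Proof.
apply/matrixP=> i j; rewrite !mxE star_sum; apply: eq_bigr => k _.
by rewrite !mxE starM.
Qed.

Lemma staradj_in_alg m n (f : 'M[R[i]]_(m, n)) :
  staradj (map_mx (in_alg A) f) = map_mx (in_alg A) (adjmx f).
Proof. by apply/matrixP=> i j; rewrite !mxE star_in_alg. Qed.

End Star.

Section MatrixLemmas.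

Lemma tensmx_mul_comm (T : pzRingType) m n p q r s
    (a : 'M[T]_(m, n)) (b : 'M[T]_(p, q)) (c : 'M[T]_(n, r)) (d : 'M[T]_(q, s)) :
  (forall i j k l, GRing.comm (b i j) (c k l)) ->
  (a *t b) *m (c *t d) = (a *m c) *t (b *m d).
Proof.
move=> bc; apply/matrixP=> i j.
case: (mxtens_indexP i)=> [im ip] {i}; case: (mxtens_indexP j)=> [jr js] {j}.
rewrite !mxE !mxtens_indexK mulr_sum; apply: eq_bigr => k _.
by rewrite !mxE !mxtens_indexK -!mulrA; congr (_ * _); rewrite !mulrA bc.
Qed.

Lemma mxtens_sum (T : nmodType) m n (F : 'I_(m * n) -> T) :
  \sum_k F k = \sum_(i < m) \sum_(j < n) F (mxtens_index (i, j)).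
Proof.
rewrite pair_big (reindex (@mxtens_index m n)) //=.
  by apply: eq_bigr => -[i j] _.
by exists (@mxtens_unindex m n) => k _; rewrite ?mxtens_indexK ?mxtens_unindexK.
Qed.

Lemma tensmx11 (T : pzRingType) m n : 1%:M *t 1%:M = 1%:M :> 'M[T]_(m * n).
Proof.
apply/matrixP=> i j.
case: (mxtens_indexP i)=> i0 i1; case: (mxtens_indexP j)=> j0 j1.
rewrite tensmxE !mxE -natrM mulnb (can_eq (@mxtens_indexK m n)).
by rewrite xpair_eqE.
Qed.

Lemma mxtens_indexA a b c (i : 'I_a) (j : 'I_b) (k : 'I_c) :
  cast_ord (mulnA a b c) (mxtens_index (i, mxtens_index (j, k)))
  = mxtens_index (mxtens_index (i, j), k).
Proof. by apply: val_inj; rewrite /= mulnDl mulnA addnA. Qed.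

Lemma tensmxA (T : pzRingType) m n p q r s
    (a : 'M[T]_(m, n)) (b : 'M[T]_(p, q)) (c : 'M[T]_(r, s)) :
  castmx (mulnA _ _ _, mulnA _ _ _) (a *t (b *t c)) = a *t b *t c.
Proof.
apply/matrixP=> i j; rewrite castmxE.
case: (mxtens_indexP i)=> i' k; case: (mxtens_indexP i') => {}i i1 {i'}.
case: (mxtens_indexP j)=> j' l; case: (mxtens_indexP j') => {}j j1 {j'}.
by rewrite -!mxtens_indexA !cast_ordK !tensmxE !mxtens_indexA !tensmxE mulrA.
Qed.

Lemma tens1mx (T : pzRingType) m n (a : 'M[T]_(m, n)) :
  castmx (mul1n _, mul1n _) (1%:M *t a) = a.
Proof. by rewrite tens_scalar1mx castmx_comp castmx_id. Qed.

Lemma tensmx1 (T : pzRingType) m n (a : 'M[T]_(m, n)) :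
  castmx (muln1 _, muln1 _) (a *t (1%:M : 'M_1)) = a.
Proof.
apply/matrixP=> i j; rewrite castmxE.
have cE k (x : 'I_k) : cast_ord (esym (muln1 k)) x = mxtens_index (x, ord0).
  by apply: val_inj; rewrite /= muln1 addn0.
by rewrite !cE tensmxE mxE mulr1.
Qed.

Lemma castid_mul (T : pzRingType) m m' n (e : m = m') (a : 'M[T]_(m, n)) :
  castmx (e, erefl) 1%:M *m a = castmx (e, erefl) a.
Proof. by case: m' / e; rewrite !castmx_id mul1mx. Qed.

Lemma mul_castid (T : pzRingType) m m' n (e : m = m') (a : 'M[T]_(n, m')) :
  a *m castmx (e, erefl) 1%:M = castmx (erefl, esym e) a.
Proof. by case: m' / e a => a; rewrite !castmx_id mulmx1. Qed.

Lemma castid_intertwines (T : pzRingType) m m' (e : m = m') (a : 'M[T]_m)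
    (b : 'M[T]_m') :
  castmx (e, e) a = b ->
  castmx (e, erefl) 1%:M *m a = b *m castmx (e, erefl) 1%:M.
Proof. by move=> <-; case: m' / e b; rewrite !castmx_id mul1mx mulmx1. Qed.

Lemma map_castid (S T : pzRingType) (f : {rmorphism S -> T}) m m' (e : m = m') :
  map_mx f (castmx (e, erefl) 1%:M) = castmx (e, erefl m) 1%:M.
Proof. by case: m' / e; rewrite !castmx_id map_mx1. Qed.

End MatrixLemmas.

Section Rep.
Variables (R : realType) (G : compact_quantum_group R).
Local Notation C := R[i].

Record rep := Rep {
  rdim : nat;
  rmx : 'M[G]_rdim;
  rmxP : unitary_corepresentation rmx
}.

Definition intertwines (X Y : rep) (f : 'M[C]_(rdim Y, rdim X)) : Prop :=
  map_mx (in_alg G) f *m rmx X = rmx Y *m map_mx (in_alg G) f.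

Record rhom (X Y : rep) := RHom {
  hmx :> 'M[C]_(rdim Y, rdim X);
  hmxP : intertwines hmx
}.

Lemma rid_subproof X : intertwines (X := X) (Y := X) 1%:M.
Proof. by rewrite /intertwines map_mx1 mul1mx mulmx1. Qed.
Definition rid X : rhom X X := RHom (@rid_subproof X).

Lemma rcomp_subproof X Y Z (g : rhom Y Z) (f : rhom X Y) :
  intertwines (X := X) (Y := Z) (g *m f).
Proof.
by rewrite /intertwines map_mxM -mulmxA (hmxP f) mulmxA (hmxP g) -mulmxA.
Qed.
Definition rcomp X Y Z (g : rhom Y Z) (f : rhom X Y) : rhom X Z :=
  RHom (rcomp_subproof g f).

Lemma radj_subproof X Y (f : rhom X Y) :
  intertwines (X := Y) (Y := X) (adjmx f).
Proof.
have [_ u1 u2] := rmxP X; have [_ v1 v2] := rmxP Y.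
have := congr1 (@staradj _ _ _ _) (hmxP f); rewrite !staradjM !staradj_in_alg.
move=> /(congr1 (fun M => rmx X *m M *m rmx Y)).
by rewrite !mulmxA u2 mul1mx -!mulmxA v1 mulmx1 => /esym.
Qed.
Definition radj X Y (f : rhom X Y) : rhom Y X := RHom (radj_subproof f).

Lemma rlin_subproof X Y (k : C) (f g : rhom X Y) :
  intertwines (X := X) (Y := Y) (k *: hmx f + hmx g).
Proof.
apply/matrixP=> i j; rewrite !mxE.
have hE (h : rhom X Y) : \sum_l (h i l)%:A * rmx X l j
                         = \sum_l rmx Y i l * (h l j)%:A.
  move/matrixP/(_ i j): (hmxP h); rewrite !mxE.
  under eq_bigr do rewrite mxE.
  by move=> ->; apply: eq_bigr => l _; rewrite mxE.
transitivity (k *: (\sum_l (f i l)%:A * rmx X l j)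
              + \sum_l (g i l)%:A * rmx X l j).
  rewrite scaler_sumr -big_split /=; apply: eq_bigr => l _.
  by rewrite !mxE /= scalerDl mulrDl -scalerA -scalerAl.
rewrite !hE scaler_sumr -big_split /=; apply: eq_bigr => l _.
by rewrite !mxE /= scalerDl mulrDr -scalerA scalerAr.
Qed.
Definition rlin X Y (k : C) (f g : rhom X Y) : rhom X Y :=
  RHom (rlin_subproof k f g).

Lemma rtens_subproof X Y : unitary_corepresentation (rmx X *t rmx Y).
Proof.
have [cu u1 u2] := rmxP X; have [cv v1 v2] := rmxP Y; split.
- move=> i j V b bb.
  case: (mxtens_indexP i)=> i0 i1; case: (mxtens_indexP j)=> j0 j1.
  rewrite tensmxE (comulM _ _ bb) big_allpairs_dep /= exchange_big /=.
  have bE q : bilinear2 (fun x y => b (x * q.1) (y * q.2)).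
    case: bb => b1 b2; split.
      by move=> x k y z; rewrite mulrDl -scalerAl b1.
    by move=> y k x z; rewrite mulrDl -scalerAl b2.
  have bE' p : bilinear2 (fun x y => b (p.1 * x) (p.2 * y)).
    case: bb => b1 b2; split.
      by move=> x k y z; rewrite mulrDr -scalerAr b1.
    by move=> y k x z; rewrite mulrDr -scalerAr b2.
  under eq_bigr => q _ do rewrite (cu i0 j0 _ _ (bE q)) big_map /=.
  rewrite exchange_big /=.
  under eq_bigr => k _ do
    rewrite (cv i1 j1 _ _ (bE' (rmx X i0 k, rmx X k j0))) big_map big_enum /=.
  rewrite big_enum big_map big_enum /= mxtens_sum.
  by apply: eq_bigr => k _; apply: eq_bigr => l _; rewrite !tensmxE.
- apply/matrixP=> i j.
  case: (mxtens_indexP i)=> i0 i1; case: (mxtens_indexP j)=> j0 j1.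
  rewrite -tensmx11 tensmxE mxE mxtens_sum exchange_big /=.
  move/matrixP/(_ i0 j0): u1; move/matrixP/(_ i1 j1): v1.
  rewrite ![(_ *m _) _ _]mxE => <- u1.
  rewrite mulr_sumr; apply: eq_bigr => l _.
  transitivity (star (rmx Y l i1) * (1%:M i0 j0 * rmx Y l j1)); last first.
    rewrite !mxE; case: (i0 == j0); first by rewrite !mul1r.
    by rewrite !mul0r mulr0.
  rewrite -u1 mulr_suml mulr_sumr; apply: eq_bigr => k _.
  by rewrite !mxE !mxtens_indexK /= starM !mulrA.
- apply/matrixP=> i j.
  case: (mxtens_indexP i)=> i0 i1; case: (mxtens_indexP j)=> j0 j1.
  rewrite -tensmx11 tensmxE mxE mxtens_sum /=.
  move/matrixP/(_ i0 j0): u2; move/matrixP/(_ i1 j1): v2.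
  rewrite ![(_ *m _) _ _]mxE => v2 <-.
  rewrite mulr_suml; apply: eq_bigr => k _.
  transitivity (rmx X i0 k * (1%:M i1 j1 * star (rmx X j0 k))); last first.
    rewrite !mxE; case: (i1 == j1); first by rewrite mul1r mulr1.
    by rewrite !mul0r !mulr0.
  rewrite -v2 mulr_suml mulr_sumr; apply: eq_bigr => l _.
  by rewrite !mxE !mxtens_indexK /= starM !mulrA.
Qed.
Definition rtens (X Y : rep) : rep := Rep (rtens_subproof X Y).

Lemma rone_subproof : unitary_corepresentation (1%:M : 'M[G]_1).
Proof.
have s1 : staradj (1%:M : 'M[G]_1) = 1%:M.
  by apply/matrixP=> i j; rewrite !ord1 !mxE /= star1.
rewrite /unitary_corepresentation s1 mulmx1; split=> //.
move=> i j V b bb; rewrite !ord1 mxE (comul1 bb).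
by rewrite big_seq1 big_map big_enum big_ord1 !mxE.
Qed.
Definition rone : rep := Rep rone_subproof.

Lemma rhtens_subproof X X' Y Y' (f : rhom X X') (g : rhom Y Y') :
  intertwines (X := rtens X Y) (Y := rtens X' Y') (hmx f *t hmx g).
Proof.
have cA (k : C) (x : G) : GRing.comm k%:A x.
  by rewrite /GRing.comm -scalerAl mul1r -scalerAr mulr1.
rewrite /intertwines /= map_mxT !tensmx_mul_comm.
- by rewrite !hmxP.
- by move=> i j k l; rewrite mxE; apply/commr_sym/cA.
- by move=> i j k l; rewrite mxE; apply/cA.
Qed.
Definition rhtens X X' Y Y' (f : rhom X X') (g : rhom Y Y') :
    rhom (rtens X Y) (rtens X' Y') :=
  RHom (rhtens_subproof f g).

Lemma rassoc_subproof X Y Z :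
  intertwines (X := rtens (rtens X Y) Z) (Y := rtens X (rtens Y Z))
    (assoc (rdim X) (rdim Y) (rdim Z)).
Proof.
rewrite /intertwines map_castid /=; apply: castid_intertwines.
by rewrite -tensmxA castmx_comp castmx_id.
Qed.
Definition rassoc X Y Z : rhom (rtens (rtens X Y) Z) (rtens X (rtens Y Z)) :=
  RHom (@rassoc_subproof X Y Z).

Lemma rlunit_subproof X :
  intertwines (X := rtens rone X) (Y := X) (lunit (rdim X)).
Proof.
rewrite /intertwines map_castid /=; apply: castid_intertwines.
exact: tens1mx.
Qed.
Definition rlunit X : rhom (rtens rone X) X := RHom (@rlunit_subproof X).

Lemma rrunit_subproof X :
  intertwines (X := rtens X rone) (Y := X) (runit (rdim X)).
Proof.
rewrite /intertwines map_castid /=; apply: castid_intertwines.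
exact: tensmx1.
Qed.
Definition rrunit X : rhom (rtens X rone) X := RHom (@rrunit_subproof X).

End Rep.

Arguments rid {R G} X.
Arguments rone {R G}.
Arguments rassoc {R G} X Y Z.
Arguments rlunit {R G} X.
Arguments rrunit {R G} X.

Record fibre_functor (R : realType) (G : compact_quantum_group R) :=
  FibreFunctor {
  fob :> rep G -> nat;
  fmap : forall X Y, rhom X Y -> 'M[R[i]]_(fob Y, fob X);
  fmul : forall X Y, 'M[R[i]]_(fob (rtens X Y), fob X * fob Y);
  funit : 'M[R[i]]_(fob rone, 1);
  fmap_id : forall X, fmap (rid X) = hid (fob X);
  fmap_comp : forall X Y Z (g : rhom Y Z) (f : rhom X Y),
    fmap (rcomp g f) = fmap g *m fmap f;
  fmap_linear : forall X Y (k : R[i]) (f g : rhom X Y),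
    fmap (rlin k f g) = k *: fmap f + fmap g;
  fmap_adj : forall X Y (f : rhom X Y), fmap (radj f) = adjmx (fmap f);
  fmul_unitary : forall X Y, unitary (fmul X Y);
  funit_unitary : unitary funit;
  fmul_natural : forall X X' Y Y' (f : rhom X X') (g : rhom Y Y'),
    fmap (rhtens f g) *m fmul X Y = fmul X' Y' *m (fmap f *t fmap g);
  fmul_assoc : forall X Y Z,
    fmap (rassoc X Y Z) *m fmul (rtens X Y) Z *m (fmul X Y *t hid (fob Z))
    = fmul X (rtens Y Z) *m (hid (fob X) *t fmul Y Z)
        *m assoc (fob X) (fob Y) (fob Z);
  fmul_unitl : forall X,
    fmap (rlunit X) *m fmul rone X *m (funit *t hid (fob X)) = lunit (fob X);
  fmul_unitr : forall X,
    fmap (rrunit X) *m fmul X rone *m (hid (fob X) *t funit) = runit (fob X)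
}.

Section CanonicalFibreFunctor.
Variables (R : realType) (G : compact_quantum_group R).

Lemma unitary1 n : unitary (1%:M : 'M[R[i]]_n).
Proof. by rewrite /unitary /adjmx trmx1 map_mx1 mulmx1. Qed.

Definition canonical_fibre_functor : fibre_functor G.
Proof.
refine (@FibreFunctor R G (@rdim R G) (fun X Y f => hmx f)
  (fun X Y => 1%:M) 1%:M _ _ _ _ _ _ _ _ _ _) => //.
- by move=> X Y; apply: unitary1.
- exact: unitary1.
- by move=> X X' Y Y' f g; rewrite mulmx1 mul1mx.
- by move=> X Y Z; rewrite /hid !tensmx11 !mulmx1 mul1mx.
- by move=> X; rewrite /hid !tensmx11 !mulmx1.
- by move=> X; rewrite /hid !tensmx11 !mulmx1.
Defined.

End CanonicalFibreFunctor.

Section UPT.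
Variables (R : realType) (G : compact_quantum_group R).
Local Notation C := R[i].
Implicit Types F : fibre_functor G.

(* The data of a UPT, without its axioms. *)
Record pretrans F1 F2 := PreTrans {
  hdim : nat;
  comp : forall X : rep G, 'M[C]_(hdim * F2 X, F1 X * hdim)
}.

Definition is_upt F1 F2 (a : pretrans F1 F2) : Prop :=
  let H := hdim a in
  [/\ forall X, unitary (comp a X),
      forall X Y (f : rhom X Y),
        (hid H *t fmap F2 f) *m comp a X = comp a Y *m (fmap F1 f *t hid H),
      forall X Y,
        comp a (rtens X Y) *m (fmul F1 X Y *t hid H)
        = (hid H *t fmul F2 X Y)
            *m assoc H (F2 X) (F2 Y)
            *m (comp a X *t hid (F2 Y))
            *m unassoc (F1 X) H (F2 Y)
            *m (hid (F1 X) *t comp a Y)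
            *m assoc (F1 X) (F1 Y) H
    & comp a rone *m (funit F1 *t hid H)
      = (hid H *t funit F2) *m unrunit H *m lunit H].

Record upt F1 F2 := UPT {
  upt_data :> pretrans F1 F2;
  uptP : is_upt upt_data
}.

Definition modification F1 F2 (a b : pretrans F1 F2)
    (f : 'M[C]_(hdim b, hdim a)) : Prop :=
  forall X, comp b X *m (hid (F1 X) *t f) = (f *t hid (F2 X)) *m comp a X.

Definition pt_id F : pretrans F F :=
  @PreTrans F F 1 (fun X => unlunit (F X) *m runit (F X)).

Definition pt_tens F1 F2 F3 (a : pretrans F1 F2) (b : pretrans F2 F3) :
    pretrans F1 F3 :=
  @PreTrans F1 F3 (hdim a * hdim b) (fun X =>
    unassoc (hdim a) (hdim b) (F3 X)
      *m (hid (hdim a) *t comp b X)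
      *m assoc (hdim a) (F2 X) (hdim b)
      *m (comp a X *t hid (hdim b))
      *m unassoc (F1 X) (hdim a) (hdim b)).

(* Read from the last line to the first, the intermediate objects are          *)
(* F2 X (x) H^*,  (H^* (x) H) (x) (F2 X (x) H^* ),                             *)
(* H^* (x) ((H (x) F2 X) (x) H^* ),  H^* (x) ((F1 X (x) H) (x) H^* ),          *)
(* (H^* (x) F1 X) (x) (H (x) H^* )  and  H^* (x) F1 X.                         *)
Definition pt_dual F1 F2 (a : pretrans F1 F2) : pretrans F2 F1 :=
  let H := hdim a in
  @PreTrans F2 F1 H (fun X =>
    runit (H * F1 X)
      *m (hid (H * F1 X) *t ev H)
      *m unassoc H (F1 X) (H * H)
      *m (hid H *t assoc (F1 X) H H)
      *m (hid H *t (adjmx (comp a X) *t hid H))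
      *m (hid H *t unassoc H (F2 X) H)
      *m assoc H H (F2 X * H)
      *m (coev H *t hid (F2 X * H))
      *m unlunit (F2 X * H)).

Definition dagger_equivalence F1 F2 (E : upt F1 F2) : Prop :=
  exists E' : upt F2 F1,
    (exists f, unitary f /\
       modification (a := pt_id F2) (b := pt_tens E' E) f)
    /\ (exists g, unitary g /\
       modification (a := pt_tens E E') (b := pt_id F1) g).

Record upt_from F := UPTFrom {
  target : fibre_functor G;
  trans : upt F target;
  trans_nonzero : (0 < hdim trans)%N
}.

Definition upt_equivalent F (a1 a2 : upt_from F) : Prop :=
  exists E : upt (target a2) (target a1),
    dagger_equivalence E /\
    exists f, unitary f /\
      modification (a := trans a1) (b := pt_tens (trans a2) E) f.

End UPT.

Section Frobenius.
Variable R : realType.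
Local Notation C := R[i].

Record hilb_monoid := HilbMonoid {
  mdim : nat;
  mmul : 'M[C]_(mdim, mdim * mdim);
  munit : 'M[C]_(mdim, 1)
}.

Definition special_frobenius (A : hilb_monoid) : Prop :=
  let n := mdim A in let m := mmul A in let u := munit A in
  [/\ m *m (m *t hid n) = m *m (hid n *t m) *m assoc n n n,
      m *m (u *t hid n) = lunit n /\ m *m (hid n *t u) = runit n,
      (m *t hid n) *m unassoc n n n *m (hid n *t adjmx m) = adjmx m *m m,
      adjmx m *m m = (hid n *t m) *m assoc n n n *m (adjmx m *t hid n)
    & m *m adjmx m = hid n].

Definition star_homomorphism (A B : hilb_monoid)
    (f : 'M[C]_(mdim B, mdim A)) : Prop :=
  let a := mdim A in let b := mdim B in
  [/\ f *m mmul A = mmul B *m (f *t f),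
      f *m munit A = munit B
    & adjmx f = runit a
        *m (hid a *t (adjmx (munit B) *m mmul B))
        *m (hid a *t (f *t hid b))
        *m assoc a a b
        *m ((adjmx (mmul A) *m munit A) *t hid b)
        *m unlunit b].

(* The monoid H (x) H^* of endomorphisms of H = C^d. *)
Definition pair_mul d : 'M[C]_(d * d, d * d * (d * d)) :=
  (sqrtC (d%:R : C))^-1 *:
    ((runit d *t hid d)
       *m ((hid d *t adjmx (coev d)) *t hid d)
       *m (assoc d d d *t hid d)
       *m unassoc (d * d) d d).

Definition pair_unit d : 'M[C]_(d * d, 1) := sqrtC (d%:R : C) *: adjmx (ev d).

Definition pair_monoid d : hilb_monoid := HilbMonoid (pair_mul d) (pair_unit d).

End Frobenius.

Arguments pair_mul {R}.
Arguments pair_unit {R}.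
Arguments pair_monoid {R}.

Section FrobeniusEnd.
Variables (R : realType) (G : compact_quantum_group R) (F : fibre_functor G).
Local Notation C := R[i].

(* The data of a monoid in End(F), without its axioms. *)
Record premonoid := PreMonoid {
  pobj : pretrans F F;
  pmul : 'M[C]_(hdim pobj, hdim pobj * hdim pobj);
  punit : 'M[C]_(hdim pobj, 1)
}.

Definition forget (A : premonoid) : hilb_monoid R :=
  HilbMonoid (pmul A) (punit A).

(* Composition, tensor product and dagger of modifications are those of the    *)
(* underlying linear maps, so the Frobenius equations in End(F) are those of   *)
(* the underlying monoid in Hilb.                                              *)
Definition special_frobenius_End (A : premonoid) : Prop :=
  [/\ is_upt (pobj A),
      modification (a := pt_tens (pobj A) (pobj A)) (b := pobj A) (pmul A),
      modification (a := pt_id F) (b := pobj A) (punit A)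
    & special_frobenius (forget A)].

Definition simple (A : premonoid) : Prop :=
  exists d, (0 < d)%N /\
    exists f, unitary f /\
      star_homomorphism (A := forget A) (B := pair_monoid d) f.

Record simple_frobenius := SimpleFrobenius {
  sf_data :> premonoid;
  sf_frobenius : special_frobenius_End sf_data;
  sf_simple : simple sf_data
}.

Definition sf_isomorphic (A B : simple_frobenius) : Prop :=
  exists f, [/\ unitary f, modification (a := pobj A) (b := pobj B) f
              & star_homomorphism (A := forget A) (B := forget B) f].

Definition pair_of_pants F' (a : pretrans F F') : premonoid :=
  @PreMonoid (pt_tens a (pt_dual a)) (pair_mul (hdim a)) (pair_unit (hdim a)).

End FrobeniusEnd.

Section Classes.
Variables (T : Type) (r : T -> T -> Prop).

Definition classes := {P : set T | exists x, P = [set y | r x y]%classic}.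

Definition class_of (x : T) : classes :=
  exist _ [set y | r x y]%classic (ex_intro _ x erefl).

End Classes.

Definition upt_classes (R : realType) (G : compact_quantum_group R)
    (F : fibre_functor G) : Type := classes (@upt_equivalent R G F).

Definition frobenius_classes (R : realType) (G : compact_quantum_group R)
    (F : fibre_functor G) : Type := classes (@sf_isomorphic R G F).

(* Main.v *)
Require Import Defs.
From HB Require Import structures.
From mathcomp Require Import all_boot all_order all_algebra.
From mathcomp Require Import complex mxtens boolp classical_sets reals ring.

Set Implicit Arguments.
Unset Strict Implicit.
Unset Printing Implicit Defensive.

Import Order.TTheory GRing.Theory Num.Theory.
Local Open Scope ring_scope.

(** A transformation alpha : F -> F' with Hilbert space H of dimension h is a
    family of unitary matrices alpha_X over the matrix algebra M_h, with rows
    indexed by F' X and columns by F X, natural and multiplicative in X. The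
    tensor product of H and its dual is M_h with the Hilbert-Schmidt inner
    product, and the product of alpha with its dual acts on it by
      x |-> sum_j alpha(j,k) x alpha(j,i)*.
    Conversely a simple Frobenius monoid in End(F) is, for every X of dimension
    n, a unital star-homomorphism theta_X from M_d to n x n matrices over M_d,
    natural and monoidal in X. Three facts give the bijection.

    Duals. The family dual to alpha has to be unitary ([is_upt_dual]); this also
    makes the monoid structure on the product of alpha with its dual a morphism
    of End(F) ([pants_special_frobenius]). Every X has a conjugate among the
    unitary representations ([conjugate_rep]), obtained as a quotient of a
    multiple of a unitary corepresentation v whose coefficients span those of
    the conjugate of X. Through it the entrywise adjoint w of alpha_X satisfies
    w q1 w* = q2 for positive scalar matrices q1, q2. Since w is also unitary
    under the trace of M_h, a comparison of norms shows that w is unitary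
    ([dual_bunitary_src], [dual_bunitary_tgt], [dual_bunitary]).

    Injectivity. An isomorphism of the monoids of alpha_1 and alpha_2 is inner
    ([inner_pair_isomorphism]), so after conjugation both transformations define
    the same theta. Then alpha_1 alpha_2* commutes with M_h; it is a scalar
    matrix, and defines a unitary monoidal isomorphism between the targets. This
    is a dagger equivalence with one-dimensional Hilbert space
    ([pants_equivalent]). Every dagger equivalence is one-dimensional, and
    cancels in the product with the dual ([equivalent_pants]).

    Surjectivity. Each theta_X is unitarily equivalent to the diagonal
    representation x |-> diag(x, ..., x), by a matrix beta_X over M_d
    ([block_representation]). By Schur's lemma, conjugating intertwiners by beta
    gives scalar matrices. These form a fibre functor F'
    ([twisted_fibre_functor]) with a transformation beta from F' to F, and the
    dual of beta is a transformation F -> F' whose monoid is the given one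
    ([exists_pants]). *)

(** * Adjoints and unitary matrices *)

Section Adjoint.
Variable R : realType.
Local Notation C := R[i].

Definition cjmx m n (f : 'M[C]_(m, n)) : 'M[C]_(m, n) := map_mx (@Num.conj C) f.

Lemma adjmxE m n (f : 'M[C]_(m, n)) i j : adjmx f i j = Num.conj (f j i).
Proof. by rewrite !mxE. Qed.

Lemma adjmxK m n (f : 'M[C]_(m, n)) : adjmx (adjmx f) = f.
Proof. by apply/matrixP=> i j; rewrite !mxE conjCK. Qed.

Lemma adjmxM m n p (f : 'M[C]_(m, n)) (g : 'M[C]_(n, p)) :
  adjmx (f *m g) = adjmx g *m adjmx f.
Proof. by rewrite /adjmx trmx_mul map_mxM. Qed.

Lemma adjmx1 n : adjmx (1%:M : 'M[C]_n) = 1%:M.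
Proof. by rewrite /adjmx trmx1 map_mx1. Qed.

Lemma adjmx0 m n : adjmx (0 : 'M[C]_(m, n)) = 0.
Proof. by rewrite /adjmx trmx0 map_mx0. Qed.

Lemma adjmxD m n (f g : 'M[C]_(m, n)) : adjmx (f + g) = adjmx f + adjmx g.
Proof. by rewrite /adjmx linearD map_mxD. Qed.

Lemma adjmxB m n (f g : 'M[C]_(m, n)) : adjmx (f - g) = adjmx f - adjmx g.
Proof. by rewrite /adjmx linearB map_mxB. Qed.

Lemma adjmxZ m n (k : C) (f : 'M[C]_(m, n)) :
  adjmx (k *: f) = Num.conj k *: adjmx f.
Proof. by rewrite /adjmx linearZ map_mxZ. Qed.

Lemma adjmx_sum m n I (r : seq I) P (F : I -> 'M[C]_(m, n)) :
  adjmx (\sum_(i <- r | P i) F i) = \sum_(i <- r | P i) adjmx (F i).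
Proof. exact: (big_morph _ (@adjmxD m n) (@adjmx0 m n)). Qed.

Lemma adjmx_scalar n (k : C) : adjmx (k%:M : 'M[C]_n) = (Num.conj k)%:M.
Proof. by rewrite /adjmx tr_scalar_mx map_scalar_mx. Qed.

Lemma adjmx_tens m n p q (f : 'M[C]_(m, n)) (g : 'M[C]_(p, q)) :
  adjmx (f *t g) = adjmx f *t adjmx g.
Proof. by rewrite /adjmx trmx_tens map_mxT. Qed.

Lemma cjmxM m n p (f : 'M[C]_(m, n)) (g : 'M[C]_(n, p)) :
  cjmx (f *m g) = cjmx f *m cjmx g.
Proof. exact: map_mxM. Qed.

Lemma adj_cjmx m n (f : 'M[C]_(m, n)) : adjmx (cjmx f) = cjmx (adjmx f).
Proof. by apply/matrixP=> i j; rewrite !mxE. Qed.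

Lemma cj_adjmx m n (f : 'M[C]_(m, n)) : cjmx (adjmx f) = f^T.
Proof. by apply/matrixP=> i j; rewrite !mxE conjCK. Qed.

Lemma tr_cjmx m n (f : 'M[C]_(m, n)) : (cjmx f)^T = adjmx f.
Proof. by apply/matrixP=> i j; rewrite !mxE. Qed.

Lemma tr_adjmx m n (f : 'M[C]_(m, n)) : (adjmx f)^T = cjmx f.
Proof. by rewrite -tr_cjmx trmxK. Qed.

Lemma mxtrace_adj_mul m n (f : 'M[C]_(m, n)) :
  \tr (f *m adjmx f) = \sum_i \sum_j `|f i j| ^+ 2.
Proof.
by apply: eq_bigr => i _; rewrite mxE; apply: eq_bigr => j _; rewrite adjmxE normCK.
Qed.

Lemma mxtrace_adj_mul_ge0 m n (f : 'M[C]_(m, n)) : 0 <= \tr (f *m adjmx f).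
Proof.
rewrite mxtrace_adj_mul; apply: sumr_ge0 => i _; apply: sumr_ge0 => j _.
by rewrite exprn_ge0.
Qed.

Lemma mxtrace_adj_mul_eq0 m n (f : 'M[C]_(m, n)) :
  \tr (f *m adjmx f) = 0 -> f = 0.
Proof.
rewrite mxtrace_adj_mul => /eqP.
rewrite psumr_eq0 => [|i _]; last by apply: sumr_ge0 => j _; rewrite exprn_ge0.
move=> /allP f0; apply/matrixP=> i j; rewrite mxE.
have /= := f0 i (mem_index_enum i).
rewrite psumr_eq0 => [|k _]; last by rewrite exprn_ge0.
move=> /allP /(_ j (mem_index_enum j)) /=.
by rewrite expf_eq0 /= normr_eq0 => /eqP.
Qed.

Lemma mul_adjmx_eq0 m n (f : 'M[C]_(m, n)) : f *m adjmx f = 0 -> f = 0.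
Proof. by move=> f0; apply: mxtrace_adj_mul_eq0; rewrite f0 mxtrace0. Qed.

(** A vector killed by the Gram matrix f f* is killed by f, because its image has
    norm zero, and f has a right inverse. *)
Lemma gram_unit m n (f : 'M[C]_(m, n)) (g : 'M[C]_(n, m)) :
  f *m g = 1%:M -> f *m adjmx f \in unitmx.
Proof.
move=> fg; rewrite -row_free_unit -kermx_eq0; apply/eqP.
set k := kermx _; have k0 : k *m (f *m adjmx f) = 0 := mulmx_ker _.
have : (k *m f) *m adjmx (k *m f) = 0.
  by rewrite adjmxM !mulmxA -[k *m f *m _]mulmxA k0 mul0mx.
move=> /mul_adjmx_eq0 /(congr1 (mulmx^~ g)).
by rewrite -mulmxA fg mulmx1 mul0mx.
Qed.

Lemma unitary_dim m n (f : 'M[C]_(m, n)) : unitary f -> m = n.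
Proof.
by case=> f1 f2; apply/eqP; rewrite eqn_leq (mulmx1_min f1) (mulmx1_min f2).
Qed.

Lemma unitary_adj m n (f : 'M[C]_(m, n)) : unitary f -> unitary (adjmx f).
Proof. by rewrite /unitary adjmxK => -[]. Qed.

Lemma unitaryM m n p (f : 'M[C]_(m, n)) (g : 'M[C]_(n, p)) :
  unitary f -> unitary g -> unitary (f *m g).
Proof.
rewrite /unitary adjmxM => -[f1 f2] [g1 g2]; split.
  by rewrite mulmxA -[_ *m adjmx f *m f]mulmxA f1 mulmx1.
by rewrite mulmxA -[f *m g *m _]mulmxA g2 mulmx1.
Qed.

Lemma unitary_tens m n p q (f : 'M[C]_(m, n)) (g : 'M[C]_(p, q)) :
  unitary f -> unitary g -> unitary (f *t g).
Proof.
by rewrite /unitary adjmx_tens => -[f1 f2] [g1 g2];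
  rewrite !tensmx_mul f1 f2 g1 g2 !tensmx11.
Qed.

Lemma unitary_cjmx m n (f : 'M[C]_(m, n)) : unitary f -> unitary (cjmx f).
Proof.
have c1 k : cjmx (1%:M : 'M_k) = 1%:M by rewrite /cjmx map_mx1.
by rewrite /unitary adj_cjmx -!cjmxM => -[-> ->]; rewrite !c1.
Qed.

End Adjoint.

(** * Matrices over a matrix algebra *)

Section BlockMatrices.
Variables (R : realType) (h : nat).
Local Notation C := R[i].
Local Notation B := 'M[C]_h.

(** The blocks of a transformation with Hilbert space of dimension h lie in M_h;
    a morphism of Hilb enters as a matrix with central blocks. *)
Definition scblk m n (f : 'M[C]_(m, n)) : 'M[B]_(m, n) := map_mx scalar_mx f.
(** The adjoint of the blocks without transposition. Up to complex conjugation of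
    all entries, this is the block matrix of the dual transformation. *)
Definition cadj m n (u : 'M[B]_(m, n)) : 'M[B]_(m, n) := map_mx adjmx u.
Definition badj m n (u : 'M[B]_(m, n)) : 'M[B]_(n, m) := (cadj u)^T.

Lemma scblkM m n p (f : 'M[C]_(m, n)) (g : 'M[C]_(n, p)) :
  scblk (f *m g) = scblk f *m scblk g.
Proof. exact: map_mxM. Qed.

Lemma scblk1 n : scblk (1%:M : 'M[C]_n) = 1%:M.
Proof. exact: map_mx1. Qed.

Lemma scblkT m n (f : 'M[C]_(m, n)) : (scblk f)^T = scblk f^T.
Proof. by rewrite /scblk map_trmx. Qed.

Lemma scblkB m n (f g : 'M[C]_(m, n)) : scblk (f - g) = scblk f - scblk g.
Proof. exact: map_mxB. Qed.

Lemma scblk_tens m n p q (f : 'M[C]_(m, n)) (g : 'M[C]_(p, q)) :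
  scblk (f *t g) = scblk f *t scblk g.
Proof. exact: map_mxT. Qed.

Lemma scblk_comm m n (f : 'M[C]_(m, n)) (b : B) i j :
  GRing.comm (scblk f i j) b.
Proof. by rewrite !mxE; apply: esym; apply: scalar_mxC. Qed.

Lemma scblk_inj m n : (0 < h)%N -> injective (@scblk m n).
Proof.
move=> h0 f g /matrixP fg; apply/matrixP=> i j; have := fg i j; rewrite !mxE.
by case: h h0 => // h' _ /(congr1 (fun b : 'M_h'.+1 => b ord0 ord0)); rewrite !mxE.
Qed.

Lemma cadjK m n (u : 'M[B]_(m, n)) : cadj (cadj u) = u.
Proof. by apply/matrixP=> i j; rewrite !mxE adjmxK. Qed.

Lemma badjE m n (u : 'M[B]_(m, n)) i j : badj u i j = adjmx (u j i).
Proof. by rewrite !mxE. Qed.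

Lemma badjK m n (u : 'M[B]_(m, n)) : badj (badj u) = u.
Proof. by apply/matrixP=> i j; rewrite !badjE adjmxK. Qed.

Lemma badjM m n p (u : 'M[B]_(m, n)) (v : 'M[B]_(n, p)) :
  badj (u *m v) = badj v *m badj u.
Proof.
apply/matrixP=> i j; rewrite !mxE adjmx_sum; apply: eq_bigr => k _.
by rewrite !badjE adjmxM.
Qed.

Lemma badj1 n : badj (1%:M : 'M[B]_n) = 1%:M.
Proof.
apply/matrixP=> i j; rewrite !mxE eq_sym.
by case: (i == j); rewrite ?adjmx0 // mulr1n adjmx1.
Qed.

Lemma badjB m n (u v : 'M[B]_(m, n)) : badj (u - v) = badj u - badj v.
Proof. by apply/matrixP=> i j; rewrite !mxE adjmxB. Qed.

Lemma badj_scblk m n (f : 'M[C]_(m, n)) : badj (scblk f) = scblk (adjmx f).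
Proof. by apply/matrixP=> i j; rewrite !mxE adjmx_scalar. Qed.

Lemma tensmx_mul_scblk m n p q r s (a : 'M[B]_(m, n)) (b : 'M[B]_(p, q))
    (f : 'M[C]_(n, r)) (g : 'M[C]_(q, s)) :
  (a *t b) *m scblk (f *t g) = (a *m scblk f) *t (b *m scblk g).
Proof.
rewrite scblk_tens tensmx_mul_comm // => i j k l.
by apply/commr_sym; apply: scblk_comm.
Qed.

Lemma scblk_mul_tensmx m n p q r s (a : 'M[B]_(m, n)) (b : 'M[B]_(p, q))
    (f : 'M[C]_(r, m)) (g : 'M[C]_(s, p)) :
  scblk (f *t g) *m (a *t b) = (scblk f *m a) *t (scblk g *m b).
Proof. by rewrite scblk_tens tensmx_mul_comm // => i j k l; apply: scblk_comm. Qed.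

(** Transposition of blocks does not reverse products over the noncommutative ring
    M_h; it does when one factor has central blocks. *)
Lemma scblk_mul_tr m n p (f : 'M[C]_(m, n)) (u : 'M[B]_(n, p)) :
  (scblk f *m u)^T = u^T *m scblk f^T.
Proof.
apply/matrixP=> i j; rewrite !mxE; apply: eq_bigr => k _.
by rewrite (scblk_comm f) !mxE.
Qed.

Lemma mul_scblk_tr m n p (f : 'M[C]_(n, p)) (u : 'M[B]_(m, n)) :
  (u *m scblk f)^T = scblk f^T *m u^T.
Proof. by apply: trmx_inj; rewrite scblk_mul_tr !trmxK. Qed.

Definition bunitary m n (u : 'M[B]_(m, n)) : Prop :=
  badj u *m u = 1%:M /\ u *m badj u = 1%:M.

Lemma bunitary_badj m n (u : 'M[B]_(m, n)) : bunitary u -> bunitary (badj u).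
Proof. by case=> u1 u2; split; rewrite badjK. Qed.

(** A Kronecker product over a noncommutative ring is not multiplicative, but the
    two factors of (u *t v)* (u *t v) can be summed one after the other. *)
Lemma bunitary_tens m n p q (u : 'M[B]_(m, n)) (v : 'M[B]_(p, q)) :
  bunitary u -> bunitary v -> bunitary (u *t v).
Proof.
move=> [u1 u2] [v1 v2]; split.
- apply/matrixP=> i j.
  case: (mxtens_indexP i)=> i0 i1; case: (mxtens_indexP j)=> j0 j1.
  move/matrixP/(_ i0 j0): u1; move/matrixP/(_ i1 j1): v1.
  rewrite -tensmx11 tensmxE !mxE mxtens_sum exchange_big /= => v1 u1.
  transitivity (\sum_k adjmx (v k i1) *m ((\sum_l badj u i0 l * u l j0) *m v k j1)).
    apply: eq_bigr => k _; rewrite mulmx_suml mulmx_sumr; apply: eq_bigr => l _.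
    by rewrite badjE !tensmxE adjmxM badjE !mulmxE !mulrA.
  rewrite u1; case: (i0 == j0); last first.
    by rewrite big1 ?mul0r // => k _; rewrite mul0mx mulmx0.
  rewrite mul1r -v1; apply: eq_bigr => k _.
  by rewrite mulr1n mul1mx badjE.
- apply/matrixP=> i j.
  case: (mxtens_indexP i)=> i0 i1; case: (mxtens_indexP j)=> j0 j1.
  move/matrixP/(_ i0 j0): u2; move/matrixP/(_ i1 j1): v2.
  rewrite -tensmx11 tensmxE !mxE mxtens_sum /= => v2 u2.
  transitivity (\sum_k u i0 k *m ((\sum_l v i1 l * badj v l j1) *m adjmx (u j0 k))).
    apply: eq_bigr => k _; rewrite mulmx_suml mulmx_sumr; apply: eq_bigr => l _.
    by rewrite badjE !tensmxE adjmxM badjE !mulmxE !mulrA.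
  rewrite v2; case: (i1 == j1); last first.
    by rewrite big1 ?mulr0 // => k _; rewrite mul0mx mulmx0.
  rewrite mulr1 -u2; apply: eq_bigr => k _.
  by rewrite mulr1n mul1mx badjE.
Qed.

Definition btr n (u : 'M[B]_n) : C := \sum_i \tr (u i i).

Lemma btr_mulC m n (u : 'M[B]_(m, n)) (v : 'M[B]_(n, m)) :
  btr (u *m v) = btr (v *m u).
Proof.
rewrite /btr.
under eq_bigr => i _ do rewrite mxE raddf_sum.
under [RHS]eq_bigr => i _ do rewrite mxE raddf_sum.
rewrite exchange_big; apply: eq_bigr => i _; apply: eq_bigr => j _.
exact: mxtrace_mulC.
Qed.

(** Although transposition is not antimultiplicative over M_h, the trace of M_h only
    sees products up to cyclic permutation, so it may be moved onto both factors. *)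
Lemma btr_mul_tr m n (u : 'M[B]_(m, n)) (v : 'M[B]_(n, m)) :
  btr (u *m v) = btr (u^T *m v^T).
Proof.
rewrite /btr.
under eq_bigr => i _ do rewrite mxE raddf_sum.
under [RHS]eq_bigr => i _ do rewrite mxE raddf_sum.
rewrite exchange_big; apply: eq_bigr => i _; apply: eq_bigr => j _.
by rewrite !mxE.
Qed.

Lemma btr_scblk n (f : 'M[C]_n) : btr (scblk f) = h%:R * \tr f.
Proof.
rewrite /btr /mxtrace mulr_sumr; apply: eq_bigr => i _.
by rewrite !mxE -/(mxtrace _) mxtrace_scalar mulr_natl.
Qed.

Lemma btrB n (u v : 'M[B]_n) : btr (u - v) = btr u - btr v.
Proof. by rewrite /btr -sumrB; apply: eq_bigr => i _; rewrite !mxE raddfB. Qed.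

Lemma btr_badj_mul_eq0 m n (u : 'M[B]_(m, n)) : btr (u *m badj u) = 0 -> u = 0.
Proof.
have -> : btr (u *m badj u) = \sum_i \sum_j \tr (u i j *m adjmx (u i j)).
  rewrite /btr; apply: eq_bigr => i _; rewrite mxE raddf_sum.
  by apply: eq_bigr => j _; rewrite badjE.
move/eqP; rewrite psumr_eq0 => [|i _]; last first.
  by apply: sumr_ge0 => j _; apply: mxtrace_adj_mul_ge0.
move=> /allP u0; apply/matrixP=> i j; rewrite mxE.
have /= := u0 i (mem_index_enum i).
rewrite psumr_eq0 => [|k _]; last exact: mxtrace_adj_mul_ge0.
move=> /allP /(_ j (mem_index_enum j)) /= /eqP.
exact: mxtrace_adj_mul_eq0.
Qed.

Section DualUnitary.
Variables (n1 n2 : nat) (u : 'M[B]_(n2, n1)).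
Hypothesis u_unitary : bunitary u.
Local Notation w := (cadj u).

(** The entrywise adjoint w of a unitary u need not be unitary, but it is so after
    applying the trace of M_h: cyclicity turns it into the unitarity of u. *)
Lemma btr_cadjl (f : 'M[C]_n2) : btr (badj w *m scblk f *m w) = h%:R * \tr f.
Proof.
have [_ u2] := u_unitary.
rewrite btr_mul_tr mul_scblk_tr.
have -> : (badj w)^T = u by rewrite /badj trmxK cadjK.
rewrite -/(badj u) -mulmxA u2 mulmx1 btr_scblk; congr (_ * _).
exact: mxtrace_tr.
Qed.

Lemma btr_cadjr (f : 'M[C]_n1) : btr (w *m scblk f *m badj w) = h%:R * \tr f.
Proof.
have [u1 _] := u_unitary.
rewrite btr_mul_tr mul_scblk_tr.
have -> : (badj w)^T = u by rewrite /badj trmxK cadjK.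
rewrite -/(badj u) -mulmxA u1 mulmx1 btr_scblk; congr (_ * _).
exact: mxtrace_tr.
Qed.

Variables (N1 N2 : nat) (v : 'M[B]_(N2, N1)).
Hypothesis v_unitary : bunitary v.
Variables (s1 : 'M[C]_(n1, N1)) (t1 : 'M[C]_(N1, n1)).
Variables (s2 : 'M[C]_(n2, N2)) (t2 : 'M[C]_(N2, n2)).
Hypothesis ws : w *m scblk s1 = scblk s2 *m v.
Hypothesis vt : v *m scblk t1 = scblk t2 *m w.

(** The entrywise adjoint w of a unitary block matrix u is unitary as soon as it is
    intertwined with a unitary v by s and t, where t s is a self-adjoint idempotent.
    With q = s s* and r = t* t this makes w q1 w* = q2 and w* r2 w = r1, so that w is
    unitary up to the change of weights from q1 to q2. The weights drop out because
    the trace identities for w make w - r2 w q1 vanish. In the same way the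
    finite-dimensional star-representations of a compact quantum group algebra
    factor through its largest quotient of Kac type. *)
Let dual_unitary_aux : (0 < h)%N ->
  s1 *m t1 = 1%:M -> adjmx (t1 *m s1) = t1 *m s1 ->
  s2 *m t2 = 1%:M -> adjmx (t2 *m s2) = t2 *m s2 -> bunitary w.
Proof.
move=> h0 st1 ts1 st2 ts2; have [v1 v2] := v_unitary.
move: ws vt btr_cadjl btr_cadjr; move: (cadj u) => w ws' vt' trl trr.
pose r1 := adjmx t1 *m t1; pose r2 := adjmx t2 *m t2.
pose q1 := s1 *m adjmx s1; pose q2 := s2 *m adjmx s2.
have qr n N (s : 'M[C]_(n, N)) (t : 'M[C]_(N, n)) :
    s *m t = 1%:M -> adjmx (t *m s) = t *m s ->
    (s *m adjmx s) *m (adjmx t *m t) = 1%:M.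
  move=> st ts; rewrite mulmxA -[s *m _ *m _]mulmxA -adjmxM ts.
  by rewrite mulmxA st mul1mx.
have qr1 : q1 *m r1 = 1%:M by apply: qr.
have qr2 : q2 *m r2 = 1%:M by apply: qr.
have rq1 := mulmx1C qr1; have rq2 := mulmx1C qr2.
have wqw : w *m scblk q1 *m badj w = scblk q2.
  rewrite scblkM mulmxA ws' -mulmxA -badj_scblk -badjM ws' badjM mulmxA.
  by rewrite -[_ *m v *m _]mulmxA v2 mulmx1 badj_scblk -scblkM.
have wrw : badj w *m scblk r2 *m w = scblk r1.
  rewrite scblkM -mulmxA -[_ *m _ *m w]mulmxA -vt' -badj_scblk mulmxA -badjM -vt'.
  by rewrite badjM mulmxA -[_ *m badj v *m v]mulmxA v1 mulmx1 badj_scblk -scblkM.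
(* w q1 w* = q2 and w* r2 w = r1 say that z is the inverse of w*; the claim is *)
(* that w = z.                                                                *)
have [z zE] : exists z, z = scblk r2 *m w *m scblk q1.
  by exists (scblk r2 *m w *m scblk q1).
have wz : badj w *m z = 1%:M.
  by rewrite zE !mulmxA wrw -scblkM rq1 scblk1.
have zw : z *m badj w = 1%:M.
  by rewrite zE -!mulmxA [w *m _]mulmxA wqw -scblkM rq2 scblk1.
have tr12 : h%:R * \tr r2 = h%:R * \tr r1 :> C.
  by rewrite -trl wrw btr_scblk.
have r1a : adjmx r1 = r1 by rewrite adjmxM adjmxK.
have r2a : adjmx r2 = r2 by rewrite adjmxM adjmxK.
have q1a : adjmx q1 = q1 by rewrite adjmxM adjmxK.
have badjz : badj z = scblk q1 *m badj w *m scblk r2.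
  by rewrite zE !badjM !badj_scblk r2a q1a mulmxA.
(* The squared norm of (w - z) t1* is a sum of four traces; w* r2 w = r1 and *)
(* the trace identities for w give all four the same value.                 *)
have d0 : (w - z) *m scblk (adjmx t1) = 0.
  apply: btr_badj_mul_eq0.
  rewrite badjM badj_scblk adjmxK mulmxA -[_ *m _ *m scblk t1]mulmxA -scblkM.
  rewrite -[adjmx t1 *m t1]/r1.
  rewrite badjB mulmxBr !mulmxBl.
  rewrite [LHS]btrB [X in X - _]btrB [X in _ - X]btrB.
  have e2 : btr (z *m scblk r1 *m badj w) = h%:R * \tr r1.
    rewrite zE -[_ *m scblk q1 *m _]mulmxA -scblkM qr1 scblk1 mulmx1.
    by rewrite -mulmxA btr_mulC -mulmxA btr_mulC wrw btr_scblk.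
  have e3 : btr (w *m scblk r1 *m badj z) = h%:R * \tr r1.
    rewrite badjz !mulmxA -[w *m _ *m _]mulmxA -scblkM rq1 scblk1 mulmx1.
    by rewrite -mulmxA btr_mulC wrw btr_scblk.
  have e4 : btr (z *m scblk r1 *m badj z) = h%:R * \tr r1.
    rewrite zE -[_ *m scblk q1 *m _]mulmxA -scblkM qr1 scblk1 mulmx1 -zE.
    have wbz : w *m badj z = 1%:M by rewrite -[w]badjK -badjM zw badj1.
    by rewrite -mulmxA wbz mulmx1 btr_scblk.
  rewrite [X in X - _ - _]trr [X in _ - X - _]e2 [X in _ - (X - _)]e3.
  by rewrite [X in _ - (_ - X)]e4 !subrr.
have wze : w = z.
  apply/eqP; rewrite -subr_eq0; apply/eqP.
  move/(congr1 (mulmx^~ (scblk (adjmx s1)))): d0.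
  by rewrite -mulmxA -scblkM -adjmxM st1 adjmx1 scblk1 mulmx1 mul0mx.
by rewrite /bunitary {2}wze wz {1}wze zw.
Qed.

(** The trace identities make w faithful on scalar matrices. Thus a relation
    between s and t on one side of w is inherited by the other side. *)
Lemma scblk_cadj_eq0 p (f : 'M[C]_(p, n2)) :
  (0 < h)%N -> scblk f *m w = 0 -> f = 0.
Proof.
move=> h0 fw0; apply: mxtrace_adj_mul_eq0.
have := btr_cadjl (adjmx f *m f).
rewrite scblkM -!mulmxA fw0 !mulmx0 mxtrace_mulC /btr big1 => [/esym/eqP|i _].
  by rewrite mulf_eq0 pnatr_eq0 -leqn0 leqNgt h0 => /eqP.
by rewrite mxE mxtrace0.
Qed.

Lemma cadj_scblk_eq0 p (f : 'M[C]_(n1, p)) :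
  (0 < h)%N -> w *m scblk f = 0 -> f = 0.
Proof.
move=> h0 wf0; apply: mxtrace_adj_mul_eq0.
have := btr_cadjr (f *m adjmx f).
rewrite scblkM !mulmxA wf0 !mul0mx /btr big1 => [/esym/eqP|i _].
  by rewrite mulf_eq0 pnatr_eq0 -leqn0 leqNgt h0 => /eqP.
by rewrite mxE mxtrace0.
Qed.

Lemma dual_bunitary_src : (0 < h)%N ->
  s1 *m t1 = 1%:M -> adjmx (t1 *m s1) = t1 *m s1 -> bunitary w.
Proof.
move=> h0 st1 ts1; have [v1 v2] := v_unitary.
apply: dual_unitary_aux => //.
  apply/eqP; rewrite -subr_eq0; apply/eqP; apply: scblk_cadj_eq0 => //.
  rewrite scblkB mulmxBl scblk1 mul1mx scblkM -mulmxA -vt mulmxA -ws.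
  by rewrite -mulmxA -scblkM st1 scblk1 mulmx1 subrr.
have e : scblk (t2 *m s2) = v *m scblk (t1 *m s1) *m badj v.
  by rewrite !scblkM mulmxA vt -[_ *m scblk s1]mulmxA ws -!mulmxA v2 mulmx1.
apply: (@scblk_inj _ _ h0).
by rewrite -badj_scblk e !badjM badj_scblk ts1 badjK mulmxA.
Qed.

Lemma dual_bunitary_tgt : (0 < h)%N ->
  s2 *m t2 = 1%:M -> adjmx (t2 *m s2) = t2 *m s2 -> bunitary w.
Proof.
move=> h0 st2 ts2; have [v1 v2] := v_unitary.
apply: dual_unitary_aux => //.
  apply/eqP; rewrite -subr_eq0; apply/eqP; apply: cadj_scblk_eq0 => //.
  rewrite scblkB mulmxBr scblk1 mulmx1 scblkM mulmxA ws -mulmxA vt.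
  by rewrite mulmxA -scblkM st2 scblk1 mul1mx subrr.
have e : scblk (t1 *m s1) = badj v *m scblk (t2 *m s2) *m v.
  by rewrite !scblkM !mulmxA -mulmxA -ws mulmxA -[_ *m scblk t2 *m _]mulmxA -vt
    mulmxA v1 mul1mx.
apply: (@scblk_inj _ _ h0).
by rewrite -badj_scblk e !badjM badj_scblk ts2 badjK mulmxA.
Qed.

End DualUnitary.
End BlockMatrices.

(** * Linear functionals and dual families *)

Section Functionals.
Variables (K : fieldType) (A : lmodType K).

(** A subspace maximal among those that avoid y has codimension one, and the
    coordinate along y modulo this subspace is the functional. *)
Lemma exists_functional (y : A) : y != 0 ->
  exists f : {linear A -> K^o}, f y = 1.
Proof.
move=> y0.
pose lin (M : set A) := forall k x z, M x -> M z -> M (k *: x + z).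
pose P : set (set A) := fun M => ~ M y /\ lin M.
have [F FP totF|M [[My linM] maxM]] := @Zorn_bigcup A P.
  split; first by case=> X FX Xy; have [] := FP X FX.
  move=> k x z [X FX Xx] [Z FZ Zz].
  have [XZ|ZX] := totF X Z FX FZ.
    by exists Z => //; have [_] := FP Z FZ; apply=> //; apply: XZ.
  by exists X => //; have [_] := FP X FX; apply=> //; apply: ZX.
(* The empty set satisfies the closure condition too, so 0 has to be adjoined. *)
have M0 : M 0.
  apply: contrapT => nM0; apply: (maxM (fun x => M x \/ x = 0)).
    split; first by move=> x; left.
    by move/(_ 0 (or_intror erefl)).
  split; first by case=> // /eqP; rewrite (negPf y0).
  move=> k x z [Mx|->] [Mz|->]; rewrite ?scaler0 ?addr0 ?add0r.
  - by left; apply: linM.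
  - case: (pselect (exists z, M z)) => [[t Mt]|]; last by case; exists x.
    by case: nM0; have := linM (-1) t t Mt Mt; rewrite scaleN1r addNr.
  - by left.
  - by right.
have MZ k x : M x -> M (k *: x) by move=> Mx; rewrite -[_ *: _]addr0; apply: linM.
have MB x z : M x -> M z -> M (x - z).
  by move=> Mx Mz; rewrite addrC -scaleN1r; apply: linM.
have exf x : exists k, M (x - k *: y).
  have [Mx|nMx] := pselect (M x); first by exists 0; rewrite scale0r subr0.
  pose N : set A := fun z => exists k, M (z - k *: x).
  have [Ny|nNy] := pselect (N y).
    have [k Mk] := Ny; have k0 : k != 0.
      by apply: contra_notN My => /eqP k0; move: Mk; rewrite k0 scale0r subr0.
    exists k^-1; have := MZ (- k^-1) _ Mk.
    by rewrite scalerBr scalerA mulNr mulVf // !scaleNr scale1r opprK addrC.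
  exfalso; apply: (maxM N).
    split; first by move=> z Mz; exists 0; rewrite scale0r subr0.
    by move/(_ x) => Nx; apply/nMx/Nx; exists 1; rewrite scale1r subrr.
  split=> // k z t [a Ma] [b Mb]; exists (k * a + b).
  have := linM k _ _ Ma Mb.
  by rewrite scalerBr scalerA addrACA -opprD -scalerDl.
have [f fP] := choice exf.
have uniq x k : M (x - k *: y) -> k = f x.
  move=> Mk; have := MB _ _ Mk (fP x).
  rewrite opprB addrC addrA subrK -scalerBl => Mfk.
  apply/eqP; rewrite -subr_eq0; apply: contra_notT My => fk.
  have := MZ (f x - k)^-1 _ Mfk.
  by rewrite scalerA mulVf ?scale1r // -opprB oppr_eq0.
have linf : linear (f : A -> K^o).
  move=> k x z; apply/esym/uniq; rewrite scalerDl -scalerA.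
  have := linM k _ _ (fP x) (fP z).
  by rewrite scalerBr addrACA -opprD.
pose F := GRing.isLinear.Build _ _ _ _ f linf.
exists (HB.pack_for {linear A -> K^o} f F) => /=.
by apply/esym/uniq; rewrite scale1r subrr.
Qed.

(** Gram-Schmidt without an inner product: a new element is corrected by its known
    coordinates, and, if the remainder is not zero, any functional that does not
    vanish on the remainder is corrected in the same way. *)
Lemma dual_family (s : seq A) :
  exists r (x : 'I_r -> A) (f : 'I_r -> {linear A -> K^o}),
  [/\ forall i j, f i (x j) = (i == j)%:R,
      forall a, a \in s -> a = \sum_i (f i a : K) *: x i
    & forall M : set A, M 0 -> (forall k x z, M x -> M z -> M (k *: x + z)) ->
        (forall a, a \in s -> M a) -> forall i, M (x i)].
Proof.
elim: s => [|a s [r [x [f [fx sx Mx]]]]].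
  by exists 0, (fun _ => 0), (fun _ => \0); split=> // -[].
pose q := a - \sum_i (f i a : K) *: x i.
have fq i : f i q = 0.
  rewrite linearB linear_sum (bigD1 i) //= linearZ /= fx eqxx.
  rewrite big1 ?addr0 => [|j ji]; last first.
    by rewrite linearZ /= fx eq_sym (negPf ji) -[LHS]/(_ * _) mulr0.
  by rewrite -[X in _ - X]/(_ * _) mulr1 subrr.
have [q0|q0] := eqVneq q 0.
  exists r, x, f; split=> //.
    move=> b; rewrite inE => /orP[/eqP ->|]; last exact: sx.
    by apply/eqP; rewrite -subr_eq0 -/q q0.
  move=> M M0 linM MS; apply: Mx => // b bs; apply: MS.
  by rewrite inE bs orbT.
have [g gq] := exists_functional q0.
pose h b := g (b - \sum_i (f i b : K) *: x i).
have linh : linear (h : A -> K^o).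
  move=> k b c; rewrite /h -linearP; congr (g _).
  rewrite scalerBr addrACA -opprD; congr (_ - _).
  rewrite scaler_sumr -big_split /=; apply: eq_bigr => i _.
  by rewrite linearP /= scalerDl scalerA.
pose hh := HB.pack_for {linear A -> K^o} h (GRing.isLinear.Build _ _ _ _ h linh).
exists r.+1.
exists (fun i => if unlift ord_max i is Some j then x j else q).
exists (fun i => if unlift ord_max i is Some j then f j else hh).
split.
- move=> i j.
  case: (unliftP ord_max i) => [i' ->|->]; case: (unliftP ord_max j) => [j' ->|->].
  + by rewrite fx (inj_eq lift_inj).
  + by rewrite fq eq_sym (negPf (neq_lift _ _)).
  + rewrite (negPf (neq_lift _ _)) /= /h (bigD1 j') //= fx eqxx scale1r.
    rewrite big1 => [|k kj]; last by rewrite fx (negPf kj) scale0r.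
    by rewrite addr0 subrr linear0.
  + rewrite eqxx /= /h big1 ?subr0 // => k _; by rewrite fq scale0r.
- move=> b; rewrite inE big_ord_recr /= unlift_none.
  have wE (i : 'I_r) : unlift ord_max (widen_ord (leqnSn r) i) = Some i.
    have -> : widen_ord (leqnSn r) i = lift ord_max i.
      by apply: val_inj; rewrite /= /bump leqNgt ltn_ord.
    by rewrite liftK.
  under eq_bigr do rewrite wE.
  case/orP=> [/eqP ->|bs].
    by rewrite /hh /= /h gq scale1r addrC subrK.
  have e : b - \sum_i (f i b : K) *: x i = 0 by rewrite {1}(sx b bs) subrr.
  by rewrite /hh /= /h e linear0 scale0r addr0 -sx.
- move=> M M0 linM MS.
  have Ms b : b \in s -> M b by move=> bs; apply: MS; rewrite inE bs orbT.
  have MX i : M (x i) by apply: Mx.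
  have Mq : M q.
    have MZ k z : M z -> M (k *: z) by move=> Mz; rewrite -[_ *: _]addr0; apply: linM.
    have MD z t : M z -> M t -> M (z + t) by move=> Mz Mt; rewrite -[z]scale1r; apply: linM.
    rewrite /q addrC -scaleN1r; apply: linM; last by apply: MS; rewrite mem_head.
    by elim/big_ind: _ => // i _; apply: MZ.
  by move=> i; case: unliftP.
Qed.

End Functionals.

(** * Unitary corepresentations of a Hopf star-algebra *)

Section CorepBasics.
Variables (R : realType) (A : hopf_star_algebra R).
Local Notation C := R[i].
Local Notation ia := (map_mx (in_alg A)).

Lemma in_algC (k : C) (x : A) : GRing.comm k%:A x.
Proof. by rewrite /GRing.comm -scalerAl mul1r -scalerAr mulr1. Qed.

Lemma mul_in_algl (k : C) (x : A) : k%:A * x = k *: x.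
Proof. by rewrite -scalerAl mul1r. Qed.

(** The value at Delta(x) of the linear map on the tensor square given by b. *)
Definition comul_eval (V : lmodType C) (b : A -> A -> V) (x : A) : V :=
  \sum_(p <- comul x) b p.1 p.2.

Lemma comul_eval_linear (V : lmodType C) (b : A -> A -> V) :
  bilinear2 b -> linear (comul_eval b).
Proof.
move=> bb k x y; rewrite /comul_eval (comulL k x y bb) big_cat big_map /=.
rewrite scaler_sumr; congr (_ + _); apply: eq_bigr => p _.
case: bb => _ b2; have /= := b2 p.2 k p.1 0.
by rewrite !addr0 => ->; have /= := b2 p.2 (-1) 0 0;
  rewrite !(scaler0, addr0) scaleN1r addNr => ->; rewrite addr0.
Qed.

Lemma comul_eval_corep (V : lmodType C) (b : A -> A -> V) n (u : 'M[A]_n) i j :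
  corepresentation u -> bilinear2 b -> comul_eval b (u i j) = \sum_k b (u i k) (u k j).
Proof. by move=> cu bb; rewrite /comul_eval (cu i j V b bb) big_map big_enum. Qed.

Lemma lin_sum (V : lmodType C) (f : A -> V) : linear f ->
  forall I (r : seq I) P (c : I -> C) (F : I -> A),
  f (\sum_(i <- r | P i) c i *: F i) = \sum_(i <- r | P i) c i *: f (F i).
Proof.
move=> lf I r P c F.
have f0 : f 0 = 0 by have := lf (-1) 0 0; rewrite scaler0 addr0 scaleN1r addNr.
have fD x y : f (x + y) = f x + f y by have := lf 1 x y; rewrite !scale1r.
rewrite (big_morph f fD f0); apply: eq_bigr => i _.
by have := lf (c i) (F i) 0; rewrite !addr0 f0 addr0.
Qed.

Section Unitary.
Variables (n : nat) (u : 'M[A]_n).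
Hypothesis uP : unitary_corepresentation u.

(** The matrix e of counits satisfies e u = u, and u is invertible. *)
Lemma corep_counit i j : (@counit R A (u i j) : C) = (i == j)%:R.
Proof.
have [cu u1 u2] := uP.
have bb : bilinear2 (fun x y : A => (@counit R A x : C) *: y).
  split=> [x k y z|y k x z]; first by rewrite scalerDr !scalerA mulrC.
  by rewrite linearP /= scalerDl scalerA.
have e : ia (\matrix_(i, j) (@counit R A (u i j) : C)) *m u = u.
  apply/matrixP=> a b; rewrite !mxE -[RHS]counitl -/(comul_eval _ _).
  rewrite -/(comul_eval (fun x y => (@counit R A x : C) *: y) _) comul_eval_corep //.
  by apply: eq_bigr => k _; rewrite !mxE /= mul_in_algl.
have {}e : ia (\matrix_(i, j) (@counit R A (u i j) : C)) = 1%:M.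
  by rewrite -[LHS]mulmx1 -u2 mulmxA e.
move/matrixP/(_ i j): e; rewrite !mxE /= => /(congr1 (@counit R A)).
by rewrite linearZ /= rmorph1 rmorph_nat -[_ *: _]/(_ * _) mulr1.
Qed.

(** Both matrices are left inverses of u, which is invertible. *)
Lemma corep_antipode i j : @antipode R A (u i j) = star (u j i).
Proof.
have [cu u1 u2] := uP.
have bb : bilinear2 (fun x y : A => @antipode R A x * y).
  split=> [x k y z|y k x z]; first by rewrite mulrDr scalerAr.
  by rewrite linearP /= mulrDl scalerAl.
have e : map_mx (@antipode R A) u *m u = 1%:M.
  apply/matrixP=> a b; rewrite !mxE.
  have := antipodel (u a b).
  rewrite -/(comul_eval (fun x y => @antipode R A x * y) _) comul_eval_corep // corep_counit.
  move=> e; transitivity ((a == b)%:R%:A : A); last by rewrite scaler_nat.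
  by rewrite -e; apply: eq_bigr => k _; rewrite mxE.
have {}e : map_mx (@antipode R A) u = staradj u.
  by rewrite -[LHS]mulmx1 -u2 mulmxA e mul1mx.
by move/matrixP/(_ i j): e; rewrite !mxE.
Qed.

Lemma counit_star i j : (@counit R A (star (u i j)) : C) = (i == j)%:R.
Proof.
have [cu u1 u2] := uP.
have bb : bilinear2 (fun x y : A => @antipode R A x * y).
  split=> [x k y z|y k x z]; first by rewrite mulrDr scalerAr.
  by rewrite linearP /= mulrDl scalerAl.
have := antipodel (u j i).
rewrite -/(comul_eval (fun x y => @antipode R A x * y) _) comul_eval_corep // corep_counit.
move/(congr1 (@counit R A)); rewrite linear_sum /= (bigD1 i) //= big1 => [|k ki].
  rewrite rmorphM linearZ /= rmorph1 corep_counit eqxx mulr1 addr0 corep_antipode.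
  by move=> ->; rewrite eq_sym -[_ *: _]/(_ * _) mulr1.
by rewrite rmorphM /= corep_counit (negPf ki) mulr0.
Qed.

(** The antipode is linear and takes u to u*; scalar matrices pass through it. *)
Lemma antipode_conj m p (f : 'M[C]_(m, n)) (g : 'M[C]_(n, p)) :
  map_mx (@antipode R A) (ia f *m u *m ia g) = ia f *m staradj u *m ia g.
Proof.
apply/matrixP=> i j; rewrite !mxE linear_sum; apply: eq_bigr => k _.
rewrite !mxE !mulr_suml linear_sum; apply: eq_bigr => l _.
rewrite !mxE /= !mul_in_algl -!scalerAl !linearZ /=.
by rewrite -!scalerAr !mulr1 linearZ /= corep_antipode.
Qed.

(** If the kernel of the projection p is invariant under u then so is its range.
    The antipode maps u to u*, hence p u (1 - p) = 0 to p u* (1 - p) = 0, whose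
    adjoint is the claim. Over the noncommutative ring A a one-sided inverse need
    not be two-sided, so counting dimensions is no substitute for the antipode. *)
Lemma unitary_complement (p : 'M[C]_n) :
  p *m p = p -> adjmx p = p -> ia p *m u *m ia (1%:M - p) = 0 ->
  ia (1%:M - p) *m u *m ia p = 0.
Proof.
move=> pp pa pu.
have e := congr1 (map_mx (@antipode R A)) pu.
rewrite antipode_conj in e.
have := congr1 (@staradj R A _ _) e; rewrite !staradjM !staradj_in_alg.
rewrite adjmxB adjmx1 pa.
have -> : staradj (staradj u) = u by apply/matrixP=> i j; rewrite !mxE starK.
rewrite mulmxA => ->; apply/matrixP=> i j; rewrite !mxE linear0; exact: star0.
Qed.

End Unitary.

Lemma star_comul_eval (b : A -> A -> A) x : bilinear2 b ->
  comul_eval b (star x) = star (comul_eval (fun y z => star (b (star y) (star z))) x).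
Proof.
move=> bb; rewrite /comul_eval (comul_star x bb) big_map star_sum.
by apply: eq_bigr => p _; rewrite starK.
Qed.

(** Tensor equality only speaks of bilinear maps, while the star is antilinear; two
    stars on the arguments and one on the value cancel when b takes values in A. *)
Lemma star_bilinear (b : A -> A -> A) : bilinear2 b ->
  bilinear2 (fun y z => star (b (star y) (star z))).
Proof.
move=> [b1 b2]; split=> [x k y z|y k x z].
  by rewrite starD starZ b1 starD starZ conjCK.
have := b2 (star y) (Num.conj k) (star x) (star z).
by rewrite /= starD starZ => ->; rewrite starD starZ conjCK.
Qed.

Lemma comul_eval_star_corep (b : A -> A -> A) n (u : 'M[A]_n) i j :
  corepresentation u -> bilinear2 b ->
  comul_eval b (star (u i j)) = \sum_k b (star (u i k)) (star (u k j)).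
Proof.
move=> cu bb; rewrite star_comul_eval // comul_eval_corep //; last exact: star_bilinear.
by rewrite star_sum; apply: eq_bigr => k _; rewrite starK.
Qed.

Lemma trivial_corep m : unitary_corepresentation (1%:M : 'M[A]_m).
Proof.
have s1 : staradj (1%:M : 'M[A]_m) = 1%:M.
  have := staradj_in_alg A (1%:M : 'M[C]_m).
  by rewrite adjmx1 map_mx1.
split; rewrite ?s1 ?mulmx1 // => i j V b bb.
rewrite big_map big_enum /= (bigD1 i) //= [X in _ = _ + X]big1 ?addr0 => [|k ki]; last first.
  case: bb => b1 b2; rewrite /= [X in b X _]mxE eq_sym (negPf ki) mulr0n.
  by have /= := b2 ((1%:M : 'M[A]_m) k j) (-1) 0 0; rewrite !(scaler0, addr0) scaleN1r addNr.
rewrite !mxE eqxx; case: (i == j) => /=.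
  by rewrite (comul1 bb) big_seq1.
rewrite -/(comul_eval b 0).
have := comul_eval_linear bb (-1) 0 0; rewrite !(scaler0, addr0) scaleN1r addNr => ->.
case: bb => b1 b2; rewrite mulr0n.
by have /= := b1 (1 : A) (-1) 0 0; rewrite !(scaler0, addr0) scaleN1r addNr.
Qed.

Lemma dsum_corep m n (u : 'M[A]_m) (v : 'M[A]_n) :
  unitary_corepresentation u -> unitary_corepresentation v ->
  unitary_corepresentation (block_mx u 0 0 v).
Proof.
move=> [cu u1 u2] [cv v1 v2].
have sa0 p q : staradj (0 : 'M[A]_(p, q)) = 0.
  by apply/matrixP=> i j; rewrite !mxE star0.
have sE : staradj (block_mx u 0 0 v) = block_mx (staradj u) 0 0 (staradj v).
  by rewrite /staradj tr_block_mx map_block_mx -!/(staradj _) !sa0.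
split; last 2 first.
- rewrite sE mulmx_block u1 v1 !mulmx0 !mul0mx !addr0 !add0r; exact/esym/scalar_mx_block.
- rewrite sE mulmx_block u2 v2 !mulmx0 !mul0mx !addr0 !add0r; exact/esym/scalar_mx_block.
move=> i j V b bb.
have b0l x : b 0 x = 0.
  by case: bb => _ b2; have /= := b2 x (-1) 0 0; rewrite !(scaler0, addr0) scaleN1r addNr.
have b0r x : b x 0 = 0.
  by case: bb => b1 _; have /= := b1 x (-1) 0 0; rewrite !(scaler0, addr0) scaleN1r addNr.
have c0 : \sum_(p <- comul (0 : A)) b p.1 p.2 = 0.
  rewrite -/(comul_eval b 0).
  by have := comul_eval_linear bb (-1) 0 0; rewrite !(scaler0, addr0) scaleN1r addNr.
rewrite big_map big_enum big_split_ord /=.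
rewrite -(splitK i) -(splitK j); case: (fintype.split i) => i'; case: (fintype.split j) => j' /=.
- rewrite block_mxEul [X in _ = _ + X]big1 ?addr0 => [|k _]; last by rewrite block_mxEur mxE b0l.
  rewrite -/(comul_eval b _) comul_eval_corep //; apply: eq_bigr => k _; by rewrite !block_mxEul.
- rewrite block_mxEur mxE c0 !big1 ?addr0 // => k _.
    by rewrite /= !block_mxEur !mxE b0l.
  by rewrite /= block_mxEul block_mxEur mxE b0r.
- rewrite block_mxEdl mxE c0 !big1 ?addr0 // => k _.
    by rewrite /= block_mxEdr block_mxEdl mxE b0r.
  by rewrite /= !block_mxEdl mxE b0l.
- rewrite block_mxEdr [X in _ = X + _]big1 ?add0r => [|k _]; last by rewrite block_mxEdl mxE b0l.
  rewrite -/(comul_eval b _) comul_eval_corep //; apply: eq_bigr => k _; by rewrite !block_mxEdr.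
Qed.

End CorepBasics.

(** * Conjugate representations *)

Section Conjugate.
Variables (R : realType) (G : compact_quantum_group R).
Local Notation C := R[i].
Local Notation A := (cqg_algebra G).
Local Notation ia := (map_mx (in_alg A)).

(** The elements of the coefficient coalgebra of v. *)
Definition in_coef n (v : 'M[A]_n) (a : A) : Prop :=
  exists c : 'M[C]_n, a = \sum_i \sum_j c i j *: v i j.

Lemma in_coef0 n (v : 'M[A]_n) : in_coef v 0.
Proof.
exists 0; rewrite big1 // => i _; rewrite big1 // => j _; by rewrite mxE scale0r.
Qed.

Lemma in_coef_linear n (v : 'M[A]_n) k x y :
  in_coef v x -> in_coef v y -> in_coef v (k *: x + y).
Proof.
move=> [c ->] [d ->]; exists (k *: c + d).
rewrite scaler_sumr -big_split; apply: eq_bigr => i _ /=.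
rewrite scaler_sumr -big_split; apply: eq_bigr => j _ /=.
by rewrite !mxE scalerA scalerDl.
Qed.

Lemma in_coef_entry n (v : 'M[A]_n) i j : in_coef v (v i j).
Proof.
exists (delta_mx i j); rewrite (bigD1 i) //= (bigD1 j) //= mxE !eqxx scale1r.
rewrite big1 => [|k ki]; last by rewrite mxE (negPf ki) andbF scale0r.
rewrite addr0 big1 ?addr0 // => k ki; rewrite big1 // => l _.
by rewrite mxE (negPf ki) scale0r.
Qed.

Lemma in_coef_dsum m n (u : 'M[A]_m) (v : 'M[A]_n) a :
  in_coef u a \/ in_coef v a -> in_coef (block_mx u 0 0 v) a.
Proof.
case=> -[c ->]; elim/big_rec: _ => [|i x _ IH]; rewrite ?in_coef0 //;
  do ?[exact: in_coef0]; rewrite -[X in X + _]scale1r; apply: in_coef_linear => //;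
  elim/big_rec: _ => [|j y _ IHy]; do ?[exact: in_coef0]; apply: in_coef_linear => //.
  by rewrite -(block_mxEul u 0 0 v); apply: in_coef_entry.
by rewrite -(block_mxEdr u 0 0 v); apply: in_coef_entry.
Qed.

(** Every element of A is a combination of coefficients of unitary corepresentations,
    and finitely many of these fit into their direct sum. *)
Lemma common_corep (s : seq A) :
  exists n (v : 'M[A]_n), unitary_corepresentation v /\
    forall a, a \in s -> in_coef v a.
Proof.
elim: s => [|a s [n [v [vP vs]]]].
  by exists 0, 1%:M; split=> //; apply: trivial_corep.
have [t [tP ->]] := cqg_spanned a.
have [m [w [wP wa]]] : exists m (w : 'M[A]_m), unitary_corepresentation w /\
    in_coef w (\sum_(p <- t) p.1 *: p.2).
  elim: t tP => [|p t IH] tP.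
    by exists 0, 1%:M; split; [apply: trivial_corep|rewrite big_nil; apply: in_coef0].
  have [|m [w [wP wt]]] := IH.
    by move=> q qt; apply: tP; rewrite inE qt orbT.
  have [m' [u [i [j [uP pE]]]]] := tP p (mem_head _ _).
  exists (m' + m)%N, (block_mx u 0 0 w); split; first exact: dsum_corep.
  rewrite big_cons; apply: in_coef_linear; apply: in_coef_dsum; last by right.
  by left; rewrite pE; apply: in_coef_entry.
exists (m + n)%N, (block_mx w 0 0 v); split; first exact: dsum_corep.
move=> b; rewrite inE => /orP[/eqP ->|bs]; apply: in_coef_dsum; first by left.
by right; apply: vs.
Qed.

Section Covering.
Variables (n N : nat) (u : 'M[A]_n) (v : 'M[A]_N).
Hypothesis uP : unitary_corepresentation u.
Hypothesis vP : unitary_corepresentation v.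
Hypothesis uv : forall i j, in_coef v (star (u i j)).

(** Each entry of the conjugate of u is a combination of entries of v, in several
    ways if these are linearly dependent. The coefficients orthogonal to all linear
    relations between the entries of v transform covariantly: the relations are
    invariant under v, hence so is their orthogonal complement because v is unitary. *)
Lemma covariant_coefficients :
  exists c : 'I_n -> 'I_n -> 'M[C]_N,
  [/\ forall i j, star (u i j) = \sum_a \sum_b c i j a b *: v a b
    & forall i j b e, \sum_a c i j a b *: v a e
                      = \sum_k c k j e b *: star (u i k)].
Proof.
have [cu _ _] := uP; have [cv _ _] := vP.
have [r [x [f [fx sx Mx]]]] :=
  dual_family [seq v p.1 p.2 | p <- enum {: 'I_N * 'I_N}].
pose D a b g : C := f g (v a b).
have vE a b : v a b = \sum_g D a b g *: x g.
  by apply: sx; apply/mapP; exists (a, b); rewrite ?mem_enum.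
have /choice[e eP] g : exists e : 'M[C]_N, x g = \sum_a \sum_b e a b *: v a b.
  apply: (Mx (in_coef v)); [exact: in_coef0|exact: in_coef_linear|].
  by move=> _ /mapP[[a b] _ ->]; apply: in_coef_entry.
(* The vectors D _ _ g span the conjugate of the complement of the relations. *)
have [Gm [Gm_unit GmE]] : exists Gm : 'M[C]_r, Gm \in unitmx /\
    forall g g', Gm g g' = \sum_a \sum_b Num.conj (D a b g) * D a b g'.
  pose Dm : 'M[C]_(r, N * N) := \matrix_(g, p)
    Num.conj (D (mxtens_unindex p).1 (mxtens_unindex p).2 g).
  exists (Dm *m adjmx Dm); split.
    apply: (@gram_unit _ _ _ _ (\matrix_(p, g)
      Num.conj (e g (mxtens_unindex p).1 (mxtens_unindex p).2))).
    apply/matrixP=> g g'; rewrite !mxE mxtens_sum.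
    transitivity (Num.conj (f g (x g') : C)); last by rewrite fx rmorph_nat.
    rewrite eP linear_sum rmorph_sum; apply: eq_bigr => a _.
    rewrite linear_sum rmorph_sum; apply: eq_bigr => b _.
    by rewrite !mxE mxtens_indexK /= linearZ rmorphM mulrC.
  move=> g g'; rewrite mxE mxtens_sum; apply: eq_bigr => a _; apply: eq_bigr => b _.
  by rewrite !mxE mxtens_indexK /= conjCK.
pose Gi := invmx Gm.
have GGi g g' : \sum_k Gm g k * Gi k g' = (g == g')%:R.
  by have /matrixP/(_ g g') := mulmxV Gm_unit; rewrite !mxE.
have GiG g g' : \sum_k Gi g k * Gm k g' = (g == g')%:R.
  by have /matrixP/(_ g g') := mulVmx Gm_unit; rewrite !mxE.
have spanE y : in_coef v y -> y = \sum_g (f g y : C) *: x g.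
  move=> [c ->]; transitivity (\sum_a \sum_b c a b *: (\sum_g D a b g *: x g)).
    by apply: eq_bigr => a _; apply: eq_bigr => b _; rewrite -vE.
  under [RHS]eq_bigr do rewrite linear_sum scaler_suml.
  rewrite [RHS]exchange_big; apply: eq_bigr => a _ /=.
  under [RHS]eq_bigr do rewrite linear_sum scaler_suml.
  rewrite [RHS]exchange_big; apply: eq_bigr => b _ /=.
  rewrite scaler_sumr; apply: eq_bigr => g _.
  by rewrite scalerA linearZ.
have yE g : \sum_a \sum_b Num.conj (D a b g) *: v a b = \sum_g' Gm g g' *: x g'.
  under [RHS]eq_bigr do rewrite GmE scaler_suml.
  rewrite [RHS]exchange_big; apply: eq_bigr => a _ /=.
  under [RHS]eq_bigr do rewrite scaler_suml.
  rewrite [RHS]exchange_big; apply: eq_bigr => b _ /=.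
  rewrite {1}vE scaler_sumr; apply: eq_bigr => g' _; by rewrite scalerA.
pose gg i j g := \sum_k (f k (star (u i j)) : C) * Gi k g.
pose c i j : 'M[C]_N := \matrix_(a, b) \sum_g gg i j g * Num.conj (D a b g).
have cE i j : star (u i j) = \sum_a \sum_b c i j a b *: v a b.
  rewrite {1}(spanE _ (uv i j)).
  transitivity (\sum_g gg i j g *: (\sum_a \sum_b Num.conj (D a b g) *: v a b)).
    under [RHS]eq_bigr do rewrite yE scaler_sumr.
    rewrite exchange_big; apply: eq_bigr => k _ /=.
    under eq_bigr do rewrite scalerA.
    rewrite -scaler_suml; congr (_ *: _).
    under eq_bigr do rewrite mulr_suml.
    rewrite exchange_big /= (bigD1 k) //= [X in _ = _ + X]big1 => [|l lk].
      under eq_bigr do rewrite -mulrA.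
      by rewrite -mulr_sumr GiG eqxx mulr1 addr0.
    under eq_bigr do rewrite -mulrA.
    by rewrite -mulr_sumr GiG (negPf lk) mulr0.
  under eq_bigr do rewrite scaler_sumr.
  rewrite exchange_big; apply: eq_bigr => a _ /=.
  under eq_bigr do rewrite scaler_sumr.
  rewrite exchange_big; apply: eq_bigr => b _ /=.
  rewrite mxE scaler_suml; apply: eq_bigr => g _; by rewrite scalerA.
exists c; split=> // i j b0 e0.
(* Z measures the failure of covariance; it lies in the complement of the         *)
(* relations by zE, and it is orthogonal to this complement by Z1, which compares *)
(* the two expressions for the comultiplication of an entry.                      *)
pose Z b e := \sum_a c i j a b *: v a e - \sum_k c k j e b *: star (u i k).
apply/eqP; rewrite -subr_eq0 -/(Z b0 e0); apply/eqP.
have Z1 g : \sum_e \sum_b D e b g *: Z b e = 0.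
  have bb : bilinear2 (fun y z : A => (f g z : C) *: y).
    split=> [y k z t|z k y t]; first by rewrite linearP /= scalerDl scalerA.
    by rewrite scalerDr !scalerA mulrC.
  have := comul_eval_star_corep i j cu bb.
  have -> : comul_eval (fun y z => (f g z : C) *: y) (star (u i j))
     = \sum_a \sum_b c i j a b *: (\sum_e D e b g *: v a e).
    rewrite cE pair_big /= (lin_sum (comul_eval_linear bb)).
    rewrite [RHS]pair_big; apply: eq_bigr => p _ /=.
    by rewrite comul_eval_corep.
  have -> : \sum_k (f g (star (u k j)) : C) *: star (u i k)
     = \sum_k \sum_a \sum_b (c k j a b * D a b g) *: star (u i k).
    apply: eq_bigr => k _; rewrite [in LHS]cE linear_sum scaler_suml.
    apply: eq_bigr => a _; rewrite linear_sum scaler_suml.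
    by apply: eq_bigr => b _; rewrite linearZ.
  move=> e1; transitivity
    (\sum_e \sum_b \sum_a (D e b g * c i j a b) *: v a e
     - \sum_e \sum_b \sum_k (c k j e b * D e b g) *: star (u i k)).
    rewrite -sumrB; apply: eq_bigr => l _; rewrite -sumrB; apply: eq_bigr => b _.
    rewrite /Z scalerBr !scaler_sumr; congr (_ - _); apply: eq_bigr => a _.
      by rewrite scalerA.
    by rewrite scalerA mulrC.
  apply/eqP; rewrite subr_eq0; apply/eqP.
  transitivity (\sum_a \sum_b c i j a b *: (\sum_e D e b g *: v a e)).
    rewrite exchange_big [RHS]exchange_big; apply: eq_bigr => b _ /=.
    rewrite exchange_big; apply: eq_bigr => a _ /=.
    rewrite scaler_sumr; apply: eq_bigr => l _; by rewrite scalerA mulrC.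
  rewrite e1 exchange_big; apply: eq_bigr => a _ /=.
  by rewrite exchange_big.
have bb g : bilinear2 (fun y z : A => (f g z : C) *: @antipode R A y).
  split=> [y k z t|z k y t]; first by rewrite linearP /= scalerDl scalerA.
  by rewrite linearP /= scalerDr !scalerA mulrC.
have [zeta zE] : exists zeta : 'I_r -> A, forall b e,
    Z b e = \sum_g Num.conj (D e b g) *: zeta g.
  exists (fun g => \sum_k gg i j k *: star (comul_eval
      (fun y z => (f k z : C) *: @antipode R A y) (x g))
    - \sum_k gg k j g *: star (u i k)) => b l.
  have -> : Z b l = \sum_g gg i j g *: (\sum_a Num.conj (D a b g) *: v a l)
      - \sum_k (\sum_g gg k j g * Num.conj (D l b g)) *: star (u i k).
    congr (_ - _); last by apply: eq_bigr => k _; rewrite mxE.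
    under eq_bigr do rewrite mxE scaler_suml.
    rewrite exchange_big; apply: eq_bigr => g _ /=; rewrite scaler_sumr.
    by apply: eq_bigr => a _; rewrite scalerA.
  under [RHS]eq_bigr do rewrite scalerBr.
  rewrite sumrB; congr (_ - _).
    under [RHS]eq_bigr do rewrite scaler_sumr.
    rewrite [RHS]exchange_big; apply: eq_bigr => g _ /=.
    transitivity (gg i j g *: star (comul_eval
      (fun y z => (f g z : C) *: @antipode R A y) (v l b))).
      congr (_ *: _); rewrite comul_eval_corep // star_sum; apply: eq_bigr => a _.
      by rewrite starZ corep_antipode // starK.
    rewrite {1}vE (lin_sum (comul_eval_linear (bb g))) star_sum scaler_sumr.
    by apply: eq_bigr => k _; rewrite starZ !scalerA mulrC.
  under eq_bigr do rewrite scaler_suml.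
  rewrite exchange_big; apply: eq_bigr => g _ /=; rewrite scaler_sumr.
  by apply: eq_bigr => k _; rewrite scalerA mulrC.
rewrite zE big1 // => g _; suff -> : zeta g = 0 by rewrite scaler0.
have G0 k : \sum_l Gm l k *: zeta l = 0.
  apply: etrans (Z1 k).
  under [LHS]eq_bigr do rewrite GmE scaler_suml.
  rewrite [LHS]exchange_big; apply: eq_bigr => a _ /=.
  under [LHS]eq_bigr do rewrite scaler_suml.
  rewrite [LHS]exchange_big; apply: eq_bigr => b _ /=.
  rewrite zE scaler_sumr; apply: eq_bigr => l _; by rewrite scalerA mulrC.
transitivity (\sum_k Gi k g *: (\sum_l Gm l k *: zeta l)); last first.
  by rewrite big1 // => k _; rewrite G0 scaler0.
under eq_bigr do rewrite scaler_sumr.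
rewrite exchange_big /= (bigD1 g) //= [X in _ = _ + X]big1 => [|l lg].
  under eq_bigr do rewrite scalerA mulrC.
  by rewrite -scaler_suml GGi eqxx scale1r addr0.
under eq_bigr do rewrite scalerA mulrC.
by rewrite -scaler_suml GGi (negPf lg) scale0r.
Qed.

(** The covariant coefficients are, for fixed j and b, the matrix of an intertwiner
    from v to the conjugate of u. All of them together form an intertwiner from a
    multiple of v; it is onto because the counit maps the conjugate of u to the
    identity matrix. *)
Lemma conjugate_intertwiner :
  exists (M : nat) (V : 'M[A]_M) (s : 'M[C]_(n, M)) (t : 'M[C]_(M, n)),
  [/\ unitary_corepresentation V, s *m t = 1%:M
    & ia s *m V = map_mx (@star R A) u *m ia s].
Proof.
have [c [cE cov]] := covariant_coefficients.
have vv : unitary_corepresentation ((1%:M : 'M[A]_(n * N)) *t v).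
  exact: (rtens_subproof (Rep (trivial_corep _ _)) (Rep vP)).
exists ((n * N) * N)%N, (1%:M *t v).
have [un unE] : exists un : 'I_(n * N * N) -> 'I_n * 'I_N * 'I_N,
    forall j b e, un (mxtens_index (mxtens_index (j, b), e)) = ((j, b), e).
  exists (fun p => let: (jb, e) := mxtens_unindex p in (mxtens_unindex jb, e)).
  by move=> j b e; rewrite !mxtens_indexK.
pose s : 'M[C]_(n, n * N * N) :=
  \matrix_(k, p) c k (un p).1.1 (un p).2 (un p).1.2.
have sE k j b e : s k (mxtens_index (mxtens_index (j, b), e)) = c k j e b.
  by rewrite mxE unE.
exists s, (\matrix_(p, j) (((un p).1.1 == j) && ((un p).1.2 == (un p).2))%:R).
split=> //; apply/matrixP=> i j.
  rewrite mxE !mxtens_sum (bigD1 j) //= [X in _ + X]big1 ?addr0 => [|k kj].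
    transitivity (@counit R A (star (u i j)) : C); last first.
      by rewrite (counit_star uP) mxE.
    rewrite cE linear_sum exchange_big; apply: eq_bigr => a _ /=.
    rewrite linear_sum; apply: eq_bigr => b _.
    by rewrite linearZ /= (corep_counit vP) sE mxE unE /= eqxx /= eq_sym.
  rewrite big1 // => b _; rewrite big1 // => e _.
  by rewrite mxE unE /= (negPf kj) mulr0.
case: (mxtens_indexP j) => jb e; case: (mxtens_indexP jb) => {}j b.
rewrite !mxE.
transitivity (\sum_a c i j a b *: v a e).
  rewrite mxtens_sum (bigD1 (mxtens_index (j, b))) //= [X in _ + X]big1 ?addr0.
    by apply: eq_bigr => a _; rewrite mxE sE tensmxE mxE eqxx /= mul1r mul_in_algl.
  move=> k kjb; rewrite big1 // => a _.
  by rewrite tensmxE [X in _ * (X * _)]mxE (negPf kjb) mul0r mulr0.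
rewrite cov; apply: eq_bigr => k _.
by rewrite !mxE unE /= -in_algC mul_in_algl.
Qed.
End Covering.

Lemma in_algM m n p (f : 'M[C]_(m, n)) (g : 'M[C]_(n, p)) :
  ia (f *m g) = ia f *m ia g.
Proof. exact: map_mxM. Qed.

(** The conjugate of the corepresentation u of X is a quotient of a unitary V through
    s, and t includes it back as the orthogonal complement of the kernel of s. Thus
    the conjugate of u is equivalent to a unitary representation; for the sequel V
    with the pair (s, t) serves as well as this summand of V. *)
Lemma conjugate_rep (X : rep G) :
  exists (Y : rep G) (s : 'M[C]_(rdim X, rdim Y)) (t : 'M[C]_(rdim Y, rdim X)),
  [/\ s *m t = 1%:M, adjmx (t *m s) = t *m s,
      ia s *m rmx Y = map_mx (@star R A) (rmx X) *m ia s
    & rmx Y *m ia t = ia t *m map_mx (@star R A) (rmx X)].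
Proof.
have [N [v [vP vX]]] := common_corep
  [seq star (rmx X p.1 p.2) | p <- enum {: 'I_(rdim X) * 'I_(rdim X)}].
have uv i j : in_coef v (star (rmx X i j)).
  by apply: vX; apply/mapP; exists (i, j); rewrite ?mem_enum.
have [M [V [s [t0 [VP st0 sV]]]]] := conjugate_intertwiner (rmxP X) vP uv.
pose q := s *m adjmx s.
have qU : q \in unitmx := gram_unit st0.
have qa : adjmx q = q by rewrite adjmxM adjmxK.
have qia : adjmx (invmx q) = invmx q.
  rewrite -[LHS]mulmx1 -(mulmxV qU) mulmxA -{2}qa -adjmxM (mulmxV qU) adjmx1.
  by rewrite mul1mx.
have [t tE] : exists t, t = adjmx s *m invmx q by exists (adjmx s *m invmx q).
have st : s *m t = 1%:M by rewrite tE mulmxA mulmxV.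
have tsa : adjmx (t *m s) = t *m s.
  by rewrite adjmxM tE adjmxM adjmxK qia mulmxA.
exists (Rep VP), s, t; split=> //=.
have sp : s *m (1%:M - t *m s) = 0 by rewrite mulmxBr mulmx1 mulmxA st mul1mx subrr.
have pV : ia (t *m s) *m V *m ia (1%:M - t *m s) = 0.
  by rewrite in_algM -[_ *m V]mulmxA sV -!mulmxA -in_algM sp map_mx0 !mulmx0.
have pp : t *m s *m (t *m s) = t *m s by rewrite mulmxA -[_ *m t]mulmxA st mulmx1.
(* The complement of the kernel of s is invariant, so t intertwines. *)
have := unitary_complement VP pp tsa pV.
rewrite map_mxB map_mx1 !mulmxBl mul1mx => /eqP; rewrite subr_eq0 => /eqP e.
transitivity (V *m ia (t *m s) *m ia t).
  by rewrite -[RHS]mulmxA -in_algM -mulmxA st mulmx1.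
have ist : ia s *m ia t = 1%:M by rewrite -in_algM st map_mx1.
rewrite e in_algM -[_ *m V]mulmxA sV !mulmxA.
by rewrite -!mulmxA ist mulmx1 ist mulmx1.
Qed.

End Conjugate.

(** * Entries of Kronecker products and of coherence maps *)

Notation "<| i , j |>" := (mxtens_index (i, j)) (format "<| i ,  j |>").

Section Entries.
Variable R : realType.
Local Notation C := R[i].

Lemma mxtens_index_eq m n (i i' : 'I_m) (j j' : 'I_n) :
  (<|i, j|> == <|i', j'|>) = (i == i') && (j == j').
Proof. by rewrite (can_eq (@mxtens_indexK m n)) xpair_eqE. Qed.

Lemma mxtens_matrixP m n p q (a b : 'M[C]_(m * n, p * q)) :
  (forall i j k l, a <|i, j|> <|k, l|> = b <|i, j|> <|k, l|>) <-> a = b.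
Proof.
split=> [ab|-> //]; apply/matrixP=> x y.
by case: (mxtens_indexP x) => i j; case: (mxtens_indexP y).
Qed.

(** Appends an identity, so that the last factor of a product of structure maps can
    be evaluated by the same lemmas as the others. *)
Lemma mxentry1 m n (A : 'M[C]_(m, n)) i j : A i j = (A *m 1%:M) i j.
Proof. by rewrite mulmx1. Qed.

Lemma castid_mulE m m' n (e : m = m') (a : 'M[C]_(m, n)) x y :
  (castmx (e, erefl) 1%:M *m a) x y = a (cast_ord (esym e) x) y.
Proof. by rewrite castid_mul castmxE cast_ord_id. Qed.

Lemma assoc_mulE a b c n (A : 'M[C]_(a * b * c, n)) i j k y :
  (assoc a b c *m A) <|i, <|j, k|>|> y = A <|<|i, j|>, k|> y.
Proof.
rewrite castid_mulE; congr (A _ y); rewrite -mxtens_indexA.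
exact: val_inj.
Qed.

Lemma unassoc_mulE a b c n (A : 'M[C]_(a * (b * c), n)) i j k y :
  (unassoc a b c *m A) <|<|i, j|>, k|> y = A <|i, <|j, k|>|> y.
Proof.
rewrite castid_mulE; congr (A _ y); rewrite -mxtens_indexA.
exact: val_inj.
Qed.

Lemma lunit_mulE a n (A : 'M[C]_(1 * a, n)) i y :
  (lunit a *m A) i y = A <|ord0, i|> y.
Proof. by rewrite castid_mulE; congr (A _ y); apply: val_inj. Qed.

Lemma unlunit_mulE a n (A : 'M[C]_(a, n)) o i y :
  (unlunit a *m A) <|o, i|> y = A i y.
Proof.
by rewrite castid_mulE; congr (A _ y); apply: val_inj; rewrite /= ord1.
Qed.

Lemma runit_mulE a n (A : 'M[C]_(a * 1, n)) i y :
  (runit a *m A) i y = A <|i, ord0|> y.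
Proof.
by rewrite castid_mulE; congr (A _ y); apply: val_inj; rewrite /= muln1 addn0.
Qed.

Lemma unrunit_mulE a n (A : 'M[C]_(a, n)) i o y :
  (unrunit a *m A) <|i, o|> y = A i y.
Proof.
rewrite castid_mulE; congr (A _ y); apply: val_inj.
by rewrite /= ord1 muln1 addn0.
Qed.

Lemma tens_mulE a b c d n (M : 'M[C]_(a, c)) (N : 'M[C]_(b, d)) (A : 'M[C]_(c * d, n)) i j y :
  ((M *t N) *m A) <|i, j|> y = \sum_k \sum_l M i k * N j l * A <|k, l|> y.
Proof.
rewrite mxE mxtens_sum; apply: eq_bigr => k _; apply: eq_bigr => l _.
by rewrite tensmxE.
Qed.

Lemma sum_delta n (i : 'I_n) (F : 'I_n -> C) :
  \sum_k (i == k)%:R * F k = F i.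
Proof.
rewrite (bigD1 i) //= eqxx mul1r big1 ?addr0 // => k ki.
by rewrite eq_sym (negPf ki) mul0r.
Qed.

Lemma sum_delta_r n (i : 'I_n) (F : 'I_n -> C) :
  \sum_k F k * (k == i)%:R = F i.
Proof.
rewrite -[RHS]sum_delta; apply: eq_bigr => k _; by rewrite mulrC eq_sym.
Qed.

Lemma hidl_mulE a b d n (N : 'M[C]_(b, d)) (A : 'M[C]_(a * d, n)) i j y :
  ((hid a *t N) *m A) <|i, j|> y = \sum_l N j l * A <|i, l|> y.
Proof.
rewrite tens_mulE -[RHS](sum_delta _ (fun k => \sum_l N j l * A <|k, l|> y)).
apply: eq_bigr => k _; rewrite mulr_sumr; apply: eq_bigr => l _.
by rewrite mxE mulrA.
Qed.

Lemma hidr_mulE a b c n (M : 'M[C]_(a, c)) (A : 'M[C]_(c * b, n)) i j y :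
  ((M *t hid b) *m A) <|i, j|> y = \sum_k M i k * A <|k, j|> y.
Proof.
rewrite tens_mulE; apply: eq_bigr => k _.
rewrite -[RHS](sum_delta _ (fun l => M i k * A <|k, l|> y)).
by apply: eq_bigr => l _; rewrite mxE mulrCA mulrA.
Qed.

Definition lfiber a d n (A : 'M[C]_(a * d, n)) (i : 'I_a) : 'M[C]_(d, n) :=
  \matrix_(l, y) A <|i, l|> y.

Lemma hidl_fiber a b d n (N : 'M[C]_(b, d)) (A : 'M[C]_(a * d, n)) i j y :
  ((hid a *t N) *m A) <|i, j|> y = (N *m lfiber A i) j y.
Proof. by rewrite hidl_mulE mxE; apply: eq_bigr => l _; rewrite mxE. Qed.

Definition rfiber a b n (A : 'M[C]_(a * b, n)) (j : 'I_b) : 'M[C]_(a, n) :=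
  \matrix_(k, y) A <|k, j|> y.

Lemma hidr_fiber a b c n (M : 'M[C]_(a, c)) (A : 'M[C]_(c * b, n)) i j y :
  ((M *t hid b) *m A) <|i, j|> y = (M *m rfiber A j) i y.
Proof. by rewrite hidr_mulE mxE; apply: eq_bigr => l _; rewrite mxE. Qed.

Lemma mul_hidlE a b d n (N : 'M[C]_(d, b)) (A : 'M[C]_(n, a * d)) x i j :
  (A *m (hid a *t N)) x <|i, j|> = \sum_l A x <|i, l|> * N l j.
Proof.
rewrite mxE mxtens_sum.
rewrite -[RHS](sum_delta_r _ (fun k => \sum_l A x <|k, l|> * N l j)).
apply: eq_bigr => k _; rewrite mulr_suml; apply: eq_bigr => l _.
by rewrite tensmxE mxE mulrCA mulrA mulrC mulrA mulrC mulrA.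
Qed.

Lemma mul_hidrE a b c n (M : 'M[C]_(c, a)) (A : 'M[C]_(n, c * b)) x i j :
  (A *m (M *t hid b)) x <|i, j|> = \sum_k A x <|k, j|> * M k i.
Proof.
rewrite mxE mxtens_sum; apply: eq_bigr => k _.
rewrite -[RHS](sum_delta_r _ (fun l => A x <|k, l|> * M k i)).
by apply: eq_bigr => l _; rewrite tensmxE mxE mulrA.
Qed.

End Entries.

(** * Unitary pseudonatural transformations as block matrices *)

Section Blocks.
Variable R : realType.
Local Notation C := R[i].

(** A map from C^m tensor H to H tensor C^n, as the matrix of its components between
    basis vectors of C^m and of C^n, which are operators on H. *)
Definition blk h n m (a : 'M[C]_(h * n, m * h)) : 'M['M[C]_h]_(n, m) :=
  \matrix_(i, j) \matrix_(p, q) a <|p, i|> <|j, q|>.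

Definition unblk h n m (u : 'M['M[C]_h]_(n, m)) : 'M[C]_(h * n, m * h) :=
  \matrix_(x, y) u (mxtens_unindex x).2 (mxtens_unindex y).1
                   (mxtens_unindex x).1 (mxtens_unindex y).2.

Lemma blkE h n m (a : 'M[C]_(h * n, m * h)) i j p q :
  blk a i j p q = a <|p, i|> <|j, q|>.
Proof. by rewrite !mxE. Qed.

Lemma unblkK h n m : cancel (@unblk h n m) (@blk h n m).
Proof.
move=> u; apply/matrixP=> i j; apply/matrixP=> p q.
by rewrite blkE mxE !mxtens_indexK.
Qed.

Lemma blk_inj h n m : injective (@blk h n m).
Proof.
move=> a b ab; apply/mxtens_matrixP=> p i j q.
by rewrite -!blkE ab.
Qed.

Lemma scblk_mulE h n m (f : 'M[C]_(n, m)) (b : 'M[C]_h) i j :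
  scblk h f i j * b = f i j *: b.
Proof. by rewrite mxE; apply: mul_scalar_mx. Qed.

Lemma mul_scblkE h n m (f : 'M[C]_(n, m)) (b : 'M[C]_h) i j :
  b * scblk h f i j = f i j *: b.
Proof. by rewrite mxE; apply: mul_mx_scalar. Qed.

Lemma blk_mull h n m k (g : 'M[C]_(k, n)) (a : 'M[C]_(h * n, m * h)) :
  blk ((hid h *t g) *m a) = scblk h g *m blk a.
Proof.
apply/matrixP=> i j; apply/matrixP=> p q; rewrite blkE hidl_mulE mxE summxE.
by apply: eq_bigr => l _; rewrite scblk_mulE mxE blkE.
Qed.

Lemma blk_mulr h n m k (f : 'M[C]_(m, k)) (a : 'M[C]_(h * n, m * h)) :
  blk (a *m (f *t hid h)) = blk a *m scblk h f.
Proof.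
apply/matrixP=> i j; apply/matrixP=> p q; rewrite blkE mul_hidrE mxE summxE.
by apply: eq_bigr => l _; rewrite mul_scblkE mxE blkE mulrC.
Qed.

Lemma unitary_blk h n m (a : 'M[C]_(h * n, m * h)) :
  unitary a <-> bunitary (blk a).
Proof.
have e1 j j' q q' : (adjmx a *m a) <|j, q|> <|j', q'|>
    = (badj (blk a) *m blk a) j j' q q'.
  rewrite !mxE mxtens_sum summxE exchange_big; apply: eq_bigr => i _.
  rewrite mxE; apply: eq_bigr => p _.
  by rewrite badjE !adjmxE !blkE.
have e2 p p' i i' : (a *m adjmx a) <|p, i|> <|p', i'|>
    = (blk a *m badj (blk a)) i i' p p'.
  rewrite !mxE mxtens_sum summxE; apply: eq_bigr => j _.
  rewrite mxE; apply: eq_bigr => q _.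
  by rewrite badjE !adjmxE !blkE.
have e3 k l (i i' : 'I_k) (p p' : 'I_l) :
    (1%:M : 'M['M[C]_l]_k) i i' p p' = ((i == i') && (p == p'))%:R.
  by rewrite mxE; case: (i == i'); rewrite !mxE.
split=> -[u1 u2]; split.
- by apply/matrixP=> j j'; apply/matrixP=> q q'; rewrite -e1 u1 mxE mxtens_index_eq e3.
- apply/matrixP=> i i'; apply/matrixP=> p p'.
  by rewrite -e2 u2 mxE mxtens_index_eq e3 andbC.
- by apply/mxtens_matrixP=> j q j' q'; rewrite e1 u1 e3 mxE mxtens_index_eq.
- by apply/mxtens_matrixP=> p i p' i'; rewrite e2 u2 e3 mxE mxtens_index_eq andbC.
Qed.

(** The composite in the multiplicativity axiom is the Kronecker product of the two
    block matrices: the operators on H are multiplied, the other indices paired. *)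
Lemma blk_tens h n m n' m' (a : 'M[C]_(h * n, m * h)) (b : 'M[C]_(h * n', m' * h)) :
  blk (assoc h n n' *m (a *t hid n') *m unassoc m h n' *m (hid m *t b)
       *m assoc m m' h) = blk a *t blk b.
Proof.
apply/matrixP=> i j; apply/matrixP=> p q.
case: (mxtens_indexP i) => {}i i'; case: (mxtens_indexP j) => {}j j'.
rewrite blkE mxentry1 -!mulmxA assoc_mulE hidr_mulE mxtens_sum.
rewrite tensmxE mxE (bigD1 j) //= [X in _ + X]big1 ?addr0; last first.
  move=> k kj; rewrite big1 // => r _.
  rewrite unassoc_mulE hidl_mulE big1 ?mulr0 // => x _.
  case: (mxtens_indexP x) => r' k'.
  by rewrite assoc_mulE mxE !mxtens_index_eq (negPf kj) mulr0.
apply: eq_bigr => r _; rewrite blkE; congr (_ * _).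
rewrite unassoc_mulE hidl_mulE blkE -[RHS](sum_delta_r _ (fun x => b <|r, i'|> x)).
apply: eq_bigr => x _; case: (mxtens_indexP x) => j2 q2.
by rewrite assoc_mulE mxE !mxtens_index_eq eqxx.
Qed.

Lemma blk_unit h : blk (unrunit h *m lunit h) = 1%:M :> 'M['M[C]_h]_1.
Proof.
apply/matrixP=> i j; apply/matrixP=> p q; rewrite !ord1 blkE.
by rewrite unrunit_mulE mxentry1 lunit_mulE !mxE mxtens_index_eq.
Qed.

End Blocks.

Section UptBlocks.
Variables (R : realType) (G : compact_quantum_group R).
Local Notation C := R[i].
Implicit Types F : fibre_functor G.

Definition bcomp F1 F2 (a : pretrans F1 F2) X : 'M['M[C]_(hdim a)]_(F2 X, F1 X) :=
  blk (Defs.comp a X).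

(** In block form a transformation looks like a unitary representation with values
    in M_h, whose row and column indices are those of the two fibre functors. *)
Lemma is_uptP F1 F2 (a : pretrans F1 F2) :
  is_upt a <->
  [/\ forall X, bunitary (bcomp a X),
      forall X Y (f : rhom X Y),
        scblk _ (fmap F2 f) *m bcomp a X = bcomp a Y *m scblk _ (fmap F1 f),
      forall X Y, bcomp a (rtens X Y) *m scblk _ (fmul F1 X Y)
        = scblk _ (fmul F2 X Y) *m (bcomp a X *t bcomp a Y)
    & bcomp a rone *m scblk _ (funit F1) = scblk _ (funit F2)].
Proof.
split=> -[a1 a2 a3 a4]; split.
- by move=> X; apply/unitary_blk.
- by move=> X Y f; rewrite -blk_mull -blk_mulr a2.
- by move=> X Y; rewrite -blk_mulr a3 -!mulmxA blk_mull !mulmxA blk_tens.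
- by rewrite -blk_mulr a4 -!mulmxA blk_mull blk_unit mulmx1.
- by move=> X; apply/unitary_blk.
- by move=> X Y f; apply: blk_inj; rewrite blk_mull blk_mulr a2.
- move=> X Y; apply: blk_inj.
  by rewrite blk_mulr -!mulmxA blk_mull !mulmxA blk_tens a3.
- by apply: blk_inj; rewrite blk_mulr a4 -!mulmxA blk_mull blk_unit mulmx1.
Qed.

Lemma modificationP F1 F2 (a b : pretrans F1 F2) (f : 'M[C]_(hdim b, hdim a)) :
  modification f <->
  forall X i j, bcomp b X i j *m f = f *m bcomp a X i j.
Proof.
have e1 X p i j q : (Defs.comp b X *m (hid (F1 X) *t f)) <|p, i|> <|j, q|>
    = (bcomp b X i j *m f) p q.
  by rewrite mul_hidlE mxE; apply: eq_bigr => l _; rewrite blkE.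
have e2 X p i j q : ((f *t hid (F2 X)) *m Defs.comp a X) <|p, i|> <|j, q|>
    = (f *m bcomp a X i j) p q.
  by rewrite hidr_mulE mxE; apply: eq_bigr => l _; rewrite blkE.
split=> fm X; first by move=> i j; apply/matrixP=> p q; rewrite -e1 fm e2.
by apply/mxtens_matrixP=> p i j q; rewrite e1 fm -e2.
Qed.

Lemma bcomp_id F X : bcomp (pt_id F) X = 1%:M.
Proof.
apply/matrixP=> i j; apply/matrixP=> p q; rewrite !ord1 blkE /=.
rewrite unlunit_mulE mxentry1 runit_mulE mxE mxtens_index_eq mxE.
by case: (i == j); rewrite !mxE.
Qed.

Lemma bcomp_tens F1 F2 F3 (a : pretrans F1 F2) (b : pretrans F2 F3) X i k :
  bcomp (pt_tens a b) X i k = \sum_j bcomp a X j k *t bcomp b X i j.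
Proof.
apply/matrixP=> p q; rewrite blkE /= summxE.
case: (mxtens_indexP p) => {}p p'; case: (mxtens_indexP q) => {}q q'.
rewrite mxentry1 -!mulmxA unassoc_mulE hidl_mulE mxtens_sum.
apply: eq_bigr => j _; rewrite tensmxE !blkE.
transitivity (\sum_r Defs.comp b X <|p', i|> <|j, r|>
                * (Defs.comp a X <|p, j|> <|k, q|> * (r == q')%:R)).
  apply: eq_bigr => r _; congr (_ * _); rewrite assoc_mulE hidr_mulE.
  rewrite -[RHS](sum_delta_r _ (fun x => Defs.comp a X <|p, j|> x * (r == q')%:R)).
  apply: eq_bigr => x _; case: (mxtens_indexP x) => k' q2.
  rewrite unassoc_mulE mxE !mxtens_index_eq andbA -mulnb natrM.
  by rewrite [X in _ * X]mulrC mulrA.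
rewrite -[RHS](sum_delta_r _ (fun r => Defs.comp a X <|p, j|> <|k, q|> * Defs.comp b X <|p', i|> <|j, r|>)).
by apply: eq_bigr => r _; rewrite !mulrA [Defs.comp b X _ _ * _]mulrC.
Qed.

(** The cup and the cap of H turn the adjoint of each component by a half turn, which
    leaves the complex conjugates of the blocks. *)
Lemma bcomp_dual F1 F2 (a : pretrans F1 F2) X j i :
  bcomp (pt_dual a) X j i = cjmx (bcomp a X i j).
Proof.
apply/matrixP=> p q; rewrite blkE /=.
rewrite -!mulmxA runit_mulE hidl_mulE mxtens_sum.
transitivity (\sum_r \sum_s (r == s)%:R * (Num.conj (Defs.comp a X <|p, i|> <|j, r|>)
    * (s == q)%:R)).
  apply: eq_bigr => r _; apply: eq_bigr => s _.
  rewrite mxE mxtens_indexK; congr (_ * _).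
  rewrite unassoc_mulE hidl_fiber assoc_mulE mxE hidl_fiber hidr_mulE mxtens_sum.
  rewrite -[RHS](sum_delta p (fun t =>
    Num.conj (Defs.comp a X <|t, i|> <|j, r|>) * (s == q)%:R)).
  apply: eq_bigr => t _.
  rewrite -[RHS](sum_delta_r i (fun i' => (p == t)%:R *
    (Num.conj (Defs.comp a X <|t, i'|> <|j, r|>) * (s == q)%:R))).
  apply: eq_bigr => i' _.
  rewrite [lfiber _ _ _ _]mxE hidl_fiber unassoc_mulE [lfiber _ _ _ _]mxE assoc_mulE hidr_mulE big_ord1.
  rewrite [unlunit _ _ _]mxentry1 unlunit_mulE !mxE mxtens_indexK mxtens_index_eq /= -mulnb natrM.
  by rewrite mulrCA -!mulrA [(i' == i)%:R * _]mulrC.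
rewrite exchange_big /= mxE blkE -[RHS](sum_delta_r q (fun s =>
  Num.conj (Defs.comp a X <|p, i|> <|j, s|>))).
apply: eq_bigr => s _.
rewrite -[RHS](sum_delta s (fun r => Num.conj (Defs.comp a X <|p, i|> <|j, r|>) * (s == q)%:R)).
by apply: eq_bigr => r _; rewrite eq_sym.
Qed.

End UptBlocks.

(** * Composition of transformations *)

Section TensorUpt.
Variables (R : realType).
Local Notation C := R[i].

(** The two commuting copies of M_h and M_k in their tensor product: the blocks of a
    composite are products of one matrix over each copy. *)
Definition tensl h k (x : 'M[C]_h) : 'M[C]_(h * k) := x *t 1%:M.
Definition tensr h k (x : 'M[C]_k) : 'M[C]_(h * k) := 1%:M *t x.

Lemma tensl_zmod h k : zmod_morphism (@tensl h k).
Proof.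
move=> x y; apply/mxtens_matrixP=> i j i' j'.
by rewrite !(mxE, mxtens_indexK) mulrBl.
Qed.
Lemma tensr_zmod h k : zmod_morphism (@tensr h k).
Proof.
move=> x y; apply/mxtens_matrixP=> i j i' j'.
by rewrite !(mxE, mxtens_indexK) mulrBr.
Qed.
Lemma tensl_monoid h k : monoid_morphism (@tensl h k).
Proof.
split; first exact: tensmx11.
by move=> x y; rewrite -!mulmxE /tensl tensmx_mul mulmx1.
Qed.
Lemma tensr_monoid h k : monoid_morphism (@tensr h k).
Proof.
split; first exact: tensmx11.
by move=> x y; rewrite -!mulmxE /tensr tensmx_mul mulmx1.
Qed.

HB.instance Definition _ h k :=
  GRing.isZmodMorphism.Build _ _ (@tensl h k) (@tensl_zmod h k).
HB.instance Definition _ h k :=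
  GRing.isMonoidMorphism.Build _ _ (@tensl h k) (@tensl_monoid h k).
HB.instance Definition _ h k :=
  GRing.isZmodMorphism.Build _ _ (@tensr h k) (@tensr_zmod h k).
HB.instance Definition _ h k :=
  GRing.isMonoidMorphism.Build _ _ (@tensr h k) (@tensr_monoid h k).

Lemma map_scblk h h' (f : {rmorphism 'M[C]_h -> 'M[C]_h'}) m n (g : 'M[C]_(m, n)) :
  (forall c, f c%:M = c%:M) -> map_mx f (scblk h g) = scblk h' g.
Proof. by move=> fc; apply/matrixP=> i j; rewrite !mxE fc. Qed.

Lemma map_bunitary h h' (f : {rmorphism 'M[C]_h -> 'M[C]_h'}) m n (u : 'M['M[C]_h]_(m, n)) :
  (forall x, f (adjmx x) = adjmx (f x)) -> bunitary u -> bunitary (map_mx f u).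
Proof.
move=> fa [u1 u2].
have e : badj (map_mx f u) = map_mx f (badj u).
  by apply/matrixP=> i j; rewrite !mxE fa.
by rewrite /bunitary e -!map_mxM u1 u2 !map_mx1.
Qed.

Lemma tensl_scalar h k c : tensl k (c%:M : 'M[C]_h) = c%:M.
Proof.
apply/mxtens_matrixP=> i j i' j'; rewrite tensmxE !mxE mxtens_index_eq.
by rewrite mulr_natr -mulrnA mulnb.
Qed.

Lemma tensr_scalar h k c : tensr h (c%:M : 'M[C]_k) = c%:M.
Proof.
apply/mxtens_matrixP=> i j i' j'; rewrite tensmxE !mxE mxtens_index_eq.
by rewrite mulr_natl -mulrnA mulnb andbC.
Qed.

Lemma tensl_adj h k (x : 'M[C]_h) : tensl k (adjmx x) = adjmx (tensl k x).
Proof. by rewrite /tensl adjmx_tens adjmx1. Qed.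

Lemma tensr_adj h k (x : 'M[C]_k) : tensr h (adjmx x) = adjmx (tensr h x).
Proof. by rewrite /tensr adjmx_tens adjmx1. Qed.

Lemma bunitaryM h m n p (u : 'M['M[C]_h]_(m, n)) (v : 'M['M[C]_h]_(n, p)) :
  bunitary u -> bunitary v -> bunitary (u *m v).
Proof.
rewrite /bunitary badjM => -[u1 u2] [v1 v2]; split.
  by rewrite mulmxA -[_ *m badj u *m u]mulmxA u1 mulmx1.
by rewrite mulmxA -[u *m v *m _]mulmxA v2 mulmx1.
Qed.

Variable G : compact_quantum_group R.
Implicit Types F : fibre_functor G.

Lemma bcomp_tensM F1 F2 F3 (a : pretrans F1 F2) (b : pretrans F2 F3) X :
  bcomp (pt_tens a b) X
  = map_mx (@tensr (hdim a) (hdim b)) (bcomp b X)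
    *m map_mx (@tensl (hdim a) (hdim b)) (bcomp a X).
Proof.
apply/matrixP=> i k; rewrite bcomp_tens mxE; apply: eq_bigr => j _.
by rewrite !mxE -mulmxE /tensl /tensr tensmx_mul mul1mx mulmx1.
Qed.

Lemma is_upt_tens F1 F2 F3 (a : pretrans F1 F2) (b : pretrans F2 F3) :
  is_upt a -> is_upt b -> is_upt (pt_tens a b).
Proof.
move=> /is_uptP[a1 a2 a3 a4] /is_uptP[b1 b2 b3 b4]; apply/is_uptP.
have l m n (g : 'M[C]_(m, n)) : map_mx (@tensl (hdim a) (hdim b)) (scblk _ g) = scblk _ g.
  exact/map_scblk/tensl_scalar.
have r m n (g : 'M[C]_(m, n)) : map_mx (@tensr (hdim a) (hdim b)) (scblk _ g) = scblk _ g.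
  exact/map_scblk/tensr_scalar.
split=> [X|X Y f|X Y|]; rewrite !bcomp_tensM.
- apply: bunitaryM; apply: map_bunitary => //; [exact: tensr_adj|exact: tensl_adj].
- rewrite mulmxA -r -map_mxM b2 map_mxM r -!mulmxA; congr (_ *m _).
  by rewrite -l -map_mxM a2 map_mxM l.
- rewrite -mulmxA -l -map_mxM a3 map_mxM l mulmxA -r -map_mxM b3 map_mxM r -mulmxA.
  congr (_ *m _); rewrite !map_mxT tensmx_mul_comm // => i j k m.
  rewrite !mxE /GRing.comm -!mulmxE /tensl /tensr !tensmx_mul.
  by rewrite !mul1mx !mulmx1.
- by rewrite -mulmxA -l -map_mxM a4 l -r -map_mxM b4 r.
Qed.

End TensorUpt.

(** * Duals of transformations *)

Section DualUpt.
Variables (R : realType) (G : compact_quantum_group R).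
Local Notation C := R[i].
Local Notation A := (cqg_algebra G).
Local Notation ia := (map_mx (in_alg A)).
Implicit Types F : fibre_functor G.

(** An intertwiner from Y to the conjugate of X is an invariant functional on the
    tensor product of Y and X, by unitarity of X. *)
Lemma cap_intertwines (X Y : rep G) (s : 'M[C]_(rdim X, rdim Y)) :
  ia s *m rmx Y = map_mx (@star R A) (rmx X) *m ia s ->
  intertwines (X := rtens Y X) (Y := rone)
    (\row_p s (mxtens_unindex p).2 (mxtens_unindex p).1).
Proof.
move=> sY; have [_ u1 _] := rmxP X.
rewrite /intertwines mul1mx; apply/matrixP=> o p; rewrite !ord1.
case: (mxtens_indexP p) => a j; rewrite !mxE mxtens_sum mxtens_indexK.
transitivity (\sum_i (\sum_b (s i b)%:A * rmx Y b a) * rmx X i j).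
  rewrite exchange_big; apply: eq_bigr => i _; rewrite mulr_suml.
  apply: eq_bigr => b _; by rewrite tensmxE !mxE mxtens_indexK mulrA.
transitivity (\sum_l (\sum_i star (rmx X i l) * rmx X i j) * (s l a)%:A).
  under [RHS]eq_bigr do rewrite mulr_suml.
  rewrite [RHS]exchange_big; apply: eq_bigr => i _ /=.
  transitivity ((ia s *m rmx Y) i a * rmx X i j).
    by rewrite mxE; congr (_ * _); apply: eq_bigr => b _; rewrite mxE.
  rewrite sY mxE mulr_suml; apply: eq_bigr => l _.
  by rewrite !mxE /= -!mulrA in_algC.
have uE l : \sum_i star (rmx X i l) * rmx X i j = (l == j)%:R.
  by have /matrixP/(_ l j) := u1; rewrite !mxE => <-; apply: eq_bigr => i _; rewrite !mxE.
under eq_bigr do rewrite uE.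
rewrite (bigD1 j) //= eqxx mul1r big1 ?addr0 // => l /negPf ->.
by rewrite mul0r.
Qed.

(** An intertwiner from the conjugate of X to Y is an invariant vector in the tensor
    product of X and Y, by unitarity of X. *)
Lemma cup_intertwines (X Y : rep G) (t : 'M[C]_(rdim Y, rdim X)) :
  rmx Y *m ia t = ia t *m map_mx (@star R A) (rmx X) ->
  intertwines (X := rone) (Y := rtens X Y)
    (\col_p t (mxtens_unindex p).2 (mxtens_unindex p).1).
Proof.
move=> tY; have [_ _ u2] := rmxP X.
rewrite /intertwines mulmx1; apply/matrixP=> p o; rewrite !ord1.
case: (mxtens_indexP p) => i a; rewrite !mxE mxtens_sum mxtens_indexK.
transitivity (\sum_k rmx X i k * (\sum_b rmx Y a b * (t b k)%:A)); last first.
  apply: eq_bigr => k _; rewrite mulr_sumr.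
  apply: eq_bigr => b _; by rewrite tensmxE !mxE mxtens_indexK mulrA.
transitivity (\sum_l (t a l)%:A * (\sum_k rmx X i k * star (rmx X l k))).
  have uE l : \sum_k rmx X i k * star (rmx X l k) = (i == l)%:R.
    by have /matrixP/(_ i l) := u2; rewrite !mxE => <-; apply: eq_bigr => k _; rewrite !mxE.
  under eq_bigr do rewrite uE.
  rewrite (bigD1 i) //= eqxx mulr1 big1 ?addr0 // => l li.
  by rewrite eq_sym (negPf li) mulr0.
under eq_bigr do rewrite mulr_sumr.
rewrite exchange_big; apply: eq_bigr => k _ /=.
transitivity (rmx X i k * (rmx Y *m ia t) a k); last first.
  by rewrite mxE; congr (_ * _); apply: eq_bigr => b _; rewrite mxE.
rewrite tY mxE mulr_sumr; apply: eq_bigr => l _.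
by rewrite !mxE /= !mulrA in_algC.
Qed.

Definition uncurry_row m n (r : 'M[C]_(1, m * n)) : 'M[C]_(n, m) :=
  \matrix_(i, b) r ord0 <|b, i|>.
Definition uncurry_col m n (c : 'M[C]_(m * n, 1)) : 'M[C]_(n, m) :=
  \matrix_(a, i) c <|i, a|> ord0.

(** The matrix of the invariant functional F(f) on the product of F Y and F X. *)
Definition cap_image F X Y (f : rhom (rtens Y X) rone) : 'M[C]_(F X, F Y) :=
  uncurry_row (adjmx (funit F) *m fmap F f *m fmul F Y X).
Definition cup_image F X Y (f : rhom rone (rtens X Y)) : 'M[C]_(F Y, F X) :=
  uncurry_col (adjmx (fmul F X Y) *m fmap F f *m funit F).

Section Upt.
Variables (F1 F2 : fibre_functor G) (a : pretrans F1 F2).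
Hypothesis aP : is_upt a.

(** Naturality for the invariant functional and multiplicativity give a relation
    between the blocks at X and at Y; unitarity at X moves the blocks at X to the
    other side, where they appear as the entrywise adjoint. *)
Lemma upt_cap X Y (f : rhom (rtens Y X) rone) :
  cadj (bcomp a X) *m scblk _ (cap_image F1 f) = scblk _ (cap_image F2 f) *m bcomp a Y.
Proof.
have [a1 a2 a3 a4] := (is_uptP a).1 aP.
have [u1 u2] := funit_unitary F1; have [w1 w2] := funit_unitary F2.
have e : scblk (hdim a) (adjmx (funit F2) *m fmap F2 f *m fmul F2 Y X)
           *m (bcomp a Y *t bcomp a X)
       = scblk _ (adjmx (funit F1) *m fmap F1 f *m fmul F1 Y X).
  rewrite scblkM -mulmxA -a3 mulmxA scblkM -[_ *m bcomp a (rtens Y X)]mulmxA a2.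
  rewrite mulmxA -[bcomp a rone]mulmx1 -scblk1 -u2 scblkM.
  rewrite [bcomp a rone *m _]mulmxA a4 !mulmxA -[_ *m scblk _ (funit F2)]scblkM w1.
  by rewrite scblk1 mul1mx -!scblkM.
have [_ x2] := a1 X.
have {}e : (scblk _ (cap_image F2 f) *m bcomp a Y)^T *m bcomp a X
   = (scblk _ (cap_image F1 f))^T.
  apply/matrixP=> b i; rewrite mxE.
  have /matrixP/(_ ord0 <|b, i|>) := e.
  rewrite mxE mxtens_sum exchange_big /= => e1.
  rewrite [in RHS]mxE [in RHS]mxE [in RHS]mxE.
  move: e1; rewrite [in RHS]mxE => <-; apply: eq_bigr => i' _.
  rewrite !mxE mulr_suml; apply: eq_bigr => b' _.
  by rewrite tensmxE !mxE mulrA.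
apply: trmx_inj; rewrite -[RHS]mulmx1 -x2 mulmxA e.
by rewrite scblkT mul_scblk_tr.
Qed.

Lemma upt_cup X Y (f : rhom rone (rtens X Y)) :
  bcomp a Y *m scblk _ (cup_image F1 f) = scblk _ (cup_image F2 f) *m cadj (bcomp a X).
Proof.
have [a1 a2 a3 a4] := (is_uptP a).1 aP.
have [u1 u2] := fmul_unitary F1 X Y; have [w1 w2] := fmul_unitary F2 X Y.
have e : (bcomp a X *t bcomp a Y)
     *m scblk _ (adjmx (fmul F1 X Y) *m fmap F1 f *m funit F1)
   = scblk (hdim a) (adjmx (fmul F2 X Y) *m fmap F2 f *m funit F2).
  rewrite -[bcomp a X *t _]mul1mx -scblk1 -w1 scblkM -[_ *m (_ *t _)]mulmxA -a3.
  rewrite !scblkM !mulmxA -[_ *m scblk _ (fmul F1 X Y) *m _]mulmxA -scblkM u2.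
  rewrite scblk1 mulmx1 -[_ *m bcomp a (rtens X Y) *m _]mulmxA -a2.
  by rewrite -!mulmxA a4.
have [x1 x2] := a1 X.
have {}e : bcomp a X *m (bcomp a Y *m scblk _ (cup_image F1 f))^T
   = (scblk _ (cup_image F2 f))^T.
  apply/matrixP=> i b; rewrite mxE.
  have /matrixP/(_ <|i, b|> ord0) := e.
  rewrite mxE mxtens_sum /= => e1.
  rewrite [in RHS]mxE [in RHS]mxE [in RHS]mxE.
  move: e1; rewrite [in RHS]mxE => <-; apply: eq_bigr => i' _.
  rewrite !mxE mulr_sumr; apply: eq_bigr => b' _.
  by rewrite tensmxE !mxE mulrA.
apply: trmx_inj; rewrite -[LHS]mul1mx -x1 -mulmxA e.
by rewrite scblkT scblk_mul_tr.
Qed.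

End Upt.

Lemma canonical_cap X Y (f : rhom (rtens Y X) rone) :
  cap_image (canonical_fibre_functor G) f = uncurry_row (hmx f).
Proof. by rewrite /cap_image /= adjmx1 mul1mx mulmx1. Qed.

Lemma canonical_cup X Y (f : rhom rone (rtens X Y)) :
  cup_image (canonical_fibre_functor G) f = uncurry_col (hmx f).
Proof. by rewrite /cup_image /= adjmx1 mul1mx mulmx1. Qed.

(** A conjugate of X supplies an invariant functional and an invariant vector, hence
    the two relations needed to compare the dual of a with a unitary. Their
    normalization is known at the canonical fibre functor, on one side of a; the
    other side inherits it. *)
Lemma dual_bunitary F1 F2 (a : pretrans F1 F2) X :
  is_upt a -> (0 < hdim a)%N ->
  F1 = canonical_fibre_functor G \/ F2 = canonical_fibre_functor G ->
  bunitary (cadj (bcomp a X)).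
Proof.
move=> aP h0 Fc; have [Y [s [t [st ts sY tY]]]] := conjugate_rep X.
pose cap := RHom (cap_intertwines sY); pose cup := RHom (cup_intertwines tY).
have [a1 _ _ _] := (is_uptP a).1 aP.
have su : uncurry_row (hmx cap) = s by apply/matrixP=> i b; rewrite !mxE mxtens_indexK.
have tu : uncurry_col (hmx cup) = t by apply/matrixP=> i b; rewrite !mxE mxtens_indexK.
have scap := upt_cap aP cap; have scup := upt_cup aP cup.
case: Fc => Fc.
  apply: (dual_bunitary_src (a1 X) (a1 Y) scap scup h0); rewrite Fc.
    by rewrite canonical_cap canonical_cup su tu.
  by rewrite canonical_cap canonical_cup su tu.
apply: (dual_bunitary_tgt (a1 X) (a1 Y) scap scup h0); rewrite Fc.
  by rewrite canonical_cap canonical_cup su tu.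
by rewrite canonical_cap canonical_cup su tu.
Qed.

Lemma bcomp_dualE F1 F2 (a : pretrans F1 F2) X :
  bcomp (pt_dual a) X = map_mx (@cjmx R _ _) (bcomp a X)^T.
Proof. by apply/matrixP=> i j; rewrite bcomp_dual !mxE. Qed.

Lemma cjmx_sum h I (r : seq I) (F : I -> 'M[C]_h) :
  cjmx (\sum_(i <- r) F i) = \sum_(i <- r) cjmx (F i).
Proof. exact: raddf_sum. Qed.

(** Only unitarity is difficult. The other axioms are the adjoints of those of a,
    and transposition of blocks exchanges the two fibre functors. *)
Lemma is_upt_dual F1 F2 (a : pretrans F1 F2) :
  is_upt a -> (0 < hdim a)%N ->
  F1 = canonical_fibre_functor G \/ F2 = canonical_fibre_functor G ->
  is_upt (pt_dual a).
Proof.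
move=> aP h0 Fc; have [a1 a2 a3 a4] := (is_uptP a).1 aP.
have cM m n p (u : 'M['M[C]_(hdim a)]_(m, n)) (v : 'M['M[C]_(hdim a)]_(n, p)) :
    map_mx (@cjmx R _ _) (u *m v) = map_mx (@cjmx R _ _) u *m map_mx (@cjmx R _ _) v.
  apply/matrixP=> i j; rewrite !mxE cjmx_sum; apply: eq_bigr => k _.
  by rewrite !mxE -!mulmxE cjmxM.
have csc m n (f : 'M[C]_(m, n)) : map_mx (@cjmx R _ _) (scblk (hdim a) f)
    = scblk _ (cjmx f).
  by apply/matrixP=> i j; rewrite !mxE /cjmx map_scalar_mx.
have csct m n (f : 'M[C]_(m, n)) : map_mx (@cjmx R _ _) (scblk (hdim a) (adjmx f)^T)
    = scblk _ f.
  by rewrite csc; congr scblk; apply/matrixP=> i j; rewrite !mxE conjCK.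
have dE X : bcomp (pt_dual a) X = map_mx (@cjmx R _ _) (bcomp a X)^T.
  exact: bcomp_dualE.
apply/is_uptP; split=> [X|X Y f|X Y|].
- have [w1 w2] := dual_bunitary X aP h0 Fc.
  have c1 n : map_mx (@cjmx R _ _) (1%:M : 'M['M[C]_(hdim a)]_n) = 1%:M.
    by rewrite -scblk1 csc /cjmx map_mx1 scblk1.
  have dw : bcomp (pt_dual a) X = map_mx (@cjmx R _ _) (badj (cadj (bcomp a X))).
    by rewrite dE /badj cadjK.
  have dw' : badj (bcomp (pt_dual a) X) = map_mx (@cjmx R _ _) (cadj (bcomp a X)).
    by apply/matrixP=> i j; rewrite badjE bcomp_dual !mxE adj_cjmx.
  by rewrite /bunitary dw' dw -!cM w1 w2 !c1.
- rewrite !dE -(csct _ _ (fmap F1 f)) -(csct _ _ (fmap F2 f)) -!cM.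
  by rewrite -scblk_mul_tr -mul_scblk_tr -!fmap_adj a2.
- have [u1 u2] := fmul_unitary F1 X Y; have [w1 w2] := fmul_unitary F2 X Y.
  rewrite !dE -map_mxT -(csct _ _ (fmul F1 X Y)) -cM -trmx_tens.
  transitivity (map_mx (@cjmx R _ _)
    (scblk _ (fmul F2 X Y) *m (bcomp a X *t bcomp a Y) *m scblk _ (adjmx (fmul F1 X Y)))^T
    *m scblk _ (fmul F2 X Y)).
    by rewrite -a3 -mulmxA -scblkM u2 scblk1 mulmx1.
  rewrite mul_scblk_tr scblk_mul_tr mulmxA cM -mulmxA.
  have -> : map_mx (@cjmx R _ _) (scblk (hdim a) (fmul F2 X Y)^T)
      = scblk _ (adjmx (fmul F2 X Y)).
    by rewrite csc; congr scblk; rewrite -adj_cjmx cj_adjmx trmxK.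
  by rewrite -scblkM w1 scblk1 mulmx1.
- have [u1 u2] := funit_unitary F1; have [w1 w2] := funit_unitary F2.
  transitivity (map_mx (@cjmx R _ _)
    (scblk _ (funit F2) *m scblk _ (adjmx (funit F1)))^T
    *m scblk (hdim a) (funit F2)).
    by rewrite dE -a4 -mulmxA -scblkM u2 scblk1 mulmx1.
  rewrite mul_scblk_tr cM csct scblkT csc -mulmxA.
  have -> : cjmx (funit F2)^T = adjmx (funit F2).
    by apply/matrixP=> i j; rewrite !mxE.
  by rewrite -scblkM w1 scblk1 mulmx1.
Qed.

End DualUpt.

(** * The Frobenius monoid of a Hilbert space and its dual *)

Section PairMonoid.
Variables (R : realType) (d : nat).
Local Notation C := R[i].
Local Notation s := (sqrtC (d%:R : C)).

(** Together with the entry lemmas of the coherence maps this reduces each equation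
    of Frobenius monoids to a comparison of finite sums. *)
Lemma pair_mul_mulE n (A : 'M[C]_(d * d * (d * d), n)) p q y :
  (pair_mul d *m A) <|p, q|> y = s^-1 * \sum_b A <|<|p, b|>, <|b, q|>|> y.
Proof.
rewrite -scalemxAl mxE; congr (_ * _).
rewrite -!mulmxA hidr_mulE -[RHS]mul1r.
have e F : \sum_(k < d * 1) (runit d : 'M[C]_(_, _)) p k * F k = F <|p, ord0|>.
  transitivity ((runit d *m (\col_k F k)) p ord0); last by rewrite runit_mulE mxE.
  by rewrite mxE; apply: eq_bigr => k _; congr (_ * _); rewrite [RHS]mxE.
rewrite e hidr_mulE mxtens_sum (bigD1 p) //= [X in _ + X]big1 ?addr0; last first.
  move=> k kp; apply: big1 => x _.
  by rewrite tensmxE mxE eq_sym (negPf kp) !mul0r.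
rewrite mxtens_sum mul1r; apply: eq_bigr => b _.
transitivity (\sum_c (b == c)%:R * A <|<|p, b|>, <|c, q|>|> y); last exact: sum_delta.
apply: eq_bigr => c _; rewrite tensmxE mxE eqxx mul1r adjmxE mxE mxtens_indexK /=.
rewrite rmorph_nat hidr_mulE; congr (_ * _).
transitivity ((assoc d d d *m rfiber (unassoc (d * d) d d *m A) q) <|p, <|b, c|>|> y).
  by rewrite mxE; apply: eq_bigr => k _; congr (_ * _); rewrite [RHS]mxE.
by rewrite assoc_mulE mxE unassoc_mulE.
Qed.

Lemma pair_unitE p q o : pair_unit d <|p, q|> o = s * (p == q)%:R.
Proof.
by rewrite !mxE mxtens_indexK rmorph_nat.
Qed.

Lemma pair_unit_mulE n (A : 'M[C]_(1, n)) p q y :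
  (pair_unit d *m A) <|p, q|> y = s * (p == q)%:R * A ord0 y.
Proof. by rewrite mxE big_ord1 pair_unitE. Qed.

Lemma pair_mulE p q a b c e :
  pair_mul d <|p, q|> <|<|a, b|>, <|c, e|>|>
  = s^-1 * ((p == a)%:R * (b == c)%:R * (q == e)%:R).
Proof.
rewrite mxentry1 pair_mul_mulE; congr (_ * _).
rewrite -[RHS](sum_delta_r b (fun x => (p == a)%:R * (x == c)%:R * (q == e)%:R)).
apply: eq_bigr => x _; rewrite mxE !mxtens_index_eq -!mulnb !natrM.
by rewrite !mulrA [RHS]mulrAC; congr (_ * _); rewrite mulrAC.
Qed.

Lemma pair_mulT_mulE n (A : 'M[C]_(d * d, n)) a b c e y :
  (adjmx (pair_mul d) *m A) <|<|a, b|>, <|c, e|>|> y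
  = s^-1 * ((b == c)%:R * A <|a, e|> y).
Proof.
rewrite mxE mxtens_sum.
transitivity (\sum_p (p == a)%:R * (s^-1 * ((b == c)%:R * A <|p, e|> y))).
  apply: eq_bigr => p _.
  rewrite -[RHS](sum_delta_r e (fun q => (p == a)%:R * (s^-1 * ((b == c)%:R * A <|p, q|> y)))).
  apply: eq_bigr => q _; rewrite adjmxE pair_mulE.
  have /CrealP -> : s^-1 * ((p == a)%:R * (b == c)%:R * (q == e)%:R) \is Num.real.
    by rewrite ger0_real // !mulr_ge0 ?invr_ge0 ?sqrtC_ge0 ?ler0n.
  rewrite -!mulrA mulrCA; congr (_ * _); congr (_ * _); congr (_ * _).
  by rewrite mulrC.
by rewrite -[RHS](sum_delta_r a (fun p => s^-1 * ((b == c)%:R * A <|p, e|> y)));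
  apply: eq_bigr => p _; rewrite mulrC.
Qed.

Hypothesis d0 : (0 < d)%N.

Lemma sqrt_dim_neq0 : s != 0.
Proof. by rewrite sqrtC_eq0 pnatr_eq0 -lt0n. Qed.

Lemma sqrt_dim_sqr : s * s = d%:R.
Proof. by rewrite -expr2 sqrtCK. Qed.

Lemma pair_special_frobenius : special_frobenius (pair_monoid d : hilb_monoid R).
Proof.
have mxP4 n (A B : 'M[C]_(d * d * (d * d), n)) :
  (forall a b c e y, A <|<|a, b|>, <|c, e|>|> y = B <|<|a, b|>, <|c, e|>|> y) -> A = B.
  move=> AB; apply/matrixP=> x y; case: (mxtens_indexP x) => x1 x2.
  by case: (mxtens_indexP x1) => a b; case: (mxtens_indexP x2).
have mxP2 n (A B : 'M[C]_(d * d, n)) :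
  (forall a b y, A <|a, b|> y = B <|a, b|> y) -> A = B.
  by move=> AB; apply/matrixP=> x y; case: (mxtens_indexP x).
have mm x : adjmx (pair_mul d) *m pair_mul d = x ->
  forall a b c e y, x <|<|a, b|>, <|c, e|>|> y =
    s^-1 * ((b == c)%:R * (s^-1 * \sum_k (1%:M : 'M[C]__) <|<|a, k|>, <|k, e|>|> y)).
  by move=> <- a b c e y; rewrite pair_mulT_mulE mxentry1 pair_mul_mulE.
split=> /=.
- apply: mxP2 => p q y; rewrite -!mulmxA !pair_mul_mulE; congr (_ * _).
  transitivity (\sum_b s^-1 * \sum_c (1%:M : 'M[C]__) <|<|<|p, c|>, <|c, b|>|>, <|b, q|>|> y).
    apply: eq_bigr => b _; rewrite mxentry1 hidr_fiber pair_mul_mulE; congr (_ * _).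
    by apply: eq_bigr => c _; rewrite mxE.
  rewrite -mulr_sumr exchange_big /= mulr_sumr; apply: eq_bigr => b _.
  rewrite hidl_fiber pair_mul_mulE; congr (_ * _).
  by apply: eq_bigr => c _; rewrite [lfiber _ _ _ _]mxE [RHS]mxentry1 assoc_mulE.
- split; apply: mxP2 => p q y; rewrite pair_mul_mulE.
    rewrite mulr_sumr [RHS]mxentry1 lunit_mulE.
    rewrite -[RHS](sum_delta p (fun b => (1%:M : 'M[C]__) <|ord0, <|b, q|>|> y)).
    apply: eq_bigr => b _; rewrite mxentry1 hidr_fiber pair_unit_mulE mxE.
    by rewrite !mulrA mulVf ?sqrt_dim_neq0 // mul1r.
  rewrite mulr_sumr [RHS]mxentry1 runit_mulE.
  rewrite -[RHS](sum_delta_r q (fun b => (1%:M : 'M[C]__) <|<|p, b|>, ord0|> y)).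
  apply: eq_bigr => b _; rewrite mxentry1 hidl_fiber pair_unit_mulE mxE.
  by rewrite !mulrA mulVf ?sqrt_dim_neq0 // mul1r mulrC.
- apply: mxP4 => a b c e y; rewrite (mm _ erefl) -!mulmxA hidr_fiber pair_mul_mulE.
  congr (_ * _); rewrite [RHS]mulrCA mulr_sumr mulr_sumr; apply: eq_bigr => x _.
  rewrite mxE unassoc_mulE mxentry1 hidl_fiber pair_mulT_mulE mxE.
  by rewrite mulrCA.
- apply: mxP4 => a b c e y; rewrite (mm _ erefl) -!mulmxA hidl_fiber pair_mul_mulE.
  congr (_ * _); rewrite mulrCA mulr_sumr mulr_sumr; apply: eq_bigr => x _.
  rewrite [RHS]mxE assoc_mulE [RHS]mxentry1 hidr_fiber pair_mulT_mulE.
  by rewrite [in RHS]mxE mulrCA.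
- apply: mxP2 => p q y; rewrite pair_mul_mulE.
  under eq_bigr do rewrite mxentry1 pair_mulT_mulE eqxx mul1r.
  rewrite sumr_const card_ord -[(_ * _) *+ d]mulr_natl.
  move: sqrt_dim_neq0 sqrt_dim_sqr; move: (sqrtC d%:R) => t t0 <-.
  by rewrite -[t * t * _]mulrA mulKf // mulVKf.
Qed.

End PairMonoid.

Section TensorSums.
Variable R : realType.
Local Notation C := R[i].

Lemma tensmx_suml I (r : seq I) m n p q (F : I -> 'M[C]_(m, n)) (b : 'M[C]_(p, q)) :
  (\sum_(i <- r) F i) *t b = \sum_(i <- r) F i *t b.
Proof.
apply/mxtens_matrixP=> i j k l; rewrite tensmxE !summxE mulr_suml.
by apply: eq_bigr => x _; rewrite tensmxE.
Qed.

Lemma tensmx_sumr I (r : seq I) m n p q (F : I -> 'M[C]_(m, n)) (b : 'M[C]_(p, q)) :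
  b *t (\sum_(i <- r) F i) = \sum_(i <- r) b *t F i.
Proof.
apply/mxtens_matrixP=> i j k l; rewrite tensmxE !summxE mulr_sumr.
by apply: eq_bigr => x _; rewrite tensmxE.
Qed.

(** On vectors this is, up to the factor 1 / sqrt d, the map sending y and z to y x^T z. *)
Definition insert_mul d (x : 'M[C]_d) : 'M[C]_(d * d, d * d * (d * d)) :=
  pair_mul d *m ((1%:M *t x) *t 1%:M).

Lemma insert_mul_sum d I (r : seq I) (F : I -> 'M[C]_d) :
  insert_mul (\sum_(i <- r) F i) = \sum_(i <- r) insert_mul (F i).
Proof. by rewrite /insert_mul tensmx_sumr tensmx_suml mulmx_sumr. Qed.

Lemma insert_mul1 d : insert_mul 1%:M = pair_mul d.
Proof. by rewrite /insert_mul !tensmx11 mulmx1. Qed.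

Lemma insert_mul0 d : insert_mul (0 : 'M[C]_d) = 0.
Proof. by rewrite /insert_mul tensmx0 tens0mx mulmx0. Qed.

(** The multiplication contracts the two inner factors, here to a matrix product. *)
Lemma pair_mul_tens d d' (A B A' B' : 'M[C]_(d', d)) : (d = d') ->
  pair_mul d' *m ((A *t B) *t (A' *t B')) = (A *t B') *m insert_mul (A'^T *m B).
Proof.
move=> e; case: d' / e in A B A' B' *.
apply/matrixP=> x y; case: (mxtens_indexP x) => p q {x}.
case: (mxtens_indexP y) => y1 y2 {y}.
case: (mxtens_indexP y1) => a b {y1}; case: (mxtens_indexP y2) => c e {y2}.
rewrite pair_mul_mulE tens_mulE.
transitivity (A p a * B' q e * ((sqrtC d%:R)^-1 * (A'^T *m B) c b)).
  rewrite mxE !mulr_sumr; apply: eq_bigr => k _; rewrite !tensmxE mxE.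
  by ring.
rewrite (bigD1 a) //= [X in _ + X]big1 ?addr0 => [|k ka]; last first.
  rewrite big1 // => l _; rewrite pair_mul_mulE big1 ?mulr0 // => z _.
  by rewrite !tensmxE [X in X * _ * _]mxE (negPf ka) !mul0r.
rewrite (bigD1 e) //= [X in _ + X]big1 ?addr0 => [|l le]; last first.
  rewrite pair_mul_mulE big1 ?mulr0 // => z _.
  by rewrite !tensmxE [X in _ * X]mxE mxtens_index_eq (negPf le) andbF mulr0.
congr (_ * _); rewrite pair_mul_mulE; congr (_ * _).
rewrite -[LHS](sum_delta_r c (fun z => (A'^T *m B) z b)); apply: eq_bigr => z _.
rewrite !tensmxE [X in _ = X * _ * _]mxE eqxx mul1r.
by rewrite [X in _ = _ * X]mxE mxtens_index_eq eqxx andbT.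
Qed.

(** An operator on H as a vector of H tensor its dual. *)
Definition vec d (x : 'M[C]_d) : 'M[C]_(d * d, 1) :=
  \matrix_(p, _) x (mxtens_unindex p).1 (mxtens_unindex p).2.
Definition unvec d (v : 'M[C]_(d * d, 1)) : 'M[C]_d :=
  \matrix_(p, q) v <|p, q|> ord0.

Lemma vec0 d : vec (0 : 'M[C]_d) = 0.
Proof. by apply/matrixP=> p q; rewrite !mxE. Qed.

Lemma vecE d (x : 'M[C]_d) p q o : vec x <|p, q|> o = x p q.
Proof. by rewrite mxE mxtens_indexK. Qed.

Lemma vecK d : cancel (@vec d) (@unvec d).
Proof. by move=> x; apply/matrixP=> p q; rewrite mxE vecE. Qed.

Lemma unvecK d : cancel (@unvec d) (@vec d).
Proof.
move=> v; apply/matrixP=> x o; case: (mxtens_indexP x) => p q.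
by rewrite vecE mxE (ord1 o).
Qed.

Lemma vec_inj_mx m d (f g : 'M[C]_(m, d * d)) :
  (forall x, f *m vec x = g *m vec x) -> f = g.
Proof.
move=> fg; apply/matrixP=> i j.
have := fg (unvec (delta_mx j ord0)); rewrite unvecK -!colE.
by move/matrixP/(_ i ord0); rewrite !mxE.
Qed.

(** With B the complex conjugate of A this is conjugation of x by A. *)
Lemma tens_vec d d' (A B : 'M[C]_(d', d)) (x : 'M[C]_d) :
  (A *t B) *m vec x = vec (A *m x *m B^T).
Proof.
apply/matrixP=> y o; case: (mxtens_indexP y) => p q.
rewrite tens_mulE vecE exchange_big mxE; apply: eq_bigr => l _ /=.
rewrite mxE mulr_suml; apply: eq_bigr => k _.
by rewrite vecE mxE mulrAC.
Qed.

Lemma pair_unit_vec d : pair_unit d = sqrtC (d%:R : C) *: vec 1%:M.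
Proof.
apply/matrixP=> x o; case: (mxtens_indexP x) => p q.
by rewrite pair_unitE mxE vecE mxE.
Qed.

End TensorSums.

(** * The Frobenius monoid of a transformation *)

Section Pants.
Variables (R : realType) (G : compact_quantum_group R).
Local Notation C := R[i].
Local Notation F := (canonical_fibre_functor G).

Lemma bcomp_pants F1 F2 (a : @pretrans R G F1 F2) X i k :
  bcomp (pobj (pair_of_pants a)) X i k
  = \sum_j bcomp a X j k *t cjmx (bcomp a X j i).
Proof. by rewrite bcomp_tens; apply: eq_bigr => j _; rewrite bcomp_dual. Qed.

Section OnePants.
Variables (F' : fibre_functor G) (a : pretrans F F').
Hypotheses (aP : is_upt a) (h0 : (0 < hdim a)%N).

Lemma upt_dual_unitary1 X k i :
  \sum_j bcomp a X j k *m adjmx (bcomp a X j i) = (k == i)%:R%:M.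
Proof.
have [w1 _] := dual_bunitary X aP h0 (or_introl erefl).
have /matrixP/(_ k i) := w1; rewrite !mxE => e.
transitivity ((k == i)%:R : 'M[C]_(hdim a)).
  rewrite -e; apply: eq_bigr => j _; by rewrite !mxE adjmxK.
by case: (k == i); rewrite ?(mulr1n, mulr0n) ?raddf0.
Qed.

Lemma upt_dual_unitary2 X j j' :
  \sum_l adjmx (bcomp a X j l) *m bcomp a X j' l = (j == j')%:R%:M.
Proof.
have [_ w2] := dual_bunitary X aP h0 (or_introl erefl).
have /matrixP/(_ j j') := w2; rewrite !mxE => e.
transitivity ((j == j')%:R : 'M[C]_(hdim a)).
  rewrite -e; apply: eq_bigr => l _; by rewrite !mxE adjmxK.
by case: (j == j'); rewrite ?(mulr1n, mulr0n) ?raddf0.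
Qed.

(** The inner factors contract to the sums over l of a(j,l)* a(j',l). These are scalar
    by the unitarity of the dual, and not by that of a. *)
Lemma pants_mul_modification :
  modification (a := pt_tens (pobj (pair_of_pants a)) (pobj (pair_of_pants a)))
    (b := pobj (pair_of_pants a)) (pmul (pair_of_pants a)).
Proof.
apply/modificationP => X i k; rewrite bcomp_tens bcomp_pants /=.
under [in RHS]eq_bigr do rewrite !bcomp_pants.
rewrite mulmx_suml mulmx_sumr.
transitivity (\sum_l \sum_j \sum_j' (bcomp a X j k *t cjmx (bcomp a X j' i))
    *m insert_mul ((adjmx (bcomp a X j l) *m bcomp a X j' l)^T)); last first.
  apply: eq_bigr => l _; rewrite tensmx_suml mulmx_sumr; apply: eq_bigr => j _.
  rewrite tensmx_sumr mulmx_sumr; apply: eq_bigr => j' _.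
  by rewrite trmx_mul tr_adjmx; apply/esym/pair_mul_tens.
rewrite exchange_big; apply: eq_bigr => j _ /=.
rewrite exchange_big /= (bigD1 j) //= [X in _ = _ + X]big1 ?addr0 => [|j' jj].
  rewrite -mulmx_sumr -insert_mul_sum; congr (_ *m _).
  by rewrite -raddf_sum /= upt_dual_unitary2 eqxx tr_scalar_mx insert_mul1.
rewrite -mulmx_sumr -insert_mul_sum -raddf_sum /= upt_dual_unitary2 eq_sym (negPf jj).
by rewrite raddf0 trmx0 insert_mul0 mulmx0.
Qed.

Lemma pants_unit_modification :
  modification (a := pt_id F) (b := pobj (pair_of_pants a)) (punit (pair_of_pants a)).
Proof.
apply/modificationP => X i k; rewrite bcomp_id bcomp_pants /= pair_unit_vec.
rewrite -scalemxAr mulmx_suml -scalemxAl; congr (_ *: _).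
transitivity (vec (\sum_j bcomp a X j k *m adjmx (bcomp a X j i))).
  rewrite -[LHS]unvecK; congr vec; apply/matrixP=> p q; rewrite mxE !summxE.
  by apply: eq_bigr => j _; rewrite tens_vec mulmx1 vecE tr_cjmx.
rewrite upt_dual_unitary1 mxE eq_sym; case: (i == k); rewrite ?mulmx1 //.
by rewrite mulmx0 raddf0; apply/matrixP=> x o; rewrite !mxE.
Qed.

Lemma pants_special_frobenius : special_frobenius_End (pair_of_pants a).
Proof.
split.
- by apply: is_upt_tens => //; apply: is_upt_dual => //; left.
- exact: pants_mul_modification.
- exact: pants_unit_modification.
- exact: pair_special_frobenius.
Qed.

End OnePants.
End Pants.

(** * Unitary star-isomorphisms *)

Section StarHom.
Variable R : realType.
Local Notation C := R[i].
Implicit Types A B : hilb_monoid R.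

Lemma assoc_natural a b c c' (g : 'M[C]_(c', c)) :
  (hid a *t (hid b *t g)) *m assoc a b c = assoc a b c' *m (hid (a * b) *t g).
Proof.
apply/matrixP=> x y; case: (mxtens_indexP x) => i x' {x}.
case: (mxtens_indexP x') => j k {x'}; case: (mxtens_indexP y) => y' l {y}.
rewrite assoc_mulE hidl_fiber hidl_mulE [RHS]mxentry1 hidl_mulE.
apply: eq_bigr => z _; congr (_ * _); rewrite mxE [LHS]mxentry1 assoc_mulE.
by [].
Qed.

Lemma unlunit_natural a b (g : 'M[C]_(a, b)) :
  (hid 1 *t g) *m unlunit b = unlunit a *m g.
Proof.
apply/matrixP=> x y; case: (mxtens_indexP x) => o i {x}.
rewrite unlunit_mulE hidl_mulE -[RHS](sum_delta_r y (fun z => g i z)).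
by apply: eq_bigr => z _; rewrite [unlunit _ _ _]mxentry1 unlunit_mulE mxE.
Qed.

Lemma lunitK a : lunit a *m unlunit a = 1%:M :> 'M[C]_a.
Proof.
apply/matrixP=> i j; rewrite lunit_mulE mxentry1 unlunit_mulE; by [].
Qed.

Lemma runit_adj a : runit a *m adjmx (runit a) = 1%:M :> 'M[C]_a.
Proof.
apply/matrixP=> i j; rewrite runit_mulE adjmxE [runit _ _ _]mxentry1 runit_mulE !mxE.
by rewrite mxtens_index_eq andbT rmorph_nat eq_sym.
Qed.

(** For a unitary monoid homomorphism f the last condition is automatic: f can be
    moved through the form of B, and the snake equation of the Frobenius monoid A
    remains. *)
Lemma unitary_star_homomorphism A B (f : 'M[C]_(mdim B, mdim A)) :
  special_frobenius A -> unitary f ->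
  f *m mmul A = mmul B *m (f *t f) -> f *m munit A = munit B ->
  star_homomorphism f.
Proof.
move=> [_ [ul ur] _ fr _] [f1 f2] fm fu; split=> //.
set a := mdim A; set b := mdim B.
have uA : munit A = adjmx f *m munit B by rewrite -fu mulmxA f1 mul1mx.
have e1 : adjmx (munit B) *m mmul B *m (f *t hid b)
    = adjmx (munit A) *m mmul A *m (hid a *t adjmx f).
  have -> : f *t hid b = (f *t f) *m (hid a *t adjmx f).
    by rewrite tensmx_mul /hid mulmx1 f2.
  by rewrite mulmxA -[adjmx _ *m _ *m (f *t f)]mulmxA -fm mulmxA uA adjmxM adjmxK.
have e2 : (hid a *t (adjmx (munit B) *m mmul B)) *m (hid a *t (f *t hid b))
  = (hid a *t (adjmx (munit A) *m mmul A)) *m (hid a *t (hid a *t adjmx f)).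
  by rewrite !tensmx_mul e1.
have e3 : (hid (a * a) *t adjmx f) *m ((adjmx (mmul A) *m munit A) *t hid b)
  = ((adjmx (mmul A) *m munit A) *t hid a) *m (hid 1 *t adjmx f).
  by rewrite !tensmx_mul /hid !mul1mx !mulmx1.
have snake : (hid a *t (adjmx (munit A) *m mmul A)) *m assoc a a a
    *m ((adjmx (mmul A) *m munit A) *t hid a) = adjmx (runit a) *m lunit a.
  have -> : hid a *t (adjmx (munit A) *m mmul A)
      = (hid a *t adjmx (munit A)) *m (hid a *t mmul A).
    by rewrite tensmx_mul /hid mulmx1.
  have -> : (adjmx (mmul A) *m munit A) *t hid a
      = (adjmx (mmul A) *t hid a) *m (munit A *t hid a).
    by rewrite tensmx_mul /hid mulmx1.
  rewrite !mulmxA -[_ *m (hid a *t mmul A) *m _]mulmxA.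
  rewrite -[_ *m (_ *m assoc a a a) *m _]mulmxA -fr mulmxA -ur -ul.
  by rewrite adjmxM adjmx_tens /hid adjmx1 -!mulmxA.
rewrite -[_ *m _ *m (hid a *t (f *t hid b))]mulmxA e2.
transitivity (runit a *m ((hid a *t (adjmx (munit A) *m mmul A))
  *m ((hid a *t (hid a *t adjmx f)) *m assoc a a b)
  *m ((adjmx (mmul A) *m munit A) *t hid b)) *m unlunit b); last by rewrite !mulmxA.
rewrite assoc_natural -!mulmxA [(hid (a * a) *t _) *m _]mulmxA e3 -mulmxA.
rewrite unlunit_natural !mulmxA -[runit a *m _ *m _ *m _]mulmxA.
rewrite -[runit a *m _ *m _]mulmxA [_ *m (assoc _ _ _ *m _)]mulmxA snake.
by rewrite mulmxA runit_adj mul1mx lunitK mul1mx.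
Qed.

End StarHom.

Section SfEquiv.
Variables (R : realType) (G : compact_quantum_group R) (F : fibre_functor G).
Local Notation C := R[i].

Lemma modification_adj F1 F2 (a b : @pretrans R G F1 F2) (f : 'M[C]_(hdim b, hdim a)) :
  unitary f -> modification f -> modification (a := b) (b := a) (adjmx f).
Proof.
move=> [f1 f2] /modificationP fm; apply/modificationP => X i j.
rewrite -[LHS]mul1mx -f1 -!mulmxA; congr (_ *m _).
by rewrite mulmxA -fm -mulmxA f2 mulmx1.
Qed.

Lemma sf_isomorphicP (A B : simple_frobenius F) (f : 'M[C]_(hdim (pobj B), hdim (pobj A))) :
  unitary f -> modification f ->
  f *m pmul A = pmul B *m (f *t f) -> f *m punit A = punit B ->
  sf_isomorphic A B.
Proof.
move=> fu fm fM f1; exists f; split=> //.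
by apply: unitary_star_homomorphism => //; case: (sf_frobenius A).
Qed.

Lemma sf_refl (A : simple_frobenius F) : sf_isomorphic A A.
Proof.
apply: (@sf_isomorphicP A A 1%:M); first exact: unitary1.
- by apply/modificationP => X i j; rewrite mulmx1 mul1mx.
- by rewrite mul1mx tensmx11 mulmx1.
- by rewrite mul1mx.
Qed.

Lemma sf_sym (A B : simple_frobenius F) : sf_isomorphic A B -> sf_isomorphic B A.
Proof.
move=> [f [fu fm [/= fM f1 _]]]; have [g1 g2] := fu.
apply: (@sf_isomorphicP B A (adjmx f)); first exact: unitary_adj.
- exact: modification_adj.
- rewrite -[pmul B]mulmx1 -tensmx11 -g2 -tensmx_mul -adjmx_tens.
  by rewrite [pmul B *m _]mulmxA -fM !mulmxA g1 mul1mx.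
- by rewrite -f1 mulmxA g1 mul1mx.
Qed.

Lemma sf_trans (A B D : simple_frobenius F) :
  sf_isomorphic A B -> sf_isomorphic B D -> sf_isomorphic A D.
Proof.
move=> [f [fu /modificationP fm [/= fM f1 _]]] [g [gu /modificationP gm [/= gM g1 _]]].
apply: (@sf_isomorphicP A D (g *m f)); first exact: unitaryM.
- by apply/modificationP => X i j; rewrite mulmxA gm -mulmxA fm mulmxA.
- by rewrite -mulmxA fM mulmxA gM -mulmxA tensmx_mul.
- by rewrite -mulmxA f1.
Qed.

End SfEquiv.

(** * Representations of matrix algebras *)

Section Inner.
Variable R : realType.
Local Notation C := R[i].

(** Gram-Schmidt on a basis of the row space gives an isometry onto the range. *)
Lemma projection_range n (p : 'M[C]_n) : p *m p = p -> adjmx p = p ->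
  exists r (y : 'M[C]_(n, r)), adjmx y *m y = 1%:M /\ y *m adjmx y = p.
Proof.
move=> pp pa.
have [r [b [bp bu]]] : exists r (b : 'M[C]_(r, n)),
    (b :=: p)%MS /\ b *m adjmx b = 1%:M.
  pose b := schmidt (row_base p); exists (\rank p), b; split.
    by apply: eqmx_trans (eq_row_base p); apply/eqmx_schmidt_free/row_base_free.
  have /unitarymxP <- : b \is unitarymx by apply/schmidt_unitarymx/rank_leq_col.
  by congr (_ *m _); apply/matrixP=> i j; rewrite !mxE.
have pb : p *m (adjmx b *m b) = p.
  have /submxP[z pE] : (p <= b)%MS by rewrite bp.
  by rewrite {1}pE -mulmxA [b *m _]mulmxA bu mul1mx -pE.
have bbp : b *m p = b.
  have /submxP[z bE] : (b <= p)%MS by rewrite bp.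
  by rewrite bE -mulmxA pp.
exists r, (adjmx b); rewrite adjmxK; split=> //.
by rewrite -[RHS]pa -[in RHS]pb !adjmxM adjmxK pa -mulmxA bbp.
Qed.

Variables (d m : nat) (phi : 'M[C]_d -> 'M[C]_m).
Hypothesis d0 : (0 < d)%N.
Hypothesis phiD : forall x y, phi (x + y) = phi x + phi y.
Hypothesis phiZ : forall k x, phi (k *: x) = k *: phi x.
Hypothesis phiM : forall x y, phi (x *m y) = phi x *m phi y.
Hypothesis phi1 : phi 1%:M = 1%:M.
Hypothesis phia : forall x, phi (adjmx x) = adjmx (phi x).

(** The images of the matrix units e_p0 carry an orthonormal basis y of the range of
    phi(e_00) to orthonormal bases of the ranges of all phi(e_pp). *)
Lemma matrix_representation :
  exists r (b : 'M[C]_(m, r * d)), unitary b /\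
    forall x, phi x *m b = b *m (1%:M *t x).
Proof.
pose o := Ordinal d0; pose e p q : 'M[C]_d := delta_mx p q.
have phi0 : phi 0 = 0 by have := phiZ 0 0; rewrite !scale0r.
have phi_sum I (r : seq I) (F : I -> 'M[C]_d) :
    phi (\sum_(i <- r) F i) = \sum_(i <- r) phi (F i).
  exact: (big_morph phi phiD phi0).
have ee p q p' q' : e p q *m e p' q' = (q == p')%:R *: e p q'.
  rewrite mul_delta_mx_cond; by case: (q == p'); rewrite ?scale1r ?scale0r.
have ea p q : adjmx (e p q) = e q p.
  by apply/matrixP=> i j; rewrite !mxE rmorph_nat andbC.
have [|| r [y [y1 y2]]] := @projection_range m (phi (e o o)).
- by rewrite -phiM ee eqxx scale1r.
- by rewrite -phia ea.
have yp : phi (e o o) *m y = y by rewrite -y2 -mulmxA y1 mulmx1.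
pose b : 'M[C]_(m, r * d) := \matrix_(x, z)
  (phi (e (mxtens_unindex z).2 o) *m y) x (mxtens_unindex z).1.
have bE x j p : b x <|j, p|> = (phi (e p o) *m y) x j.
  by rewrite mxE mxtens_indexK.
exists r, b; split; first split.
- apply/mxtens_matrixP=> j p j' p'.
  transitivity ((adjmx (phi (e p o) *m y) *m (phi (e p' o) *m y)) j j').
    by rewrite !mxE; apply: eq_bigr => x _; rewrite !adjmxE !bE.
  rewrite adjmxM -mulmxA [adjmx (phi _) *m _]mulmxA -phia ea -phiM ee phiZ.
  rewrite -scalemxAl yp -scalemxAr y1 mxE mxE [RHS]mxE mxtens_index_eq.
  by rewrite -mulnb natrM mulrC.
- apply/matrixP=> x x'.
  transitivity ((\sum_p phi (e p p)) x x').
    rewrite summxE mxE mxtens_sum exchange_big; apply: eq_bigr => p _ /=.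
    transitivity (((phi (e p o) *m y) *m adjmx (phi (e p o) *m y)) x x').
      by rewrite mxE; apply: eq_bigr => j _; rewrite !adjmxE !bE.
    rewrite adjmxM mulmxA -[_ *m y *m _]mulmxA y2 -phia ea -!phiM !ee !eqxx.
    by rewrite scale1r ee eqxx !scale1r.
  rewrite -phi_sum; congr ((_ : 'M__) x x'); rewrite -[RHS]phi1; congr phi.
  by rewrite -mx1_sum_delta.
move=> a; apply/matrixP=> x z; case: (mxtens_indexP z) => j p.
rewrite mul_hidlE.
transitivity ((phi a *m (phi (e p o) *m y)) x j).
  by rewrite !mxE; apply: eq_bigr => w _; rewrite bE.
have -> : phi a *m (phi (e p o) *m y) = \sum_q a q p *: (phi (e q o) *m y).
  rewrite mulmxA -phiM.
  have -> : a *m e p o = \sum_q a q p *: e q o.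
    apply/matrixP=> i k; rewrite summxE (bigD1 i) //= big1 ?addr0 => [|l li].
      rewrite mxE (bigD1 p) //= big1 ?addr0 => [|l lp]; last first.
        by rewrite mxE (negPf lp) mulr0.
      by rewrite !mxE !eqxx.
    by rewrite !mxE eq_sym (negPf li) mulr0.
  rewrite phi_sum mulmx_suml; apply: eq_bigr => q _.
  by rewrite phiZ scalemxAl.
rewrite summxE; apply: eq_bigr => q _; by rewrite mxE bE mulrC.
Qed.

End Inner.

Section InnerCorollaries.
Variable R : realType.
Local Notation C := R[i].

Lemma unitary_castid m m' (e : m = m') :
  unitary (castmx (e, erefl) 1%:M : 'M[C]_(m', m)).
Proof. by case: m' / e; rewrite castmx_id; apply: unitary1. Qed.

Lemma pair_mul_vec d (x y : 'M[C]_d) :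
  pair_mul d *m (vec x *t vec y) = (sqrtC (d%:R : C))^-1 *: vec (x *m y).
Proof.
apply/matrixP=> z o; case: (mxtens_indexP z) => p q.
rewrite pair_mul_mulE mxE vecE mxE; congr (_ * _); apply: eq_bigr => b _.
by case: (mxtens_indexP o) => o1 o2; rewrite tensmxE !vecE.
Qed.

Lemma vec_adj_vec d (x y : 'M[C]_d) :
  adjmx (vec x) *m vec y = (\tr (adjmx x *m y))%:M.
Proof.
apply/matrixP=> i j; rewrite !ord1 mxE [RHS]mxE mulr1n mxtens_sum exchange_big.
apply: eq_bigr => q _; rewrite mxE; apply: eq_bigr => p _.
by rewrite !adjmxE !vecE.
Qed.

Lemma vecD d (x y : 'M[C]_d) : vec (x + y) = vec x + vec y.
Proof. by apply/matrixP=> i j; rewrite !mxE. Qed.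
Lemma vecZ d k (x : 'M[C]_d) : vec (k *: x) = k *: vec x.
Proof. by apply/matrixP=> i j; rewrite !mxE. Qed.
Lemma unvecD d (x y : 'M[C]_(d * d, 1)) : unvec (x + y) = unvec x + unvec y.
Proof. by apply/matrixP=> i j; rewrite !mxE. Qed.
Lemma unvecZ d k (x : 'M[C]_(d * d, 1)) : unvec (k *: x) = k *: unvec x.
Proof. by apply/matrixP=> i j; rewrite !mxE. Qed.

(** Up to a scalar the multiplication of the pair monoid is that of M_d, the unit
    gives the trace and the inner product of vectors is that of Hilbert-Schmidt. So f
    is a star-automorphism of M_d, and a representation of M_d of dimension d is
    unitarily equivalent to the defining one. *)
Lemma inner_pair_isomorphism d1 d2 (f : 'M[C]_(d2 * d2, d1 * d1)) :
  (0 < d1)%N -> unitary f ->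
  f *m pair_mul d1 = pair_mul d2 *m (f *t f) -> f *m pair_unit d1 = pair_unit d2 ->
  exists v : 'M[C]_(d2, d1), unitary v /\
    forall x, f *m vec x = vec (v *m x *m adjmx v).
Proof.
move=> d0 fu fm f1; have dd := unitary_dim fu.
have d12 : d1 = d2.
  by apply/eqP; rewrite -(eqn_exp2r _ _ (isT : 0 < 2)%N) -!mulnn dd.
subst d2; have [fu1 fu2] := fu.
pose phi (x : 'M[C]_d1) : 'M[C]_d1 := unvec (f *m vec x).
have fvec x : f *m vec x = vec (phi x) by rewrite unvecK.
have s0 : sqrtC (d1%:R : C) != 0 := sqrt_dim_neq0 _ d0.
have phi1 : phi 1%:M = 1%:M.
  move: f1; rewrite !pair_unit_vec -scalemxAr => /(scalerI s0).
  by rewrite fvec => /(congr1 (@unvec _ _)); rewrite !vecK.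
have phiM x y : phi (x *m y) = phi x *m phi y.
  have := congr1 (mulmx^~ (vec x *t vec y)) fm; rewrite -!mulmxA tensmx_mul.
  rewrite !fvec !pair_mul_vec -scalemxAr fvec.
  move/(scalerI (invr_neq0 s0)) => /(congr1 (@unvec _ _)); by rewrite !vecK.
have phi_tr x : \tr (phi x) = \tr x.
  have e : adjmx (vec 1%:M) *m vec (phi x) = adjmx (vec 1%:M) *m vec x.
    rewrite -{1}phi1 -!fvec adjmxM -mulmxA [adjmx f *m _]mulmxA fu1 mul1mx.
    by [].
  move: e; rewrite !vec_adj_vec !adjmx1 !mul1mx.
  by move/matrixP/(_ ord0 ord0); rewrite !mxE.
have phiT x y : \tr (adjmx (phi x) *m phi y) = \tr (adjmx x *m y).
  have : adjmx (vec (phi x)) *m vec (phi y) = adjmx (vec x) *m vec y.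
    by rewrite -!fvec adjmxM -mulmxA [adjmx f *m _]mulmxA fu1 mul1mx.
  by rewrite !vec_adj_vec => /matrixP/(_ ord0 ord0); rewrite !mxE.
have phi_surj y : y = phi (unvec (adjmx f *m vec y)).
  by rewrite /phi unvecK mulmxA fu2 mul1mx vecK.
(* Both sides have the same inner products with the image of phi, which is onto. *)
have phia x : phi (adjmx x) = adjmx (phi x).
  apply/eqP; rewrite -subr_eq0; apply/eqP/mxtrace_adj_mul_eq0.
  set z := adjmx (_ - _); rewrite [z]phi_surj; set w := unvec _.
  by rewrite mulmxBl raddfB /= -phiM phi_tr phiT subrr.
have [||r [b [bu bphi]]] := @matrix_representation R d1 d1 phi d0 _ _ phiM phi1 phia.
- by move=> x y; rewrite /phi vecD mulmxDr unvecD.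
- by move=> k x; rewrite /phi vecZ -scalemxAr unvecZ.
have dr := unitary_dim bu.
have r1 : r = 1%N.
  by apply/eqP; rewrite -(eqn_pmul2r d0) mul1n -dr.
move: b bu bphi {dr}; rewrite r1 => b bu bphi.
exists (b *m unlunit d1); split; first exact/unitaryM/unitary_castid.
move=> x; rewrite fvec; congr vec.
have [u1 u2] := unitaryM bu (unitary_castid (esym (mul1n d1))).
rewrite -[LHS]mulmx1 -u2 mulmxA; congr (_ *m _).
by rewrite mulmxA bphi -!mulmxA (unlunit_natural x).
Qed.

Lemma scalar_commutant d n m (u : 'M['M[C]_d]_(n, m)) : (0 < d)%N ->
  (forall x : 'M[C]_d, x%:M *m u = u *m x%:M) -> exists e, u = scblk d e.
Proof.
move=> d0 ux; pose o := Ordinal d0.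
exists (\matrix_(i, j) u i j o o); apply/matrixP=> i j; apply/matrixP=> q p.
have /matrixP/(_ i j) := ux (delta_mx p o); rewrite !mxE.
rewrite (bigD1 i) //= [X in _ + X]big1 => [|k ki]; last first.
  by rewrite mxE eq_sym (negPf ki) mulr0n mul0r.
rewrite (bigD1 j) //= [X in _ = _ + X]big1 => [|k kj]; last first.
  by rewrite mxE (negPf kj) mulr0n mulr0.
rewrite !addr0 !mxE !eqxx !mulr1n => /matrixP/(_ q o).
rewrite -!mulmxE !mxE (bigD1 o) //= [X in _ + X]big1 => [|k ko]; last first.
  by rewrite mxE (negPf ko) andbF mul0r.
rewrite [X in _ = X](bigD1 p) //= [X in _ = _ + X]big1 => [|k kp]; last first.
  by rewrite mxE (negPf kp) mulr0.
rewrite !addr0 !mxE !eqxx andbT mulr1 => <-.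
by rewrite mulr_natl.
Qed.

End InnerCorollaries.

(** * Transformations with a one-dimensional Hilbert space *)

Section Line.
Variables (R : realType) (G : compact_quantum_group R).
Local Notation C := R[i].
Implicit Types F : fibre_functor G.

Definition monoidal_iso F1 F2 (c : forall X : rep G, 'M[C]_(F2 X, F1 X)) : Prop :=
  [/\ forall X, unitary (c X),
      forall X Y (f : rhom X Y), fmap F2 f *m c X = c Y *m fmap F1 f,
      forall X Y, c (rtens X Y) *m fmul F1 X Y = fmul F2 X Y *m (c X *t c Y)
    & c rone *m funit F1 = funit F2].

Lemma monoidal_iso_adj F1 F2 (c : forall X : rep G, 'M[C]_(F2 X, F1 X)) :
  monoidal_iso c -> @monoidal_iso F2 F1 (fun X => adjmx (c X)).
Proof.
move=> [cu cn cm c1]; split=> [X|X Y f|X Y|].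
- exact: unitary_adj.
- have [x1 x2] := cu X; have [y1 y2] := cu Y.
  rewrite -[LHS]mul1mx -y1 -!mulmxA; congr (_ *m _).
  by rewrite !mulmxA -cn -mulmxA x2 mulmx1.
- have [x1 x2] := cu (rtens X Y); have [y1 y2] := unitary_tens (cu X) (cu Y).
  rewrite -[RHS]mul1mx -x1 -!mulmxA; congr (_ *m _).
  by rewrite !mulmxA cm -mulmxA -adjmx_tens y2 mulmx1.
- have [x1 x2] := cu rone.
  by rewrite -c1 mulmxA x1 mul1mx.
Qed.

Definition scalar_trans F1 F2 (c : forall X : rep G, 'M[C]_(F2 X, F1 X)) : pretrans F1 F2 :=
  @PreTrans R G F1 F2 1 (fun X => unblk (scblk 1 (c X))).

Lemma bcomp_scalar_trans F1 F2 (c : forall X : rep G, 'M[C]_(F2 X, F1 X)) X :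
  bcomp (scalar_trans c) X = scblk 1 (c X).
Proof. exact: unblkK. Qed.

Lemma bunitary_scblk h m n (c : 'M[C]_(m, n)) : (0 < h)%N ->
  bunitary (scblk h c) <-> unitary c.
Proof.
move=> h0; rewrite /bunitary badj_scblk -!scblkM -!scblk1; split=> [[]|[-> ->] //].
by move=> /(scblk_inj h0) ? /(scblk_inj h0) ?.
Qed.

Lemma is_upt_scalar F1 F2 (a : pretrans F1 F2) (c : forall X : rep G, 'M[C]_(F2 X, F1 X)) :
  (0 < hdim a)%N -> (forall X, bcomp a X = scblk _ (c X)) ->
  is_upt a <-> monoidal_iso c.
Proof.
move=> h0 ac; have inj m n := @scblk_inj R (hdim a) m n h0.
split=> [/is_uptP[a1 a2 a3 a4]|[c1 c2 c3 c4]]; [|apply/is_uptP]; split=> [X|X Y f|X Y|].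
- by apply/(bunitary_scblk _ h0); rewrite -ac.
- by apply: inj; rewrite !scblkM -!ac a2.
- by apply: inj; rewrite !scblkM scblk_tens -!ac a3.
- by apply: inj; rewrite scblkM -ac a4.
- by rewrite ac; apply/(bunitary_scblk _ h0).
- by rewrite !ac -!scblkM c2.
- by rewrite !ac -scblk_tens -!scblkM c3.
- by rewrite ac -scblkM c4.
Qed.

Lemma is_upt_scalar_trans F1 F2 (c : forall X : rep G, 'M[C]_(F2 X, F1 X)) :
  monoidal_iso c -> is_upt (scalar_trans c).
Proof. by move=> cP; apply/(is_upt_scalar (c := c)) => // X; apply: bcomp_scalar_trans. Qed.

Lemma bcomp_scalar_trans_tens F1 F2 F3 (c : forall X : rep G, 'M[C]_(F2 X, F1 X))
    (c' : forall X : rep G, 'M[C]_(F3 X, F2 X)) X :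
  bcomp (pt_tens (scalar_trans c) (scalar_trans c')) X = scblk 1 (c' X *m c X).
Proof.
apply/matrixP=> i k; rewrite bcomp_tens !mxE raddf_sum; apply: eq_bigr => j _.
rewrite !bcomp_scalar_trans !mxE /=; apply/mxtens_matrixP=> p q p' q'.
by rewrite tensmxE !mxE !ord1 !eqxx !mulr1n mulrC.
Qed.

Lemma scalar_trans_equivalence F1 F2 (c : forall X : rep G, 'M[C]_(F2 X, F1 X))
    (E : upt F1 F2) :
  monoidal_iso c -> upt_data E = scalar_trans c -> dagger_equivalence E.
Proof.
case: E => e eP cP /= eE; move: eP; rewrite {e}eE => eP.
have [cu _ _ _] := cP.
exists (UPT (is_upt_scalar_trans (monoidal_iso_adj cP))); split.
- exists 1%:M; split; first exact: unitary1.
  apply/modificationP => X i j; rewrite mulmx1 mul1mx.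
  rewrite bcomp_scalar_trans_tens bcomp_id; have [_ ->] := cu X; by rewrite scblk1.
- exists 1%:M; split; first exact: unitary1.
  apply/modificationP => X i j; rewrite mulmx1 mul1mx.
  rewrite bcomp_scalar_trans_tens bcomp_id; have [-> _] := cu X; by rewrite scblk1.
Qed.

(** An isomorphism from the identity to the composite of E with its inverse makes
    the product of the two dimensions equal to 1. *)
Lemma equivalence_scalar F1 F2 (E : upt F1 F2) : dagger_equivalence E ->
  hdim E = 1%N /\ exists c, monoidal_iso c /\ forall X, bcomp E X = scblk _ (c X).
Proof.
move=> [E' [[f [fu _]] _]].
have h1 : hdim E = 1%N.
  have := unitary_dim fu => /= /eqP; rewrite muln_eq1 => /andP[_ /eqP //].
split=> //.
have sc h m n (u : 'M['M[C]_h]_(m, n)) : h = 1%N -> exists c, u = scblk h c.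
  move=> hh; subst h; exists (\matrix_(i, j) u i j ord0 ord0).
  by apply/matrixP=> i j; rewrite !mxE -mx11_scalar.
have cX X : {c | bcomp E X = scblk _ c} by apply/cid/sc.
exists (fun X => sval (cX X)).
have e X : bcomp E X = scblk _ (sval (cX X)) := svalP (cX X).
by split=> //; apply/(is_upt_scalar _ e); rewrite ?h1 //; apply: uptP.
Qed.

End Line.

(** * Equivalence of transformations and isomorphism of monoids *)

Section Classification.
Variables (R : realType) (G : compact_quantum_group R).
Local Notation C := R[i].
Local Notation F := (canonical_fibre_functor G).


Lemma runit_tens_scalar d (x : 'M[C]_d) k :
  runit d *m (x *t (k%:M : 'M_1)) = (k *: x) *m runit d.
Proof.
apply/matrixP=> p y; case: (mxtens_indexP y) => q o; rewrite runit_mulE tensmxE.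
rewrite mul_castid castmxE cast_ord_id !mxE !ord1 mulr1n mulrC; congr (_ * x p _).
by apply: val_inj; rewrite /= muln1 addn0.
Qed.

Lemma absorb_line d h : h = 1%N -> exists r : 'M[C]_(d, d * h),
  unitary r /\ forall (x : 'M[C]_d) k, r *m (x *t k%:M) = (k *: x) *m r.
Proof.
move=> h1; subst h; exists (runit d); split=> [|x k]; first exact: unitary_castid.
exact: runit_tens_scalar.
Qed.

Lemma pants_simple (F' : fibre_functor G) (a : pretrans F F') :
  (0 < hdim a)%N -> simple (pair_of_pants a).
Proof.
move=> h0; exists (hdim a); split=> //; exists 1%:M; split; first exact: unitary1.
apply: unitary_star_homomorphism.
- exact: pair_special_frobenius.
- exact: unitary1.
- by rewrite mul1mx tensmx11 mulmx1.
- by rewrite mul1mx.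
Qed.

Definition pants (a : upt_from F) : simple_frobenius F :=
  SimpleFrobenius (pants_special_frobenius (uptP (trans a)) (trans_nonzero a))
    (pants_simple (trans_nonzero a)).

Lemma pants_vec (F' : fibre_functor G) (a : pretrans F F') X i k x :
  bcomp (pobj (pair_of_pants a)) X i k *m vec x
  = vec (\sum_j bcomp a X j k *m x *m adjmx (bcomp a X j i)).
Proof.
have vec0 : vec (0 : 'M[C]_(hdim a)) = 0 by apply/matrixP=> p q; rewrite !mxE.
rewrite bcomp_pants mulmx_suml (big_morph _ (@vecD R _) vec0).
by apply: eq_bigr => j _; rewrite tens_vec tr_cjmx.
Qed.

(** An equivalence of transformations is, up to a unitary v between their Hilbert
    spaces, a unitary scalar matrix c on the target side; in the product with the
    dual c meets its adjoint. *)
Lemma equivalent_pants (a1 a2 : upt_from F) :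
  upt_equivalent a1 a2 -> sf_isomorphic (pants a1) (pants a2).
Proof.
move=> [E [Eeq [f [fu /modificationP fm]]]].
have [h1 [c [[cu _ _ _] Ec]]] := equivalence_scalar Eeq.
have [r [ru rE]] := absorb_line (hdim (trans a2)) h1.
pose v : 'M[C]_(hdim (trans a2), hdim (trans a1)) := r *m f.
have vu : unitary v := unitaryM ru fu.
have vE X i k : v *m bcomp (trans a1) X i k
    = \sum_j c X i j *: (bcomp (trans a2) X j k *m v).
  rewrite -mulmxA -fm bcomp_tens mulmxA mulmx_sumr mulmx_suml.
  by apply: eq_bigr => j _; rewrite Ec [scblk _ _ _ _]mxE rE -!scalemxAl mulmxA.
have [v1 v2] := vu; have d12 := unitary_dim vu.
have vvec x : (v *t cjmx v) *m vec x = vec (v *m x *m adjmx v).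
  by rewrite tens_vec tr_cjmx.
apply: (@sf_isomorphicP _ _ _ (pants a1) (pants a2) (v *t cjmx v)).
- by apply: unitary_tens => //; apply: unitary_cjmx.
- apply/modificationP => X i k; apply: vec_inj_mx => x.
  rewrite -!mulmxA vvec !pants_vec vvec; congr vec.
  have [c1 c2] := cu X.
  transitivity (\sum_j (v *m bcomp (trans a1) X j k) *m x
      *m adjmx (v *m bcomp (trans a1) X j i)); last first.
    rewrite mulmx_sumr mulmx_suml; apply: eq_bigr => j _.
    by rewrite adjmxM !mulmxA.
  transitivity (\sum_j \sum_l \sum_l' (Num.conj (c X j l') * c X j l) *:
     ((bcomp (trans a2) X l k *m v) *m x *m adjmx (bcomp (trans a2) X l' i *m v))).
    rewrite exchange_big; apply: eq_bigr => l _ /=.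
    rewrite exchange_big (bigD1 l) //= [X in _ = _ + X]big1 ?addr0 => [|l' ll].
      rewrite -scaler_suml.
      have /matrixP/(_ l l) := c1; rewrite !mxE eqxx => e.
      have -> : \sum_j Num.conj (c X j l) * c X j l = 1.
        by rewrite -[RHS]e; apply: eq_bigr => j _; rewrite adjmxE.
      by rewrite scale1r adjmxM !mulmxA.
    rewrite -scaler_suml.
    have /matrixP/(_ l' l) := c1; rewrite !mxE (negPf ll) => e.
    have -> : \sum_j Num.conj (c X j l') * c X j l = 0.
      by rewrite -[RHS]e; apply: eq_bigr => j _; rewrite adjmxE.
    by rewrite scale0r.
  apply: eq_bigr => j _; rewrite !vE adjmx_sum mulmx_suml mulmx_suml.
  apply: eq_bigr => l _; rewrite mulmx_sumr; apply: eq_bigr => l' _.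
  by rewrite adjmxZ -!scalemxAl -scalemxAr scalerA mulrC.
- rewrite /= pair_mul_tens // -cj_adjmx -cjmxM v1.
  by rewrite /cjmx map_mx1 insert_mul1.
- rewrite /= !pair_unit_vec -scalemxAr vvec mulmx1 v2; congr (_ *: _).
  by congr (sqrtC _%:R).
Qed.

Lemma unitary_conjugation h h' (v : 'M[C]_(h', h)) : unitary v ->
  exists phi : {rmorphism 'M[C]_h' -> 'M[C]_h},
  [/\ forall x, phi x = adjmx v *m x *m v, forall c, phi c%:M = c%:M
    & forall x, phi (adjmx x) = adjmx (phi x)].
Proof.
move=> [v1 v2]; pose ad x : 'M[C]_h := adjmx v *m x *m v.
have adM : monoid_morphism (ad : 'M[C]_h' -> _).
  split; first by rewrite /ad mulmx1 v1.
  move=> x y; rewrite /ad -!mulmxE !mulmxA -[_ *m v *m adjmx v]mulmxA v2.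
  by rewrite mulmx1.
have adB : zmod_morphism (ad : 'M[C]_h' -> _).
  by move=> x y; rewrite /ad mulmxBr mulmxBl.
pose adr := HB.pack_for {rmorphism 'M[C]_h' -> 'M[C]_h} ad
  (GRing.isZmodMorphism.Build _ _ _ adB) (GRing.isMonoidMorphism.Build _ _ _ adM).
exists adr; split=> [//|c|x].
  by rewrite /= /ad mul_mx_scalar -scalemxAl v1 scalemx1.
by rewrite /= /ad !adjmxM adjmxK mulmxA.
Qed.

Lemma mulmx_scalarE (K : pzRingType) m n (A : 'M[K]_(m, n)) x i j :
  (A *m x%:M) i j = A i j * x.
Proof.
rewrite mxE (bigD1 j) //= big1 ?addr0 => [|k kj]; first by rewrite mxE eqxx mulr1n.
by rewrite mxE (negPf kj) mulr0n mulr0.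
Qed.

(** The isomorphism of monoids is conjugation by a unitary v. After conjugation a1 and
    a2 define the same maps on M_h, so their dual block matrices differ by a matrix
    commuting with M_h. This is a scalar matrix, unitary, natural and monoidal
    because a1 and a2 are: a one-dimensional equivalence of the targets. *)
Lemma pants_equivalent (a1 a2 : upt_from F) :
  sf_isomorphic (pants a1) (pants a2) -> upt_equivalent a1 a2.
Proof.
case: a1 => F1 [a1 a1P] h1; case: a2 => F2 [a2 a2P] h2 /=.
move=> [f [fu /modificationP fm [fM f1 _]]]; rewrite /= in f fu fm fM f1.
have [v [vu fv]] := inner_pair_isomorphism h1 fu fM f1.
have [v1 v2] := vu.
have [phi [phiE phic phia]] := unitary_conjugation vu.
pose g X := map_mx phi (bcomp a2 X).
have [a11 a12 a13 a14] := (is_uptP a1).1 a1P.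
have [a21 a22 a23 a24] := (is_uptP a2).1 a2P.
have dual (F' : fibre_functor G) (a : pretrans F F') X : is_upt a ->
    (0 < hdim a)%N -> bunitary (bcomp a X)^T.
  move=> aP h0; have [w1 w2] := dual_bunitary X aP h0 (or_introl erefl).
  have e : badj (cadj (bcomp a X)) = (bcomp a X)^T by rewrite /badj cadjK.
  have e' : badj (bcomp a X)^T = cadj (bcomp a X).
    by rewrite -e badjK.
  by split; rewrite e' -e.
have sigma X i k x :
    \sum_j bcomp a1 X j k *m x *m adjmx (bcomp a1 X j i)
    = \sum_j g X j k *m x *m adjmx (g X j i).
  have := congr1 (mulmx^~ (vec x)) (fm X i k).
  rewrite -!mulmxA fv !pants_vec fv => /(congr1 (@unvec _ _)); rewrite !vecK => e.
  transitivity (adjmx v *m (v *m (\sum_j bcomp a1 X j k *m x *m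
     adjmx (bcomp a1 X j i)) *m adjmx v) *m v).
    by rewrite !mulmxA v1 mul1mx -mulmxA v1 mulmx1.
  rewrite -e mulmx_sumr mulmx_suml; apply: eq_bigr => j _.
  by rewrite !mxE !phiE !adjmxM adjmxK !mulmxA.
have gu X : bunitary (g X) by apply: map_bunitary.
(* The transposed block matrix is unitary because the dual is a transformation. *)
have guT X : bunitary (g X)^T.
  by rewrite map_trmx; apply: map_bunitary => //; apply: dual.
have /(_ _)/cid ex X : exists c : 'M[C]_(F2 X, F1 X),
    unitary c /\ g X = scblk _ c *m bcomp a1 X.
  have [g1 g2] := guT X; have [w1 w2] := dual _ _ X a1P h1.
  have e x : (bcomp a1 X)^T *m x%:M *m badj (bcomp a1 X)^T
           = (g X)^T *m x%:M *m badj (g X)^T.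
    apply/matrixP=> k i; rewrite !mxE.
    transitivity (\sum_j bcomp a1 X j k *m x *m adjmx (bcomp a1 X j i)).
      by apply: eq_bigr => j _; rewrite mulmx_scalarE badjE !mxE.
    by rewrite sigma; apply: eq_bigr => j _; rewrite mulmx_scalarE badjE !mxE.
  have [|c cE] := @scalar_commutant R (hdim a1) _ _
      (badj (bcomp a1 X)^T *m (g X)^T) h1.
    move=> x; transitivity (badj (bcomp a1 X)^T *m
        ((bcomp a1 X)^T *m x%:M *m badj (bcomp a1 X)^T) *m (g X)^T).
      by rewrite !mulmxA w1 mul1mx.
    by rewrite e !mulmxA -mulmxA g1 mulmx1.
  have gc : g X = scblk _ c^T *m bcomp a1 X.
    by apply: trmx_inj; rewrite scblk_mul_tr trmxK -cE mulmxA w2 mul1mx.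
  exists c^T; split=> //; apply/(bunitary_scblk _ h1).
  have [x1 x2] := a11 X.
  have -> : scblk _ c^T = g X *m badj (bcomp a1 X).
    by rewrite gc -mulmxA x2 mulmx1.
  by apply: bunitaryM; [exact: gu|exact/bunitary_badj/a11].
pose c X := sval (ex X).
have cu X : unitary (c X) := (svalP (ex X)).1.
have cE X : g X = scblk _ (c X) *m bcomp a1 X := (svalP (ex X)).2.
have cancel m n p (w : 'M['M[C]_(hdim a1)]_(n, p)) (x y : 'M[C]_(m, n)) :
    bunitary w -> scblk _ x *m w = scblk _ y *m w -> x = y.
  move=> [_ w2] xy; apply: (scblk_inj h1).
  by rewrite -[LHS]mulmx1 -w2 mulmxA xy -mulmxA w2 mulmx1.
have phis m n (x : 'M[C]_(m, n)) : map_mx phi (scblk _ x) = scblk _ x.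
  exact: map_scblk.
have cP : monoidal_iso c.
  split=> // [X Y t|X Y|].
  - apply: (cancel _ _ _ _ _ _ (a11 X)).
    rewrite !scblkM -!mulmxA -cE a12 mulmxA -cE /g -[LHS](congr1 (mulmx^~ _) (phis _ _ _)).
    by rewrite -map_mxM a22 map_mxM phis.
  - apply: (cancel _ _ _ _ _ _ (bunitary_tens (a11 X) (a11 Y))).
    rewrite !scblkM -!mulmxA -a13 scblk_mul_tensmx -!cE mulmxA -cE.
    by rewrite -map_mxT -[in RHS]phis -map_mxM -a23 map_mxM phis.
  - apply: (scblk_inj h1); rewrite scblkM -a14 mulmxA -cE.
    by rewrite -[in LHS]phis -map_mxM a24 phis.
have dP := monoidal_iso_adj cP.
pose E : upt F2 F1 := UPT (is_upt_scalar_trans dP).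
exists E; split; first exact: (scalar_trans_equivalence dP).
pose r : 'M[C]_(hdim a2, hdim a2 * 1) := runit (hdim a2).
have ru : unitary r by apply: unitary_castid.
have [r1 r2] := ru.
exists (adjmx r *m v); split; first by apply/unitaryM/vu/unitary_adj.
apply/modificationP => X i k.
have a1E : bcomp a1 X = scblk _ (adjmx (c X)) *m g X.
  by rewrite cE mulmxA -scblkM; have [-> _] := cu X; rewrite scblk1 mul1mx.
rewrite -[adjmx r *m v *m _]mulmxA.
have -> : v *m bcomp a1 X i k
    = (\sum_j Num.conj (c X j i) *: bcomp a2 X j k) *m v.
  rewrite a1E mxE mulmx_sumr mulmx_suml; apply: eq_bigr => j _.
  rewrite scblk_mulE adjmxE -scalemxAr -scalemxAl mxE phiE !mulmxA.
  by rewrite v2 mul1mx.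
rewrite !mulmxA; congr (_ *m v); rewrite bcomp_tens /=.
rewrite mulmx_suml mulmx_sumr; apply: eq_bigr => j _.
have -> : bcomp (scalar_trans (fun X => adjmx (c X))) X i j = (Num.conj (c X j i))%:M.
  by rewrite bcomp_scalar_trans !mxE.
rewrite -[LHS]mul1mx -r1 -!mulmxA; congr (_ *m _).
by rewrite mulmxA runit_tens_scalar -mulmxA r2 mulmx1.
Qed.

End Classification.

(** * Block representations of matrix algebras *)

Section Flat.
Variables (R : realType) (d : nat).
Local Notation C := R[i].
Local Notation B := 'M[C]_d.

Definition flat m n (u : 'M[B]_(m, n)) : 'M[C]_(m * d, n * d) :=
  \matrix_(x, y) u (mxtens_unindex x).1 (mxtens_unindex y).1
                   (mxtens_unindex x).2 (mxtens_unindex y).2.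
Definition unflat m n (a : 'M[C]_(m * d, n * d)) : 'M[B]_(m, n) :=
  \matrix_(i, j) \matrix_(p, q) a <|i, p|> <|j, q|>.

Lemma flatE m n (u : 'M[B]_(m, n)) i j p q : flat u <|i, p|> <|j, q|> = u i j p q.
Proof. by rewrite mxE !mxtens_indexK. Qed.

Lemma unflatK m n : cancel (@unflat m n) (@flat m n).
Proof. by move=> a; apply/mxtens_matrixP=> i p j q; rewrite flatE !mxE. Qed.

Lemma flatK m n : cancel (@flat m n) (@unflat m n).
Proof.
move=> u; apply/matrixP=> i j; apply/matrixP=> p q.
by rewrite [unflat _ _ _]mxE mxE flatE.
Qed.

Lemma flatM m n k (u : 'M[B]_(m, n)) (v : 'M[B]_(n, k)) :
  flat (u *m v) = flat u *m flat v.
Proof.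
apply/mxtens_matrixP=> i p j q; rewrite flatE !mxE summxE mxtens_sum.
by apply: eq_bigr => l _; rewrite mxE; apply: eq_bigr => r _; rewrite !flatE.
Qed.

Lemma flat_scalar n (x : B) : flat (x%:M : 'M[B]_n) = 1%:M *t x.
Proof.
apply/mxtens_matrixP=> i p j q; rewrite flatE tensmxE !mxE.
by case: (i == j); rewrite ?mul1r ?mul0r ?mulr1n // mulr0n mxE.
Qed.

Lemma flat1 n : flat (1%:M : 'M[B]_n) = 1%:M.
Proof. by rewrite flat_scalar tensmx11. Qed.

Lemma flat_badj m n (u : 'M[B]_(m, n)) : flat (badj u) = adjmx (flat u).
Proof.
by apply/mxtens_matrixP=> i p j q; rewrite flatE badjE !adjmxE flatE.
Qed.

(** A representation of M_d of dimension n d is n times the defining one. *)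
Lemma block_representation n (Th : B -> 'M[B]_n) : (0 < d)%N ->
  (forall x y, Th (x + y) = Th x + Th y) ->
  (forall k x i j, Th (k *: x) i j = k *: Th x i j) ->
  (forall x y, Th (x *m y) = Th x *m Th y) -> Th 1%:M = 1%:M ->
  (forall x, Th (adjmx x) = badj (Th x)) ->
  exists b : 'M[B]_n, bunitary b /\ forall x, Th x *m b = b *m x%:M.
Proof.
move=> d0 ThD ThZ ThM Th1 Tha.
have [|||||r [b [bu bTh]]] := @matrix_representation R d (n * d) (fun x => flat (Th x)) d0.
- by move=> x y; rewrite ThD; apply/matrixP=> i j; rewrite !mxE.
- by move=> k x; apply/matrixP=> i j; rewrite !mxE ThZ mxE.
- by move=> x y; rewrite ThM flatM.
- by rewrite Th1 flat1.
- by move=> x; rewrite Tha flat_badj.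
have rn : r = n.
  by apply/eqP; rewrite -(eqn_pmul2r d0) (unitary_dim bu).
subst r; exists (unflat b); split.
  have [b1 b2] := bu.
  by split; apply/(can_inj (@flatK _ _)); rewrite flatM flat_badj unflatK flat1.
by move=> x; apply/(can_inj (@flatK _ _)); rewrite !flatM unflatK bTh flat_scalar.
Qed.

Definition bscale m n (k : C) (u : 'M[B]_(m, n)) : 'M[B]_(m, n) :=
  map_mx (fun x => k *: x) u.

Lemma bscaleMl m n p k (u : 'M[B]_(m, n)) (v : 'M[B]_(n, p)) :
  bscale k u *m v = bscale k (u *m v).
Proof.
apply/matrixP=> i j; rewrite !mxE scaler_sumr; apply: eq_bigr => l _.
by rewrite mxE -!mulmxE scalemxAl.
Qed.

Lemma bscaleMr m n p k (u : 'M[B]_(m, n)) (v : 'M[B]_(n, p)) :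
  u *m bscale k v = bscale k (u *m v).
Proof.
apply/matrixP=> i j; rewrite !mxE scaler_sumr; apply: eq_bigr => l _.
by rewrite mxE -!mulmxE scalemxAr.
Qed.

Lemma scblk_lin m n k (e e' : 'M[C]_(m, n)) :
  scblk d (k *: e + e') = bscale k (scblk d e) + scblk d e'.
Proof.
by apply/matrixP=> i j; rewrite !mxE raddfD /= scale_scalar_mx.
Qed.

End Flat.

(** * The star-homomorphism of a simple Frobenius monoid *)

Section Star.
Variables (R : realType) (d n : nat) (d0 : (0 < d)%N).
Local Notation C := R[i].
Local Notation B := 'M[C]_d.
Variable t : 'M['M[C]_(d * d)]_n.
Hypothesis tu : bunitary t.
Hypothesis tm : forall i k,
  t i k *m pair_mul d = pair_mul d *m \sum_l t l k *t t i l.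
Hypothesis t1 : forall i k, t i k *m pair_unit d = (i == k)%:R *: pair_unit d.

(** The action t of A_G on M_d, read as one map from M_d to n x n matrices over M_d.
    The transpositions make the order of multiplication that of the block matrices. *)
Definition theta (x : B) : 'M[B]_n :=
  \matrix_(i, k) (unvec (t i k *m vec x^T))^T.

Lemma thetaE x i k : theta x i k = (unvec (t i k *m vec x^T))^T.
Proof. by rewrite mxE. Qed.

Lemma theta_vec x i k : t i k *m vec x = vec (theta x^T i k)^T.
Proof. by rewrite thetaE !trmxK unvecK. Qed.

Lemma thetaD x y : theta (x + y) = theta x + theta y.
Proof.
have trD (a b : B) : (a + b)^T = a^T + b^T by exact: linearD.
apply/matrixP=> i k; rewrite [RHS]mxE !thetaE.
by rewrite [(x + y)^T]trD vecD mulmxDr unvecD trD.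
Qed.

Lemma thetaZ c x i k : theta (c *: x) i k = c *: theta x i k.
Proof.
have trZ (a : B) : (c *: a)^T = c *: a^T by exact: linearZ.
by rewrite !thetaE [(c *: x)^T]trZ vecZ -scalemxAr unvecZ trZ.
Qed.

Lemma scale_sqrt_dim_inj m p (x y : 'M[C]_(m, p)) :
  sqrtC (d%:R : C) *: x = sqrtC (d%:R : C) *: y -> x = y.
Proof. exact: (scalerI (sqrt_dim_neq0 R d0)). Qed.

Lemma t_vec1 i k : t i k *m vec 1%:M = (i == k)%:R *: vec 1%:M.
Proof.
apply: scale_sqrt_dim_inj; have := t1 i k; rewrite pair_unit_vec -scalemxAr => ->.
by rewrite scalerA mulrC -scalerA.
Qed.

Lemma theta1 : theta 1%:M = 1%:M.
Proof.
apply/matrixP=> i k; rewrite !mxE trmx1 t_vec1 unvecZ vecK linearZ /= trmx1.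
by case: (i == k); rewrite ?scale1r ?scale0r.
Qed.

Lemma thetaM x y : theta (x *m y) = theta x *m theta y.
Proof.
apply/matrixP=> i k; apply: trmx_inj; apply: (can_inj (@vecK _ _)).
rewrite -[x *m y]trmxK -theta_vec trmx_mul.
have s0 : (sqrtC (d%:R : C))^-1 != 0 by rewrite invr_eq0 sqrt_dim_neq0.
apply: (scalerI s0); rewrite scalemxAr -pair_mul_vec mulmxA tm -mulmxA.
rewrite mulmx_suml mulmx_sumr mxE.
have vs I (r : seq I) (f : I -> B) : vec (\sum_(j <- r) f j)^T = \sum_(j <- r) vec (f j)^T.
  apply: (big_morph (fun z : B => vec z^T)) => [u v|]; first by rewrite linearD vecD.
  by apply/matrixP=> a b; rewrite !mxE.
rewrite vs scaler_sumr; apply: eq_bigr => l _.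
rewrite (tensmx_mul (t l k) (t i l) (vec y^T) (vec x^T)).
by rewrite !theta_vec !trmxK pair_mul_vec -trmx_mul.
Qed.

(** The unit is invariant under t, hence also under t*, because t is unitary; the
    adjoint of the unit is the trace. *)
Lemma theta_tr x i k : \tr (theta x i k) = (i == k)%:R * \tr x.
Proof.
have [u1 _] := tu.
have tadj : adjmx (t i k) *m vec 1%:M = (i == k)%:R *: vec 1%:M.
  have /matrixP/(_ k i) := u1; rewrite mxE => /(congr1 (mulmx^~ (vec 1%:M))).
  rewrite mulmx_suml (bigD1 i) //= [X in _ + X]big1 ?addr0 => [|l li]; last first.
    by rewrite -mulmxE -mulmxA t_vec1 (negPf li) scale0r mulmx0.
  rewrite -mulmxE -mulmxA t_vec1 eqxx scale1r badjE => ->.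
  rewrite mxE eq_sym; case: (i == k); rewrite ?mulr1n ?mul1mx ?scale1r //.
  by rewrite mulr0n mul0mx scale0r.
have : adjmx (vec 1%:M) *m vec (theta x i k)^T
     = (i == k)%:R *: (adjmx (vec 1%:M) *m vec x^T).
  rewrite -[x in LHS]trmxK -theta_vec mulmxA -[t i k]adjmxK -adjmxM tadj.
  by rewrite adjmxZ rmorph_nat -scalemxAl.
rewrite !vec_adj_vec !adjmx1 !mul1mx !mxtrace_tr => /matrixP/(_ ord0 ord0).
by rewrite !mxE !mulr1n.
Qed.

Lemma theta_isometry x y j k :
  \sum_i \tr (adjmx (theta x i j) *m theta y i k) = (j == k)%:R * \tr (adjmx x *m y).
Proof.
have trT (a b : B) : \tr (adjmx a^T *m b^T) = \tr (adjmx a *m b).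
  rewrite -mxtrace_tr trmx_mul trmxK mxtrace_mulC; congr (\tr (_ *m _)).
  by apply/matrixP=> p q; rewrite !mxE.
have [u1 _] := tu; have /matrixP/(_ j k) := u1; rewrite mxE => e.
have := congr1 (fun z => adjmx (vec x^T) *m (z *m vec y^T)) e.
rewrite mulmx_suml mulmx_sumr.
have -> : \sum_i adjmx (vec x^T) *m (badj t j i * t i k *m vec y^T)
   = (\sum_i \tr (adjmx (theta x i j) *m theta y i k))%:M.
  rewrite raddf_sum; apply: eq_bigr => i _ /=.
  rewrite badjE -mulmxE -mulmxA mulmxA -adjmxM !theta_vec vec_adj_vec trT.
  by rewrite !trmxK.
have -> : adjmx (vec x^T) *m ((1%:M : 'M['M[C]_(d * d)]_n) j k *m vec y^T)
   = ((j == k)%:R * \tr (adjmx x *m y))%:M.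
  rewrite mxE; case: (j == k); last by rewrite mulr0n mul0mx mulmx0 mul0r raddf0.
  by rewrite mulr1n mul1mx vec_adj_vec trT mul1r.
by move/matrixP/(_ ord0 ord0); rewrite !mxE !mulr1n.
Qed.

Lemma theta_onto (w : 'I_n -> B) : exists b : 'I_n -> B,
  forall i, w i = \sum_k theta (b k) i k.
Proof.
have [_ u2] := tu.
exists (fun k => (unvec (\sum_l adjmx (t l k) *m vec (w l)^T))^T) => i.
apply: trmx_inj; apply: (can_inj (@vecK _ _)).
have vs I (r : seq I) (f : I -> B) : vec (\sum_(j <- r) f j)^T = \sum_(j <- r) vec (f j)^T.
  apply: (big_morph (fun z : B => vec z^T)) => [u v|]; first by rewrite linearD vecD.
  by apply/matrixP=> a b; rewrite !mxE.
rewrite vs.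
under eq_bigr do rewrite -theta_vec unvecK mulmx_sumr.
rewrite exchange_big /=.
transitivity (\sum_l (t *m badj t) i l *m vec (w l)^T).
  rewrite u2 (bigD1 i) //= big1 ?addr0 => [|l li].
    by rewrite mxE eqxx mul1mx.
  by rewrite mxE eq_sym (negPf li) mulr0n mul0mx.
apply: eq_bigr => l _; rewrite mxE mulmx_suml; apply: eq_bigr => k _.
by rewrite badjE -mulmxE mulmxA.
Qed.

(** Row j of either side has the same trace against every column of every theta y: on
    the left by multiplicativity and invariance of the trace, on the right because t
    is unitary. These columns span. *)
Lemma theta_adj x : theta (adjmx x) = badj (theta x).
Proof.
apply/eqP; rewrite -subr_eq0; apply/eqP/matrixP=> j i0; rewrite [RHS]mxE.
pose z i : B := (theta (adjmx x) - badj (theta x)) j i.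
have [b bE] := theta_onto (fun i => adjmx (z i)).
have z0 : \sum_i \tr (z i *m adjmx (z i)) = 0.
  transitivity (\sum_k (\sum_i \tr (theta (adjmx x) j i *m theta (b k) i k)
      - \sum_i \tr (adjmx (theta x i j) *m theta (b k) i k))).
    transitivity (\sum_i \sum_k \tr (z i *m theta (b k) i k)).
      by apply: eq_bigr => i _; rewrite bE mulmx_sumr raddf_sum.
    rewrite exchange_big; apply: eq_bigr => k _; rewrite -sumrB.
    apply: eq_bigr => i _; rewrite /z mxE [(- badj _) _ _]mxE badjE.
    by rewrite mulmxBl raddfB.
  rewrite big1 // => k _; rewrite theta_isometry -raddf_sum /=.
  have -> : \sum_i theta (adjmx x) j i *m theta (b k) i k
      = theta (adjmx x *m b k) j k by rewrite thetaM mxE.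
  by rewrite theta_tr subrr.
apply: mxtrace_adj_mul_eq0; apply/eqP.
have := z0; move/eqP; rewrite psumr_eq0 => [|i _]; last exact: mxtrace_adj_mul_ge0.
by move=> /allP/(_ i0 (mem_index_enum i0)).
Qed.

End Star.

(** * The fibre functor of a simple Frobenius monoid *)

Section Twist.
Variables (R : realType) (G : compact_quantum_group R) (d : nat) (d0 : (0 < d)%N).
Local Notation C := R[i].
Local Notation B := 'M[C]_d.
Variable beta : forall X : rep G, 'M[B]_(rdim X).
Hypothesis betaU : forall X, bunitary (beta X).

Variable bmap : forall X Y : rep G, rhom X Y -> 'M[C]_(rdim Y, rdim X).
Variable bmul : forall X Y : rep G, 'M[C]_(rdim (rtens X Y), rdim X * rdim Y).
Variable bunit : 'M[C]_(rdim (@rone R G), 1).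
Hypothesis bmapE : forall (X Y : rep G) (f : rhom X Y),
  scblk d (hmx f) *m beta X = beta Y *m scblk d (bmap f).
Hypothesis bmulE : forall X Y : rep G,
  beta X *t beta Y = beta (rtens X Y) *m scblk d (bmul X Y).
Hypothesis bunitE : 1%:M = beta rone *m scblk d bunit.

Let cancel X m (x y : 'M[C]_(rdim X, m)) :
  beta X *m scblk d x = beta X *m scblk d y -> x = y.
Proof.
have [b1 _] := betaU X; move=> xy; apply: (scblk_inj d0).
by rewrite -[LHS]mul1mx -b1 -mulmxA xy mulmxA b1 mul1mx.
Qed.

Let bmap_adj X Y (f : rhom X Y) : bmap (radj f) = adjmx (bmap f).
Proof.
apply: cancel; rewrite -bmapE /=.
have := congr1 (@badj R d _ _) (bmapE f); rewrite !badjM !badj_scblk => e.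
have [x1 x2] := betaU X; have [y1 y2] := betaU Y.
rewrite -[LHS]mul1mx -x2 -!mulmxA; congr (_ *m _).
by rewrite mulmxA e -mulmxA y1 mulmx1.
Qed.

Let unitary_of m n (x : 'M[C]_(m, n)) (w : 'M[B]_(m, n)) (b : 'M[B]_m) :
  bunitary b -> bunitary w -> w = b *m scblk d x -> unitary x.
Proof.
move=> bU wU wE; have [b1 b2] := bU; apply/(bunitary_scblk _ d0).
have -> : scblk d x = badj b *m w by rewrite wE mulmxA b1 mul1mx.
by apply: bunitaryM => //; apply: bunitary_badj.
Qed.

Let scblk_castid m m' (e : m = m') :
  scblk d (castmx (e, erefl) 1%:M : 'M[C]_(m', m)) = castmx (e, erefl) 1%:M.
Proof. exact: map_castid. Qed.

(** All axioms can be checked after multiplication by beta, where they become those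
    of the canonical fibre functor. *)
Definition twisted_fibre_functor : fibre_functor G.
Proof.
refine (@FibreFunctor R G (@rdim R G) bmap bmul bunit _ _ _ _ _ _ _ _ _ _).
- by move=> X; apply: cancel; rewrite -bmapE /= !scblk1 mul1mx mulmx1.
- move=> X Y Z g f; apply: cancel; rewrite -bmapE /= !scblkM mulmxA -bmapE.
  by rewrite -!mulmxA -bmapE.
- move=> X Y k f g; apply: cancel; rewrite -bmapE /= !scblk_lin.
  by rewrite mulmxDl mulmxDr bscaleMl bscaleMr !bmapE.
- exact: bmap_adj.
- move=> X Y; apply: (unitary_of (betaU (rtens X Y)) _ (bmulE X Y)).
  exact: bunitary_tens.
- apply: (unitary_of (betaU rone) _ bunitE).
  by rewrite /bunitary badj1 mulmx1.
- move=> X X' Y Y' f g; apply: cancel; rewrite !scblkM mulmxA -bmapE /=.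
  rewrite -mulmxA -bmulE mulmxA -bmulE scblk_mul_tensmx tensmx_mul_scblk.
  by rewrite !bmapE.
- move=> X Y Z; apply: cancel; rewrite !scblkM !mulmxA -bmapE /=.
  rewrite -[_ *m beta _ *m scblk d (bmul (rtens X Y) Z)]mulmxA -bmulE.
  rewrite -[LHS]mulmxA tensmx_mul_scblk scblk1 mulmx1 -bmulE.
  rewrite -(bmulE X (rtens Y Z)) tensmx_mul_scblk scblk1 mulmx1 -bmulE scblk_castid.
  apply: castid_intertwines.
  by rewrite -tensmxA castmx_comp castmx_id.
- move=> X; apply: cancel; rewrite !scblkM !mulmxA -bmapE /=.
  rewrite -[_ *m scblk d (bmul rone X)]mulmxA -(bmulE rone X).
  rewrite -[LHS]mulmxA tensmx_mul_scblk scblk1 mulmx1 -bunitE scblk_castid.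
  apply: castid_intertwines; exact: tens1mx.
- move=> X; apply: cancel; rewrite !scblkM !mulmxA -bmapE /=.
  rewrite -[_ *m scblk d (bmul X rone)]mulmxA -(bmulE X rone).
  rewrite -[LHS]mulmxA tensmx_mul_scblk scblk1 mulmx1 -bunitE scblk_castid.
  apply: castid_intertwines; exact: tensmx1.
Defined.

Definition twist : pretrans twisted_fibre_functor (canonical_fibre_functor G) :=
  @PreTrans R G twisted_fibre_functor (canonical_fibre_functor G) d
    (fun X => unblk (beta X)).

Lemma bcomp_twist X : bcomp twist X = beta X.
Proof. exact: unblkK. Qed.

Lemma is_upt_twist : is_upt twist.
Proof.
apply/is_uptP; split=> [X|X Y f|X Y|]; rewrite !bcomp_twist //=.
- by rewrite -bmulE scblk1 mul1mx.
- by rewrite -bunitE scblk1.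
Qed.

End Twist.

(** By Schur's lemma for M_d, conjugating by b turns an intertwiner into a matrix of
    scalars. *)
Lemma descend (R : realType) d n m (Th : 'M[R[i]]_d -> 'M['M[R[i]]_d]_n)
    (b : 'M['M[R[i]]_d]_n) (w : 'M['M[R[i]]_d]_(n, m)) :
  (0 < d)%N -> bunitary b -> (forall x, Th x *m b = b *m x%:M) ->
  (forall x, Th x *m w = w *m x%:M) -> exists e, w = b *m scblk d e.
Proof.
move=> d0 [b1 b2] bT wT.
have [|e eE] := @scalar_commutant R d _ _ (badj b *m w) d0; last first.
  by exists e; rewrite -eE mulmxA b2 mul1mx.
move=> x; rewrite -[RHS]mulmxA -wT.
have -> : Th x = b *m x%:M *m badj b by rewrite -bT -mulmxA b2 mulmx1.
by rewrite !mulmxA b1 mul1mx.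
Qed.

Section Surjectivity.
Variables (R : realType) (G : compact_quantum_group R).
Local Notation C := R[i].
Local Notation F := (canonical_fibre_functor G).

(** The double dual has the blocks of T, so the monoid of the dual of T acts by
    x |-> T x T*, with the transposition that theta takes care of. *)
Lemma dual_pants_isomorphic (F' : fibre_functor G) (T : pretrans F' F) :
  is_upt T -> (0 < hdim T)%N -> forall (A : simple_frobenius F)
    (f : 'M[C]_(hdim T * hdim T, hdim (pobj A))),
  unitary f -> f *m pmul A = pair_mul (hdim T) *m (f *t f) ->
  f *m punit A = pair_unit (hdim T) ->
  (forall X i k x, f *m bcomp (pobj A) X i k *m adjmx f *m vec x
     = vec ((bcomp T X *m (x^T)%:M *m badj (bcomp T X)) i k)^T) ->
  exists a : upt_from F, sf_isomorphic (pants a) A.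
Proof.
move=> TU d0 A f fu fM f1 fA; have [f1' f2'] := fu.
have dU : is_upt (pt_dual T) by apply: is_upt_dual => //; right.
pose a : upt_from F := @UPTFrom R G F _ (UPT dU) d0.
exists a; apply: (@sf_isomorphicP _ _ _ (pants a) A (adjmx f)).
- exact: unitary_adj.
- apply/modificationP => X i k /=.
  have -> : bcomp (pt_tens (pt_dual T) (pt_dual (pt_dual T))) X i k
      = f *m bcomp (pobj A) X i k *m adjmx f.
    apply: vec_inj_mx => x; rewrite fA; apply: etrans (@pants_vec R G F' (pt_dual T) X i k x) _; congr vec.
    apply: trmx_inj; rewrite trmxK raddf_sum mxE /=; apply: eq_bigr => j _.
    rewrite !bcomp_dual mulmx_scalarE badjE.
    by rewrite !trmx_mul adj_cjmx cj_adjmx !trmxK tr_cjmx mulmxA.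
  by rewrite !mulmxA f1' mul1mx.
- have [x1 x2] := unitary_tens fu fu.
  transitivity (adjmx f *m (pair_mul (hdim T) *m (f *t f)) *m adjmx (f *t f)).
    by rewrite -!mulmxA x2 mulmx1.
  by rewrite -fM mulmxA f1' mul1mx adjmx_tens.
- transitivity (adjmx f *m pair_unit (hdim T)); first by [].
  by rewrite -f1 mulmxA f1' mul1mx.
Qed.

(** Transported to M_d, the monoid acts by star-homomorphisms theta. Choosing for
    every X a unitary b X that diagonalizes theta, the matrices f (b X) and
    b X *t b Y again intertwine theta with the diagonal action, since theta is natural
    and monoidal in X. They descend to scalar matrices, which form a fibre functor. *)
Lemma exists_pants (A : simple_frobenius F) :
  exists a : upt_from F, sf_isomorphic (pants a) A.
Proof.
case: A => A AF AS; have [d [d0 [f [fu [/= fM f1 _]]]]] := AS.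
have [AU /modificationP AM /modificationP A1 _] := AF.
have [f1' f2'] := fu.
have [phi [phiE phic phia]] := unitary_conjugation (unitary_adj fu).
pose t X := map_mx phi (bcomp (pobj A) X).
have tE X i k : t X i k = f *m bcomp (pobj A) X i k *m adjmx f.
  by rewrite mxE phiE adjmxK.
have [a1 a2 a3 a4] := (is_uptP _).1 AU.
have tU X : bunitary (t X) by apply: map_bunitary.
have phis m n (x : 'M[C]_(m, n)) : map_mx phi (scblk _ x) = scblk _ x.
  exact: map_scblk.
have tn X Y (g : rhom X Y) : scblk _ (hmx g) *m t X = t Y *m scblk _ (hmx g).
  by rewrite -[scblk _ _]phis -!map_mxM; congr map_mx; exact: a2.
have tt X Y : t (rtens X Y) = t X *t t Y.
  by rewrite /t -map_mxT; congr map_mx; have := a3 X Y; rewrite /= scblk1 mulmx1 mul1mx.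
have to : t rone = 1%:M.
  by rewrite /t; have := a4; rewrite /= scblk1 mulmx1 => ->; rewrite map_mx1.
have tM X i k : t X i k *m pair_mul d = pair_mul d *m \sum_l t X l k *t t X i l.
  rewrite tE -!mulmxA.
  have -> : adjmx f *m pair_mul d = pmul A *m adjmx (f *t f).
    have [x1 x2] := unitary_tens fu fu.
    rewrite -[LHS]mulmx1 -x2 mulmxA -[adjmx f *m _ *m _]mulmxA -fM mulmxA.
    by rewrite f1' mul1mx.
  rewrite [bcomp _ _ _ _ *m (pmul A *m _)]mulmxA AM mulmxA mulmxA fM -!mulmxA.
  congr (_ *m _); rewrite bcomp_tens mulmx_suml mulmx_sumr; apply: eq_bigr => l _.
  by rewrite !tE adjmx_tens !tensmx_mul !mulmxA.
have t1 X i k : t X i k *m pair_unit d = (i == k)%:R *: pair_unit d.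
  rewrite tE -{1}f1 !mulmxA -[_ *m adjmx f *m f]mulmxA f1' mulmx1 -mulmxA A1.
  rewrite mulmxA f1 bcomp_id mxE; case: (i == k).
    by rewrite mulmx1 scale1r.
  by rewrite mulr0n mulmx0 scale0r.
have /(_ _)/cid ex X : exists b : 'M['M[C]_d]_(rdim X), bunitary b /\
    forall x, theta (t X) x *m b = b *m x%:M.
  apply: block_representation => //.
  - exact: thetaD.
  - exact: thetaZ.
  - exact: (thetaM d0 (tM X)).
  - exact: (theta1 d0 (t1 X)).
  - exact: (theta_adj d0 (tU X) (tM X) (t1 X)).
pose b X := sval (ex X).
have bU X : bunitary (b X) := (svalP (ex X)).1.
have bth X x : theta (t X) x *m b X = b X *m x%:M := (svalP (ex X)).2 x.
(* A matrix w with theta w = w x is b X times a matrix of scalars. *)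
have desc X m (w : 'M['M[C]_d]_(rdim X, m)) :
    (forall x, theta (t X) x *m w = w *m x%:M) -> exists e, w = b X *m scblk d e.
  exact: (descend d0 (bU X) (bth X)).
have vinj (x y : 'M[C]_d) : vec x^T = vec y^T -> x = y.
  by move/(can_inj (@vecK _ _)); apply: trmx_inj.
have thE X x i k : vec (theta (t X) x i k)^T = t X i k *m vec x^T.
  by rewrite theta_vec trmxK.
have vs I (r : seq I) (c : I -> C) (g : I -> 'M[C]_d) :
    vec (\sum_(j <- r) c j *: g j)^T = \sum_(j <- r) c j *: vec (g j)^T.
  rewrite (big_morph (fun z : 'M[C]_d => vec z^T) (id1 := 0) (op1 := +%R)).
  - by apply: eq_bigr => j _; rewrite linearZ vecZ.
  - by move=> x y; rewrite linearD vecD.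
  - by apply/matrixP=> p q; rewrite !mxE.
have bthE X x i k : \sum_j theta (t X) x i j * b X j k = b X i k * x.
  by have /matrixP/(_ i k) := bth X x; rewrite mxE mulmx_scalarE.
have /(_ _ _ _)/cid bhom X Y (g : rhom X Y) :
    exists e : 'M[C]_(rdim Y, rdim X), scblk d (hmx g) *m b X = b Y *m scblk d e.
  apply: desc => x; rewrite -[RHS]mulmxA -bth !mulmxA; congr (_ *m _).
  apply/matrixP=> i k; rewrite !mxE.
  under eq_bigr do rewrite mul_scblkE.
  under [RHS]eq_bigr do rewrite scblk_mulE.
  apply: vinj; rewrite !vs.
  under eq_bigr do rewrite thE.
  under [RHS]eq_bigr do rewrite thE.
  have /matrixP/(_ i k) := tn X Y g; rewrite !mxE => e.
  transitivity ((\sum_j t Y i j * scblk _ (hmx g) j k) *m vec x^T).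
    by rewrite mulmx_suml; apply: eq_bigr => j _; rewrite mul_scblkE scalemxAl.
  rewrite -e mulmx_suml; apply: eq_bigr => j _.
  by rewrite scblk_mulE scalemxAl.
have /(_ _ _)/cid bmul X Y : exists e : 'M[C]_(rdim (rtens X Y), rdim X * rdim Y),
    b X *t b Y = b (rtens X Y) *m scblk d e.
  apply: (desc (rtens X Y)) => x; apply/matrixP=> i k.
  case: (mxtens_indexP i) => i0 i1; case: (mxtens_indexP k) => k0 k1.
  rewrite mulmx_scalarE tensmxE mxE mxtens_sum exchange_big /=.
  rewrite -mulrA -[b Y _ _ * x]bthE mulr_sumr; apply: eq_bigr => j1 _.
  rewrite mulrA -[b X _ _ * _]bthE mulr_suml; apply: eq_bigr => j0 _.
  rewrite tensmxE mulrA; congr (_ * _ * _).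
  by apply: vinj; rewrite (thE (rtens X Y)) !thE mulmxA tt tensmxE.
have /cid bone : exists e : 'M[C]_(rdim (@rone R G), 1), 1%:M = b rone *m scblk d e.
  apply: (desc rone) => x; rewrite mulmx1 mul1mx.
  apply/matrixP=> i k; apply: vinj; rewrite thE to !mxE.
  by case: (i == k); rewrite ?mulr1n ?mul1mx // !mulr0n mul0mx trmx0 vec0.
have mapE X Y (g : rhom X Y) := svalP (bhom Y X g).
have mulE X Y := svalP (bmul X Y).
have oneE := svalP bone.
pose T := twist d0 bU mapE mulE oneE.
have TU : is_upt T := is_upt_twist d0 bU mapE mulE oneE.
apply: (@dual_pants_isomorphic _ T TU d0 (SimpleFrobenius AF AS) f fu fM f1).
move=> X i k x; rewrite -[f *m _ *m _]tE (theta_vec (t X)) bcomp_twist.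
congr (vec _^T); rewrite -bth -mulmxA; have [_ ->] := bU X.
by rewrite mulmx1.
Qed.

End Surjectivity.

(** * The bijection *)

Section ClassLemmas.
Variables (T : Type) (r : T -> T -> Prop).
Hypotheses (r_refl : forall x, r x x) (r_sym : forall x y, r x y -> r y x).
Hypothesis r_trans : forall x y z, r x y -> r y z -> r x z.

Lemma class_of_eq x y : class_of r x = class_of r y <-> r x y.
Proof.
split=> [xy|xy].
  have /(congr1 (fun P => P y)) : sval (class_of r x) = sval (class_of r y) by rewrite xy.
  by move=> /= ->.
apply/eq_exist/funext => z; apply/propext; split=> [xz|yz].
  exact/r_trans/xz/r_sym.
exact/r_trans/yz.
Qed.

Lemma class_of_onto (c : classes r) : exists x, class_of r x = c.
Proof. by case: c => P [x Px]; exists x; apply/esym/eq_exist. Qed.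

End ClassLemmas.

Theorem corollary5p8 (R : realType) (G : compact_quantum_group R) :
  let F := canonical_fibre_functor G in
  exists Phi : upt_classes F -> frobenius_classes F,
    bijective Phi /\
    forall a : upt_from F, exists A : simple_frobenius F,
      sf_data A = pair_of_pants (trans a) /\
      Phi (class_of (@upt_equivalent R G F) a)
      = class_of (@sf_isomorphic R G F) A.
Proof.
move=> F.
have equivP a1 a2 : upt_equivalent a1 a2 <-> sf_isomorphic (pants a1) (pants a2).
  by split; [apply: equivalent_pants|apply: pants_equivalent].
have sfE A B : class_of (@sf_isomorphic R G F) A = class_of (@sf_isomorphic R G F) B
    <-> sf_isomorphic A B.
  apply: class_of_eq; [exact: sf_refl|exact: sf_sym|exact: sf_trans].
have uptE a1 a2 : class_of (@upt_equivalent R G F) a1 = class_of (@upt_equivalent R G F) a2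
    <-> upt_equivalent a1 a2.
  apply: class_of_eq => [x|x y|x y z]; rewrite !equivP.
  - exact: sf_refl.
  - exact: sf_sym.
  - exact: sf_trans.
have repu (c : upt_classes F) := cid (class_of_onto c).
have repf (c : frobenius_classes F) := cid (class_of_onto c).
pose Phi c := class_of (@sf_isomorphic R G F) (pants (sval (repu c))).
have PhiE a : Phi (class_of (@upt_equivalent R G F) a) = class_of (@sf_isomorphic R G F) (pants a).
  by apply/sfE/equivP/uptE; apply: (svalP (repu _)).
exists Phi; split; last by move=> a; exists (pants a); split.
have inv (c : frobenius_classes F) : {a | class_of (@sf_isomorphic R G F) (pants a) = c}.
  apply: cid; have [A <-] := class_of_onto c; have [a aA] := exists_pants A.
  by exists a; apply/sfE.
exists (fun c => class_of (@upt_equivalent R G F) (sval (inv c))) => c.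
  rewrite -(svalP (repu c)); apply/uptE/equivP/sfE; rewrite (svalP (inv _)).
  by rewrite PhiE.
by rewrite PhiE; apply: (svalP (inv c)).
Qed.
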